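(* Let $\mathcal A$ be a linear homogeneous first-order differential operator with constant coefficients satisfying the constant rank property and property (ZL), and let $K\subset\mathbb R^d$ be compact. Then $H_{\mathcal A}(K)=\mathcal M^{\mathcal Aqc}(K)$.
   Context: $\mathcal A u=\sum_{k=1}^N A_k\partial_k u$ for $u:\mathbb R^N\to\mathbb R^d$, $A_k:\mathbb R^d\to\mathbb R^l$ linear. Constant rank property: $\dim\ker(\sum_k\xi_kA_k)$ is constant in $\xi\in S^{N-1}$. $T_N=\mathbb R^N/\mathbb Z^N$; $u\in\ker\mathcal A$ means $\mathcal Au=0$ in the sense of distributions. Property (ZL): there is $C=C(\mathcal A)$ such that for every sequence $u_n\in L^1(T_N,\mathbb R^d)\cap\ker\mathcal A$ for which some $L>0$ satisfies $\int_{\{|u_n|>L\}}|u_n|\to0$, there exist $v_n\in L^1(T_N,\mathbb R^d)\cap\ker\mathcal A$ with $\|v_n\|_{L^\infty}\le CL$ and $\|v_n-u_n\|_{L^1}\to0$. A continuous $f:\mathbb R^d\to\mathbb R$ is $\mathcal A$-quasiconvex if $f(x)\le\int_{T_N}f(x+\phi)$ for all $x$ and all $\phi\in C^\infty(T_N,\mathbb R^d)$ with $\int_{T_N}\phi=0$, $\mathcal A\phi=0$. $\mathcal M(\mathbb R^d)$ is the space of finite signed Radon measures, $\langle\mu,f\rangle=\int f\,d\mu$, and $\mathrm{id}$ is the identity map. A weak$*$ measurable map $\nu:T_N\to\mathcal M(\mathbb R^d)$ is generated by a sequence $v_j:T_N\to\mathbb R^d$ if $f(v_j)\overset{*}{\rightharpoonup}\langle\nu_x,f\rangle$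 in $L^\infty(T_N)$ for all $f\in C_0(\mathbb R^d)$; it is an $\mathcal A$-$\infty$-Young measure if it is generated by a bounded sequence in $L^\infty(T_N,\mathbb R^d)$ with $\mathcal Av_j=0$. $H_{\mathcal A}(K)$ is the set of $\nu_0\in\mathcal M(\mathbb R^d)$ such that the constant map $x\mapsto\nu_0$ is an $\mathcal A$-$\infty$-Young measure and $\mathrm{spt}\,\nu_0\subset K$. $\mathcal M^{\mathcal Aqc}(K)=\{\nu\in\mathcal M(\mathbb R^d):\nu\ge0,\ \mathrm{spt}\,\nu\subset K,\ \langle\nu,f\rangle\ge f(\langle\nu,\mathrm{id}\rangle)\text{ for all continuous }\mathcal A\text{-quasiconvex }f\}$. *)

(* Defs.v *)
From HB Require Import structures.
From mathcomp Require Import all_boot all_order all_algebra.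
From mathcomp Require Import all_classical all_reals all_analysis.
Set Implicit Arguments. Unset Strict Implicit. Unset Printing Implicit Defensive.
Import Order.TTheory GRing.Theory Num.Theory.
Import numFieldNormedType.Exports.
Local Open Scope classical_set_scope.
Local Open Scope ring_scope.

Section rV_measurable.
Context (R : realType) (n : nat).
Let coors : 'I_n -> 'rV[R]_n -> R := fun i x => x ord0 i.
Let rV_set0 : g_sigma_preimage coors set0.
Proof. exact: sigma_algebra0. Qed.
Let rV_setC A : g_sigma_preimage coors A -> g_sigma_preimage coors (~` A).
Proof. exact: sigma_algebraC. Qed.
Let rV_bigcup (F : _^nat) : (forall i, g_sigma_preimage coors (F i)) ->
  g_sigma_preimage coors (\bigcup_i (F i)).
Proof. exact: sigma_algebra_bigcup. Qed.
HB.instance Definition _ := @isMeasurable.Build default_measure_display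
  'rV[R]_n (g_sigma_preimage coors) rV_set0 rV_setC rV_bigcup.
End rV_measurable.

(** The points of R^n are row vectors 'rV[R]_n; they carry the normed
    (Euclidean topology) structure of mathcomp-analysis and, by the instance
    above, the Borel sigma-algebra (generated by the coordinate maps). *)

Section Defs.
Context (R : realType).

Definition enorm (n : nat) (x : 'rV[R]_n) : R := Num.sqrt (\sum_i x ord0 i ^+ 2).

(** Lebesgue measure on the Borel sets of R^n, by iterated integration
    (Tonelli): lebR 0 is the unit point mass, and
    lebR (n+1) A = \int_R lebR n {v | (t,v) \in A} dt. *)
Fixpoint lebR (n : nat) : set 'rV[R]_n -> \bar R :=
  match n with
  | 0 => fun A : set 'rV[R]_0 => if `[< A 0 >] then 1%E else 0%E
  | n'.+1 => fun A : set 'rV[R]_(n'.+1) =>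
      (\int[@lebesgue_measure R]_t
          @lebR n' [set v : 'rV[R]_n' | A (row_mx ((t : R)%:M : 'rV[R]_1) v)])%E
  end.

(** The torus T_N = R^N / Z^N is identified with the fundamental cell
    [0,1)^N; its Haar measure is Lebesgue measure restricted to the cell. *)
Definition cell (N : nat) : set 'rV[R]_N :=
  [set x | forall i, 0 <= x ord0 i < 1].

Definition tint (N : nat) (f : 'rV[R]_N -> R) : \bar R :=
  (\int[@lebR N]_(x in @cell N) (f x)%:E)%E.

Definition L1 (N m : nat) (u : 'rV[R]_N -> 'rV[R]_m) : Prop :=
  measurable_fun (@cell N) u /\
  (@lebR N).-integrable (@cell N) (fun x => (enorm (u x))%:E).

Definition L1R (N : nat) (g : 'rV[R]_N -> R) : Prop :=
  (@lebR N).-integrable (@cell N) (fun x => (g x)%:E).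

Definition Linf_le (N m : nat) (u : 'rV[R]_N -> 'rV[R]_m) (M : R) : Prop :=
  almost_everywhere (@lebR N) (fun x => @cell N x -> enorm (u x) <= M).

Definition evec (N : nat) (k : 'I_N) : 'rV[R]_N := delta_mx ord0 k.

Fixpoint iterD (N : nat) (V : normedModType R) (s : seq 'rV[R]_N)
    (f : 'rV[R]_N -> V) : 'rV[R]_N -> V :=
  match s with
  | [::] => f
  | v :: s' => 'D_v (iterD s' f)
  end.

Definition smooth (N : nat) (V : normedModType R) (f : 'rV[R]_N -> V) : Prop :=
  forall (s : seq 'rV[R]_N) (x : 'rV[R]_N), differentiable (iterD s f) x.

(** Z^N-periodic, i.e. a function on T_N *)
Definition periodic (N : nat) (T : Type) (f : 'rV[R]_N -> T) : Prop :=
  forall (x : 'rV[R]_N) (z : 'I_N -> int), f (x + \row_i (z i)%:~R) = f x.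

Definition smooth_torus (N m : nat) (f : 'rV[R]_N -> 'rV[R]_m) : Prop :=
  smooth f /\ periodic f.

(** The operator  A u = sum_k A_k d_k u ; the linear maps A_k : R^d -> R^l
    are d x l matrices acting on row vectors: A_k u = u *m A k. *)

(** A u = 0 in the sense of distributions on T_N (u \in L^1):
    < A u , psi > = - \int_{T_N} sum_k (A_k u) . d_k psi = 0
    for every test function psi \in C^infty(T_N, R^l). *)
Definition kerA (N d l : nat) (A : 'I_N -> 'M[R]_(d, l))
    (u : 'rV[R]_N -> 'rV[R]_d) : Prop :=
  forall psi : 'rV[R]_N -> 'rV[R]_l, smooth_torus psi ->
    tint (fun x => \sum_k ((u x *m A k) *m ('D_(evec k) psi x)^T) ord0 ord0) = 0%E.

Definition symbol (N d l : nat) (A : 'I_N -> 'M[R]_(d, l)) (xi : 'rV[R]_N)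
  : 'M[R]_(d, l) := \sum_k xi ord0 k *: A k.

(** constant rank property: dim ker (sum_k xi_k A_k) is constant on S^{N-1};
    ker M = {u | u *m M = 0}, whose row space is that of kermx M. *)
Definition constant_rank (N d l : nat) (A : 'I_N -> 'M[R]_(d, l)) : Prop :=
  forall xi xi' : 'rV[R]_N, enorm xi = 1 -> enorm xi' = 1 ->
    \rank (kermx (symbol A xi)) = \rank (kermx (symbol A xi')).

Definition propZL (N d l : nat) (A : 'I_N -> 'M[R]_(d, l)) : Prop :=
  exists C : R,
  forall (u : nat -> 'rV[R]_N -> 'rV[R]_d) (L : R),
    (forall n, L1 (u n) /\ kerA A (u n)) ->
    0 < L ->
    (fun n => (\int[@lebR N]_(x in @cell N `&` [set x | (L < enorm (u n x))%R])
                 (enorm (u n x))%:E)%E) @ \oo --> 0%E ->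
    exists v : nat -> 'rV[R]_N -> 'rV[R]_d,
      (forall n, L1 (v n) /\ kerA A (v n) /\ Linf_le (v n) (C * L)) /\
      (fun n => tint (fun x => enorm (v n x - u n x))) @ \oo --> 0%E.

Definition Aquasiconvex (N d l : nat) (A : 'I_N -> 'M[R]_(d, l))
    (f : 'rV[R]_d -> R) : Prop :=
  forall (x : 'rV[R]_d) (phi : 'rV[R]_N -> 'rV[R]_d),
    smooth_torus phi ->
    (forall i, tint (fun y => phi y ord0 i) = 0%E) ->
    (forall y, \sum_k ('D_(evec k) phi y *m A k) = 0) ->
    ((f x)%:E <= tint (fun y => f (x + phi y)%R))%E.

Definition C0 (d : nat) (f : 'rV[R]_d -> R) : Prop :=
  continuous f /\
  forall e : R, 0 < e -> exists r : R, forall x, r < enorm x -> `|f x| < e.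

(** finite signed Radon measures on R^d = charges on the Borel sets of R^d *)

Definition pairing (d : nat) (mu : {charge set 'rV[R]_d -> \bar R}) (f : 'rV[R]_d -> R) : \bar R :=
  let h := cid (Hahn_decomposition mu) in
  let h' := cid (projT2 h) in
  (\int[jordan_pos (projT2 h')]_x (f x)%:E
   - \int[jordan_neg (projT2 h')]_x (f x)%:E)%E.

Definition barycenter (d : nat) (mu : {charge set 'rV[R]_d -> \bar R}) : 'rV[R]_d :=
  \row_i fine (pairing mu (fun x => x ord0 i)).

(** support: complement of the union of the open |mu|-null sets *)
Definition null_on (d : nat) (mu : {charge set 'rV[R]_d -> \bar R}) (U : set 'rV[R]_d) : Prop :=
  forall B, measurable B -> B `<=` U -> mu B = 0%E.

Definition spt (d : nat) (mu : {charge set 'rV[R]_d -> \bar R}) : set 'rV[R]_d :=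
  ~` \bigcup_(U in [set U | open U /\ null_on mu U]) U.

(** the constant map x |-> nu0 is an A-infty-Young measure: it is generated
    by a bounded sequence v_j in L^infty(T_N, R^d) with A v_j = 0, i.e.
    f(v_j) -> <nu0, f> weakly* in L^infty(T_N) for all f \in C_0(R^d). *)
Definition const_AYoung (N d l : nat) (A : 'I_N -> 'M[R]_(d, l))
    (nu0 : {charge set 'rV[R]_d -> \bar R}) : Prop :=
  exists v : nat -> 'rV[R]_N -> 'rV[R]_d,
    (forall j, L1 (v j) /\ kerA A (v j)) /\
    (exists M : R, forall j, Linf_le (v j) M) /\
    forall f, C0 f -> forall g : 'rV[R]_N -> R, L1R g ->
      (fun j => tint (fun x => f (v j x) * g x)) @ \oo -->
        (pairing nu0 f * tint g)%E.

Definition H_A (N d l : nat) (A : 'I_N -> 'M[R]_(d, l)) (K : set 'rV[R]_d)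
  : set ({charge set 'rV[R]_d -> \bar R}) :=
  [set nu0 : {charge set 'rV[R]_d -> \bar R} | const_AYoung A nu0 /\ spt nu0 `<=` K].

Definition M_Aqc (N d l : nat) (A : 'I_N -> 'M[R]_(d, l)) (K : set 'rV[R]_d)
  : set ({charge set 'rV[R]_d -> \bar R}) :=
  [set nu : {charge set 'rV[R]_d -> \bar R} | (forall B, measurable B -> (0 <= nu B)%E) /\ spt nu `<=` K /\
     forall f : 'rV[R]_d -> R, continuous f -> Aquasiconvex A f ->
       ((f (barycenter nu))%:E <= pairing nu f)%E].

End Defs.

(* Main.v *)
Require Import Defs.
From HB Require Import structures.
From mathcomp Require Import all_boot all_order all_algebra.
From mathcomp Require Import all_classical all_reals all_analysis.
From mathcomp Require Import measurable_realfun ring lra.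
Import Order.TTheory GRing.Theory Num.Theory.
Import numFieldNormedType.Exports.
Local Open Scope classical_set_scope.
Local Open Scope ring_scope.
Set Implicit Arguments. Unset Strict Implicit. Unset Printing Implicit Defensive.

(** A Young measure satisfies Jensen's inequality because the Fejer means of a
    bounded field [v] with [A v = 0] are its mean plus a mean zero trigonometric
    field in the kernel, an admissible competitor for quasiconvexity.

    Conversely, let [x0] be the barycenter of a measure [nu] with Jensen's
    inequality.  By constant rank, [1_E psi(n x)] is close in [L^1] to a
    trigonometric field of the kernel when [psi] is one: a vector annihilated by
    the symbol at [q] is a limit of vectors annihilated by the symbol at
    [n q + k].  This gluing makes [Qf x = inf_phi \int f(x + phi)] quasiconvex,
    and makes the set of moment vectors [(\int f_j(x0 + phi))_j] nearly convex.
    Were the moments of [nu] separated from that set by [c], the function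
    [F = \sum_j c_j f_j] would satisfy [\int F d nu < QF x0], whereas Jensen for
    [QF <= F] gives the opposite inequality.  Taking for the [f_j] a fine
    partition of unity and the excess [(|x| - rho - 1)^+] yields fields [phi_n]
    whose distributions tend to [nu] and with small mass far away; dilating
    [phi_n], truncating by (ZL) and averaging the oscillations gives the
    generating sequence. *)

(** * Borel sets of R^n *)

(** Two obstacles shape the argument. First, separation controls finitely many averages only, and
    gives no bound on the fields it produces. Hence [excess] is one of the moments. It is unbounded,
    and [F] must be bounded below for its envelope to be finite, so its weight in the separating
    functional has to be nonnegative; in return its average is bounded from above only, which is
    exactly what (ZL) asks for. Second, cutting off a field of the kernel leaves the kernel.
    Constant rank repairs this one frequency at a time, without Fourier multipliers: the symbol at
    [n q + k] is [n] times a perturbation of size [1/n], of equal rank, of the symbol at [q]. That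
    is why the constructions use trigonometric fields; Fejer means lead back to smooth and bounded
    fields, and positivity of their kernel preserves sup bounds. Since [lebR] is a bare set
    function, integration is moved to a probability [torusP] that agrees with it on the cell.
    Invariance of [torusP] under translations and dilations is read off the vanishing of its nonzero
    Fourier modes. *)

Section rV_borel.
Context (R : realType) (n : nat).
Implicit Types (x : 'rV[R]_n).

Lemma measurable_coord (i : 'I_n) :
  measurable_fun setT (fun x : 'rV[R]_n => x ord0 i).
Proof.
move=> _ Y mY; rewrite setTI; apply: sub_sigma_algebra => /=.
rewrite -bigcup_seq/=; exists i => /=; first by rewrite mem_index_enum.
by exists Y => //; rewrite setTI.
Qed.

(** The sets with measurable preimage form a sigma-algebra, so it is enough to test generators,
    which are preimages under coordinates. *)
Lemma measurable_rVP d (T : measurableType d) (D : set T) (u : T -> 'rV[R]_n) :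
  measurable_fun D u <-> forall i, measurable_fun D (fun t => u t ord0 i).
Proof.
split=> [mu i|mu].
  exact: (@measurable_comp _ _ _ _ _ _ setT _ _ _ _ _ (measurable_coord i) mu).
move=> mD Y mY; suff : image_set_system D u measurable Y by [].
apply: mY; split; last first.
  move=> B; rewrite -bigcup_seq => -[i _ [C mC <-]]; rewrite setTI.
  exact: (mu i mD C mC).
split=> [|B|F] /=; rewrite /image_set_system/=.
- by rewrite preimage_set0 setI0.
- rewrite setTD preimage_setC => mB.
  rewrite (_ : D `&` _ = D `\` (D `&` u @^-1` B)); first exact: measurableD.
  by rewrite setDIr setDv set0U setDE.
- by move=> mF; rewrite preimage_bigcup setI_bigcupr; exact: bigcupT_measurable.
Qed.

(** The norm of a row vector is here the maximum norm. Most estimates use it; [enorm] enters where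
    the definitions impose it, and is compared by [norm_le_enorm] and [enorm_le]. *)
Lemma norm_rV_le (x : 'rV[R]_n) (r : R) :
  0 <= r -> (`|x| <= r) = [forall i, `|x ord0 i| <= r].
Proof.
move=> r0; rewrite [`|x|]/Num.norm /= mx_normrE.
apply/bigmax_leP/forallP => [[_ h] i|h]; first exact: (h (ord0, i)).
by split=> // -[i j] _ /=; rewrite ord1.
Qed.

Lemma norm_rV_lt (x : 'rV[R]_n) (r : R) :
  0 < r -> (`|x| < r) = [forall i, `|x ord0 i| < r].
Proof.
move=> r0; rewrite [`|x|]/Num.norm /= mx_normrE.
apply/bigmax_ltP/forallP => [[_ h] i|h]; first exact: (h (ord0, i)).
by split=> // -[i j] _ /=; rewrite ord1.
Qed.

Lemma coord_le_norm (x : 'rV[R]_n) i : `|x ord0 i| <= `|x|.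
Proof. by have := lexx `|x|; rewrite {1}norm_rV_le// => /forallP. Qed.

Lemma measurable_norm_rV_ball (a : 'rV[R]_n) (r : R) :
  measurable [set x : 'rV[R]_n | `|a - x| < r].
Proof.
have [r0|r0] := leP r 0.
  rewrite (_ : mkset _ = set0)//; apply/seteqP; split => // x /= h.
  by have := le_lt_trans (normr_ge0 _) (lt_le_trans h r0); rewrite ltxx.
rewrite (_ : mkset _ = \bigcap_(i in [set: 'I_n])
    [set x : 'rV[R]_n | `|a ord0 i - x ord0 i| < r]); last first.
  apply/seteqP; split=> x /=; rewrite norm_rV_lt//.
    by move=> /forallP h i _; have := h i; rewrite !mxE.
  by move=> h; apply/forallP => i; rewrite !mxE; exact: h.
apply: fin_bigcap_measurable => // i _.
rewrite (_ : mkset _ = (fun x : 'rV[R]_n => x ord0 i) @^-1`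
    [set y | `|a ord0 i - y| < r])// -[X in measurable X]setTI.
apply: measurable_coord => //; apply: open_measurable.
exact: (@ball_open _ R^o (a ord0 i) r).
Qed.

Lemma open_rV_measurable (U : set 'rV[R]_n) : open U -> measurable U.
Proof.
move=> oU.
(* Cubes with rational centre and radius: countably many, and each a finite intersection of
   coordinate conditions. *)
pose B (p : 'rV[rat]_n * rat) : set 'rV[R]_n :=
  [set x | `|map_mx ratr p.1 - x| < ratr p.2].
rewrite (_ : U = \bigcup_(p in [set p | B p `<=` U]) B p); last first.
  apply/seteqP; split=> [x Ux|x [p /= + Bpx]]; last exact.
  have /nbhs_ballP[e /= e0 eU] := open_nbhs_nbhs (conj oU Ux).
  have [r /andP[r0 re]] : exists r : rat, 0 < (ratr r : R) < e / 2.
    have := @rat_in_itvoo R 0 (e / 2); rewrite divr_gt0// => /(_ isT)[r].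
    by rewrite in_itv/= => h; exists r.
  have hq i : exists q : rat, `|x ord0 i - ratr q| < (ratr r : R).
    have := @rat_in_itvoo R (x ord0 i - ratr r) (x ord0 i + ratr r).
    rewrite ltrBlDr -addrA ltrDl addr_gt0// => /(_ isT)[q].
    rewrite in_itv/= => /andP[q1 q2]; exists q.
    rewrite ltr_norml; apply/andP; split; lra.
  pose q i := sval (cid (hq i)).
  exists (\row_i q i, r) => /=; last first.
    rewrite /B/= norm_rV_lt//; apply/forallP => i; rewrite !mxE distrC.
    exact: (svalP (cid (hq i))).
  move=> y; rewrite /B/= norm_rV_lt// => /forallP hy; apply: eU.
  rewrite -ball_normE/= norm_rV_lt//; apply/forallP => i.
  have := hy i; have := svalP (cid (hq i)); rewrite !mxE -/(q i) => h1 h2.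
  rewrite (le_lt_trans (ler_distD (ratr (q i)) _ _))// (splitr e).
  by apply: ltrD; [exact: lt_trans re|exact: lt_trans re].
rewrite bigcup_mkcond; apply: countable_bigcupT_measurable => // p.
by case: ifPn => // _; exact: measurable_norm_rV_ball.
Qed.

Lemma continuous_rV_measurable (f : 'rV[R]_n -> R) :
  continuous f -> measurable_fun setT f.
Proof.
move=> /continuousP cf; apply: (measurability _ (RGenOpens.measurableE R)).
move=> _ [_ [a [b ->] <-]]; rewrite setTI.
by apply: open_rV_measurable; apply: cf; exact: interval_open.
Qed.

End rV_borel.

Section halfspaces.
Context (R : realType) (n : nat).

Lemma measurable_halfspace (i : 'I_n) (b : R) :
  measurable [set x : 'rV[R]_n | b < x ord0 i].
Proof.
rewrite -[X in measurable X]setTI.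
rewrite (_ : [set x | _] = (fun x : 'rV[R]_n => x ord0 i) @^-1` `]b, +oo[%classic).
  exact: measurable_coord.
by apply/seteqP; split => x /=; rewrite in_itv/= andbT.
Qed.

(** Provides generators simple enough for their indicators to be approximated by hand, once by
    trigonometric polynomials and once by bounded continuous functions. *)
Lemma measurable_rV_halfspaces : @measurable _ 'rV[R]_n `<=`
  <<s [set A | exists (i : 'I_n) (b : R), A = [set x : 'rV[R]_n | b < x ord0 i]] >>.
Proof.
set G := [set A | _].
apply: smallest_sub; first exact: smallest_sigma_algebra.
move=> A; rewrite -bigcup_seq => -[i _ [B mB <-]].
have sG : sigma_algebra setT (image_set_system setT
    (fun x : 'rV[R]_n => x ord0 i) (<<s G >>)).
  by apply: sigma_algebra_image; exact: smallest_sigma_algebra.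
suff /(_ B) : @measurable _ (measurableTypeR R) `<=` image_set_system setT
    (fun x : 'rV[R]_n => x ord0 i) (<<s G >>) by exact.
move=> C; change (((@ocitv R).-sigma).-measurable C -> image_set_system setT
    (fun x : 'rV[R]_n => x ord0 i) (<<s G >>) C).
rewrite RGenOInfty.measurableE; move: C; apply: smallest_sub => //.
move=> _ [b ->]; apply: sub_sigma_algebra; exists i, b; rewrite setTI.
by apply/seteqP; split => x /=; rewrite in_itv/= andbT.
Qed.

End halfspaces.

(** * Haar measure of the torus as a probability on R^N *)

Section integral_restriction.
Local Open Scope ereal_scope.
Context d (T : measurableType d) (R : realType).
Variables (m : set T -> \bar R) (P : {measure set T -> \bar R}).
Variables (D : set T) (mD : measurable D).
Hypothesis mP : forall B, measurable B -> m (B `&` D) = P B.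

Import HBNNSimple.

Let nnint (mu : set T -> \bar R) (f : T -> \bar R) := ereal_sup [set sintegral mu h |
  h in [set h : {nnsfun T >-> R} | forall x, (h x)%:E <= f x]].

Let nnint_restr (f : T -> \bar R) : (forall x, 0 <= f x) ->
  nnint m (f \_ D) = nnint P f.
Proof.
move=> f0.
have hD (h : {nnsfun T >-> R}) :
    (forall t, ~ D t -> h t = 0%R) -> sintegral m h = sintegral P h.
  move=> hf; apply: eq_fsbigr => x _.
  (* The level set of 0 may leave [D] but has weight 0; the other level sets lie in [D], where [m]
     and [P] agree. *)
  have [->|x0] := eqVneq x 0%R; first by rewrite !mul0e.
  rewrite -mP// (setIidl _)// => t /= htx; apply: contrapT => /hf ht0.
  by move: x0; rewrite -htx ht0 eqxx.
apply/eqP; rewrite eq_le; apply/andP; split.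
  apply: ge_ereal_sup => _ [h /= hf <-]; apply: ereal_sup_ubound; exists h.
    move=> t; apply: (le_trans (hf t)); rewrite patchE; case: ifPn => //.
  apply/esym/hD => t nDt; have := hf t; rewrite patchE.
  rewrite memNset// lee_fin => ht0; apply/eqP; rewrite eq_le ht0/=.
  exact: fun_ge0.
apply: ge_ereal_sup => _ [h /= hf <-]; apply: ereal_sup_ubound.
have E : (proj_nnsfun h mD : T -> R) = h \_ D by rewrite mrestrict.
exists (proj_nnsfun h mD).
  change (forall t, ((proj_nnsfun h mD : T -> R) t)%:E <= (f \_ D) t) => t.
  by rewrite E !patchE; case: ifPn.
rewrite hD; last by move=> t nDt; rewrite E patchE memNset.
apply: eq_fsbigr => x _.
have [->|x0] := eqVneq x 0%R; first by rewrite !mul0e.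
congr (_ * _); rewrite -mP// -(mP (B := h @^-1` _))//; congr (m _).
by rewrite E; apply/seteqP; split => t [+ Dt]; rewrite /= patchE mem_set.
Qed.

(** [m] need not be a measure. The integral is built from suprema of [sintegral] over simple
    functions, and those lying below a nonnegative function restricted to [D] vanish off [D], so [m]
    matters on measurable subsets of [D] only. *)
Lemma integral_restr (f : T -> \bar R) :
  \int[m]_(x in D) f x = \int[P]_x f x.
Proof.
rewrite /integral funepos_restrict funeneg_restrict patch_setT.
by rewrite -!/(nnint _ _) !nnint_restr.
Qed.

Lemma integrable_restr (f : T -> \bar R) :
  m.-integrable D f <-> measurable_fun D f /\ P.-integrable setT (f \_ D).
Proof.
have E : \int[m]_(x in D) `|f x| = \int[P]_x `|(f \_ D) x|.
  rewrite -integral_restr /integral.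
  suff -> : (fun x => `|f x|) \_ D = (fun x => `|(f \_ D) x|) \_ D by [].
  by apply/funext => x; rewrite !patchE; case: ifPn.
split=> [/integrableP[mf foo]|[mf /integrableP[mf' foo]]].
  split => //; apply/integrableP; split; last by rewrite -E.
  by apply/(measurable_restrictT f mD).
by apply/integrableP; split => //; rewrite E.
Qed.

End integral_restriction.

Section torus_probability.
Context (R : realType).

Definition unif01 : set (measurableTypeR R) -> \bar R :=
  mrestr (@lebesgue_measure R) (measurable_itv `[0%R, 1%R[).
HB.instance Definition _ := Measure.on unif01.

Let unif01_setT : unif01 setT = 1%E.
Proof.
by rewrite /unif01 /mrestr setTI /= lebesgue_measure_itv/= lte_fin ltr01 oppr0 adde0.
Qed.
HB.instance Definition _ := Measure_isProbability.Build _ _ _ unif01 unif01_setT.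

Definition rowcons n (p : measurableTypeR R * 'rV[R]_n) : 'rV[R]_n.+1 :=
  row_mx ((p.1 : R)%:M : 'rV[R]_1) p.2.

Lemma rowcons0 n p : @rowcons n p ord0 ord0 = p.1.
Proof.
have -> : (ord0 : 'I_n.+1) = lshift n (ord0 : 'I_1) by exact: val_inj.
by rewrite [LHS]row_mxEl mxE eqxx mulr1n.
Qed.

Lemma rowconsS n p i : @rowcons n p ord0 (lift ord0 i) = p.2 ord0 i.
Proof.
have -> : lift ord0 i = rshift 1 i by exact: val_inj.
by rewrite [LHS]row_mxEr.
Qed.

Lemma measurable_rowcons n : measurable_fun setT (@rowcons n).
Proof.
apply/measurable_rVP => i; have [->|] := eqVneq i ord0.
  by under eq_fun do rewrite rowcons0; exact: measurable_fst.
rewrite eq_sym => /unlift_some[j -> _]; under eq_fun do rewrite rowconsS.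
exact: (measurableT_comp (measurable_coord j) measurable_snd).
Qed.
HB.instance Definition _ n :=
  isMeasurableFun.Build _ _ _ _ (@rowcons n) (@measurable_rowcons n).

(** The recursion copies that of [lebR], so that the two can be compared slice by slice, while
    sigma-additivity and Fubini come from the product construction. *)
Fixpoint torusP n : probability 'rV[R]_n R :=
  match n with
  | 0 => dirac (0 : 'rV[R]_0)
  | n'.+1 => distribution ((unif01 : probability _ _) \x torusP n')%E
               (@rowcons n' : {mfun _ >-> _})
  end.

Lemma measurable_cell n : measurable (@cell R n).
Proof.
rewrite (_ : @cell R n = \bigcap_(i in [set: 'I_n])
   ((fun x : 'rV[R]_n => x ord0 i) @^-1` `[0, 1[%classic)); last first.
  by apply/seteqP; split => x h i; [move=> _|]; have := h i; rewrite /= in_itv; exact.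
apply: fin_bigcap_measurable => // i _.
by rewrite -[X in measurable X]setTI; apply: measurable_coord.
Qed.

(** For [t] in [0,1) the slice at [t] is the slice of [B] within the lower cell, and otherwise it is
    empty; this is the restriction built into [unif01]. *)
Lemma lebR_cell n (B : set 'rV[R]_n) :
  measurable B -> lebR (B `&` @cell R n) = torusP n B.
Proof.
elim: n B => [|n ih] B mB /=.
  rewrite diracE; case: asboolP => [[h _]|h]; first by rewrite mem_set.
  rewrite memNset// => B0; apply: h; split => //.
  by move=> [].
rewrite /distribution /pushforward /product_measure1.
rewrite -(integral_restr (m := @lebesgue_measure R) (P := unif01) (D := `[0%R, 1%R[%classic))//.
rewrite [RHS]integral_mkcond; apply: eq_integral => t _.
rewrite patchE; case: ifPn => [|/negP]; rewrite in_setE/= in_itv/= => t01.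
  rewrite -ih; last first.
    rewrite -[X in measurable X]setTI.
    have /measurable_xsection : measurable (@rowcons n @^-1` B).
      by rewrite -[X in measurable X]setTI; exact: measurable_rowcons.
    by move=> /(_ t); rewrite setTI.
  congr (lebR _); apply/seteqP; split => v /=.
    move=> [h1 h2]; split; first by rewrite /xsection/= in_setE.
    by move=> i; have := h2 (lift ord0 i); rewrite (rowconsS (t, v)).
  rewrite /xsection /= in_setE => -[h1 h2]; split => // i.
  have [->|] := eqVneq i ord0; first by rewrite (rowcons0 (t, v)).
  by rewrite eq_sym => /unlift_some[j -> _]; rewrite (rowconsS (t, v)); exact: h2.
rewrite (_ : mkset _ = set0); last first.
  apply/seteqP; split => // v /= [_ /(_ ord0)].
  by rewrite (rowcons0 (t, v)).
by rewrite -(set0I (@cell R n)) ih// measure0.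
Qed.

Lemma tintE n (f : 'rV[R]_n -> R) : tint f = (\int[torusP n]_x (f x)%:E)%E.
Proof.
exact: (integral_restr (@measurable_cell n) (@lebR_cell n)).
Qed.

Lemma torusP_cell n : torusP n (~` @cell R n) = 0%E.
Proof.
rewrite -lebR_cell; last by apply: measurableC; exact: measurable_cell.
by rewrite setICl -(set0I (@cell R n)) lebR_cell.
Qed.

Lemma lebR_ge0 n (B : set 'rV[R]_n) : (0 <= lebR B)%E.
Proof.
elim: n B => [|n ih] B /=; first by case: ifP.
exact: integral_ge0.
Qed.

(** Measurability plays no part: the integral of a nonnegative function is a supremum over simple
    functions below it. Monotonicity has to be proved because [lebR] carries no measure
    structure. *)
Lemma lebR_le n (B C : set 'rV[R]_n) : B `<=` C -> (lebR B <= lebR C)%E.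
Proof.
elim: n B C => [|n ih] B C BC /=.
  by case: asboolP => [/BC|] h; case: asboolP.
rewrite !ge0_integralTE//; try by move=> t; exact: lebR_ge0.
apply: le_ereal_sup => _ [h /= hB <-]; exists h => //= t.
apply: (le_trans (hB t)); apply: ih => v; exact: BC.
Qed.

End torus_probability.

(** * Density of algebras of bounded functions in L^1 *)

Lemma bernoulli_ge (R : realType) (x : R) n : -1 <= x ->
  1 + n%:R * x <= (1 + x) ^+ n.
Proof.
move=> x1; elim: n => [|n ih]; first by rewrite mul0r addr0 expr0.
rewrite exprS; apply: (@le_trans _ _ ((1 + x) * (1 + n%:R * x))); last first.
  by rewrite ler_wpM2l//; lra.
have n0 : 0 <= n%:R :> R by [].
rewrite -natr1 -subr_ge0.
rewrite (_ : _ - _ = n%:R * x ^+ 2); last by ring.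
by rewrite mulr_ge0// sqr_ge0.
Qed.

Lemma cvg_natM_expr (R : realType) (r : R) : 0 <= r -> r < 1 ->
  n%:R * r ^+ n @[n --> \oo] --> (0 : R).
Proof.
move=> r0 r1; have [->|rn0] := eqVneq r 0.
  apply: cvg_near_cst; near=> n; rewrite expr0n.
  by rewrite (_ : (n == 0)%N = false) ?mulr0//; apply/eqP/eqP; near: n; exists 1%N => // -[].
have {}r0 : 0 < r by rewrite lt_neqAle eq_sym rn0.
(* As [r^n = q^n q^n], it suffices to bound [n q^n], and Bernoulli gives [n t <= (1 + t)^n = q^-n]
   for [t = 1/q - 1]. *)
pose q := Num.sqrt r.
have q0 : 0 < q by rewrite sqrtr_gt0.
have qr : q ^+ 2 = r by rewrite sqr_sqrtr// ltW.
have q1 : q < 1 by rewrite -(sqrtr1 R) ltr_sqrt.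
pose t := q^-1 - 1; have t0 : 0 < t by rewrite subr_gt0 invf_gt1.
have h n : 0 <= n%:R * r ^+ n <= t^-1 * q ^+ n.
  rewrite mulr_ge0 ?exprn_ge0 ?(ltW r0)//=.
  rewrite -qr -exprM mulnC exprM expr2 mulrA ler_wpM2r//; first exact/exprn_ge0/ltW.
  rewrite -ler_pdivlMr ?exprn_gt0// -ler_pdivrMl ?invr_gt0// invrK -exprVn.
  apply: le_trans (_ : 1 + n%:R * t <= _); first by rewrite mulrC lerDr.
  apply: le_trans (bernoulli_ge n _) _; first by lra.
  by rewrite /t addrC subrK.
apply: (@squeeze_cvgr _ _ _ _ (fun=> 0) (fun n => t^-1 * q ^+ n)).
- by apply: nearW.
- exact: cvg_cst.
- rewrite -(mulr0 t^-1); apply: cvgMr; apply: cvg_expr.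
  by rewrite ger0_norm// ltW.
Unshelve. all: by end_near. Qed.

(* [steep n h] tends to the indicator of [h > 0] on [-1, 1], everywhere. *)
Definition steep (R : realType) n (h : R) : R :=
  (1 - ((1 - h) / 2) ^+ n) ^+ (n * 2 ^ n).

Section steep.
Context (R : realType).

Lemma steep_01 n (h : R) : -1 <= h <= 1 -> 0 <= steep n h <= 1.
Proof.
move=> /andP[h1 h2]; have s0 : 0 <= (1 - h) / 2 by lra.
have s1 : (1 - h) / 2 <= 1 by lra.
have := exprn_ile1 n s0 s1; have := exprn_ge0 n s0 => a b.
by rewrite exprn_ge0 ?exprn_ile1//; lra.
Qed.

(** With [s = (1 - h) / 2], the exponent [m = n 2^n] times [s^n] is [n (2 s)^n], and [2 s < 1]
    exactly when [h > 0]. Bernoulli gives the lower bound [1 - n (2 s)^n] in that case, and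
    otherwise [(1 - x)^m <= (1 + x)^-m <= 1 / (n + 1)] with [x = s^n]. *)
Lemma cvg_steep (h : R) : -1 <= h <= 1 ->
  steep n h @[n --> \oo] --> ((0 < h)%R%:R : R).
Proof.
move=> h11; have /andP[h1 h2] := h11.
set s := (1 - h) / 2; have s0 : 0 <= s by rewrite /s; lra.
have s1 : s <= 1 by rewrite /s; lra.
have E n : (n * 2 ^ n)%:R * s ^+ n = n%:R * (2 * s) ^+ n.
  by rewrite natrM natrX [in RHS]exprMn mulrA.
case: (ltP 0 h) => h0.
  apply: (@squeeze_cvgr _ _ _ _ (fun n => 1 - n%:R * (2 * s) ^+ n) (fun=> 1)).
  - apply: nearW => n; rewrite (andP (steep_01 n h11)).2 andbT /steep -/s -E.
    rewrite -mulrN; apply: bernoulli_ge.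
    by rewrite lerN2 exprn_ile1.
  - rewrite -[X in _ --> X]subr0; apply: cvgB; first exact: cvg_cst.
    by apply: cvg_natM_expr; rewrite /s; lra.
  - exact: cvg_cst.
apply: (@squeeze_cvgr _ _ _ _ (fun=> 0) (fun n => n.+1%:R^-1)).
- apply: nearW => n; rewrite (andP (steep_01 n h11)).1 /=.
  set m := (n * 2 ^ n)%N; set x := s ^+ n.
  have x0 : 0 <= x by exact: exprn_ge0.
  have x1 : x <= 1 by exact: exprn_ile1.
  have h3 : n.+1%:R <= (1 + x) ^+ m.
    apply: le_trans (bernoulli_ge m _); last by lra.
    rewrite -natr1 addrC lerD2l /m /x E ler_peMr// exprn_ege1//.
    by rewrite /s; lra.
  rewrite /steep -/s -/x -/m -[leRHS]mul1r ler_pdivlMr//.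
  apply: le_trans (_ : (1 - x) ^+ m * (1 + x) ^+ m <= _).
    by apply: ler_wpM2l => //; apply: exprn_ge0; lra.
  rewrite -exprMn; apply: exprn_ile1; nra.
- exact: cvg_cst.
- exact: cvg_harmonic.
Qed.

End steep.

Section L1_density.
Local Open Scope ereal_scope.
Context d (T : measurableType d) (R : realType).
Variable mu : {finite_measure set T -> \bar R}.
Variable AA : set (T -> R).
Hypothesis AAm : forall p, AA p -> measurable_fun setT p.
Hypothesis AAb : forall p, AA p -> exists B : R, forall x, (`|p x| <= B)%R.
Hypothesis AAc : forall c : R, AA (fun=> c).
Hypothesis AAD : forall p q, AA p -> AA q -> AA (fun x => p x + q x)%R.
Hypothesis AAM : forall p q, AA p -> AA q -> AA (fun x => p x * q x)%R.

Definition dense_in (f : T -> R) := measurable_fun setT f /\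
  forall e : R, (0 < e)%R ->
    exists2 p, AA p & \int[mu]_x (`|f x - p x|%R)%:E <= e%:E.

Lemma measurable_absB (f g : T -> R) : measurable_fun setT f ->
  measurable_fun setT g -> measurable_fun setT (fun x => (`|f x - g x|%R)%:E).
Proof.
move=> mf mg; apply/measurable_EFinP; apply: measurableT_comp => //.
exact: measurable_funB.
Qed.

Lemma L1_triangle (f g h : T -> R) : measurable_fun setT f ->
  measurable_fun setT g -> measurable_fun setT h ->
  \int[mu]_x (`|f x - h x|%R)%:E <=
  \int[mu]_x (`|f x - g x|%R)%:E + \int[mu]_x (`|g x - h x|%R)%:E.
Proof.
move=> mf mg mh; rewrite -ge0_integralD//; try exact: measurable_absB.
  apply: ge0_le_integral => //; try exact: measurable_absB.
    by apply: emeasurable_funD; exact: measurable_absB.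
  by move=> x _; rewrite -EFinD lee_fin ler_distD.
Qed.

Lemma dense_in_AA p : AA p -> dense_in p.
Proof.
move=> Ap; split => [|e e0]; first exact: AAm.
by exists p => //; rewrite integral0_eq ?lee_fin ?ltW// => x _; rewrite subrr normr0.
Qed.

Lemma dense_in_L1 (f : T -> R) : measurable_fun setT f ->
  (forall e : R, (0 < e)%R ->
    exists2 g, dense_in g & \int[mu]_x (`|f x - g x|%R)%:E <= e%:E) ->
  dense_in f.
Proof.
move=> mf h; split => // e e0; have e2 : (0 < e / 2)%R by rewrite divr_gt0.
have [g [mg /(_ _ e2)[p Ap pe]] ge] := h _ e2.
exists p => //; apply: le_trans (L1_triangle mf mg (AAm Ap)) _.
by rewrite (splitr e) EFinD leeD.
Qed.

Lemma dense_in_lim (f : nat -> T -> R) (g : T -> R) (B : R) :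
  (forall n, dense_in (f n)) -> (forall n x, (`|f n x| <= B)%R) ->
  (forall x, f n x @[n --> \oo] --> g x) -> dense_in g.
Proof.
move=> df fB fg.
have mf n : measurable_fun setT (f n) := (df n).1.
have mg : measurable_fun setT g.
  by apply: (measurable_fun_cvg mf) => x _; exact: fg.
apply: dense_in_L1 => // e e0.
have iB : mu.-integrable setT (EFin \o cst B).
  by apply: finite_measure_integrable_cst.
have := @dominated_convergence _ _ _ mu setT measurableT (fun n => EFin \o f n)
  (EFin \o g) (EFin \o cst B).
case=> //.
- by move=> n; apply/measurable_EFinP.
- by apply/measurable_EFinP.
- by apply: aeW => x _; apply: cvg_EFin; [exact: nearW|exact: fg].
- by apply: aeW => x n _ /=; rewrite lee_fin.
move=> _ /fine_cvgP[fin /cvgrPdist_lt/(_ _ e0)] + _.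
move=> /(filterI fin)[n _ /(_ n (leqnn _))][/= h1]; rewrite sub0r normrN => h2.
exists (f n) => //.
rewrite (eq_integral (fun x => `|(f n x)%:E - (g x)%:E|)); last first.
  by move=> x _; rewrite -EFinB/= distrC.
by rewrite -(fineK h1) lee_fin (le_trans (ler_norm _))// ltW.
Qed.

Lemma dense_inD f g : dense_in f -> dense_in g -> dense_in (fun x => f x + g x)%R.
Proof.
move=> [mf df] [mg dg]; split=> [|e e0]; first exact: measurable_funD.
have e2 : (0 < e / 2)%R by rewrite divr_gt0.
have [p Ap pe] := df _ e2; have [q Aq qe] := dg _ e2.
exists (fun x => p x + q x)%R; first exact: AAD.
have mp := AAm Ap; have mq := AAm Aq.
rewrite (splitr e) EFinD; apply: le_trans (leeD pe qe).
rewrite -ge0_integralD//; try exact: measurable_absB.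
apply: ge0_le_integral => //.
- by apply: measurable_absB; exact: measurable_funD.
- by apply: emeasurable_funD; exact: measurable_absB.
- move=> x _; rewrite -EFinD lee_fin; apply: le_trans (ler_normD _ _).
  by rewrite opprD addrACA.
Qed.

(** The approximant [q] of [g] is chosen after [p], since its accuracy depends on a bound for [p]
    that [B] does not control. *)
Lemma dense_inM f g (B : R) : dense_in f -> dense_in g ->
  (forall x, (`|g x| <= B)%R) -> dense_in (fun x => f x * g x)%R.
Proof.
move=> [mf df] [mg dg] gB; split=> [|e e0]; first exact: measurable_funM.
wlog B0 : B gB / (0 < B)%R.
  by move=> /(_ (`|B| + 1)%R); apply => [x|]; [|exact: ltr_pwDr];
    rewrite (le_trans (gB x))// (le_trans (ler_norm _))// lerDl.
have e1 : (0 < e / 2 / B)%R by rewrite !divr_gt0.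
have [p Ap pe] := df _ e1; have [C0 pC0] := AAb Ap.
pose C := (`|C0| + 1)%R; have C0' : (0 < C)%R by exact: ltr_pwDr.
have pC x : (`|p x| <= C)%R.
  by rewrite (le_trans (pC0 x))// (le_trans (ler_norm _))// lerDl.
have e2 : (0 < e / 2 / C)%R by rewrite !divr_gt0.
have [q Aq qe] := dg _ e2.
exists (fun x => p x * q x)%R; first exact: AAM.
have mp := AAm Ap; have mq := AAm Aq.
apply: (@le_trans _ _ (\int[mu]_x (B%:E * (`|f x - p x|%R)%:E +
                                  C%:E * (`|g x - q x|%R)%:E))).
  apply: ge0_le_integral => //.
  - by apply: measurable_absB; exact: measurable_funM.
  - by apply: emeasurable_funD; apply: emeasurable_funM => //; exact: measurable_absB.
  move=> x _; rewrite -!EFinM -EFinD lee_fin.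
  rewrite (_ : f x * g x - p x * q x =
    g x * (f x - p x) + p x * (g x - q x))%R; last by ring.
  apply: le_trans (ler_normD _ _) _; rewrite !normrM.
  by apply: lerD; exact: ler_wpM2r.
rewrite ge0_integralD//.
- rewrite !ge0_integralZl//; try exact: measurable_absB; try by rewrite lee_fin ltW.
  rewrite (splitr e) [leRHS]EFinD; apply: leeD.
    rewrite -(@divfK _ B _ (e / 2))%R ?gt_eqF// mulrC EFinM.
    by apply: lee_pmul => //; [rewrite lee_fin ltW|exact: integral_ge0].
  rewrite -(@divfK _ C _ (e / 2))%R ?gt_eqF// mulrC EFinM.
  by apply: lee_pmul => //; [rewrite lee_fin ltW|exact: integral_ge0].
- by move=> x _; rewrite mule_ge0// lee_fin ltW.
- by apply: emeasurable_funM => //; exact: measurable_absB.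
- by move=> x _; rewrite mule_ge0// lee_fin ltW.
- by apply: emeasurable_funM => //; exact: measurable_absB.
Qed.

(** The functions [steep n \o h] are polynomials in [h], hence in [AA], and converge boundedly to
    the indicator. *)
Lemma dense_in_gt0 (h : T -> R) : AA h -> (forall x, -1 <= h x <= 1)%R ->
  dense_in (\1_[set x | (0 < h x)%R]).
Proof.
move=> Ah h1.
apply: (@dense_in_lim (fun n x => steep n (h x)) _ 1%R).
- move=> n; apply: dense_in_AA.
  have AX p m : AA p -> AA (fun x => p x ^+ m)%R.
    move=> Ap; elim: m => [|m ih]; first by under eq_fun do rewrite expr0; exact: AAc.
    by under eq_fun do rewrite exprS; exact: AAM.
  have AB p : AA p -> AA (fun x => 1 - p x)%R.
    move=> Ap; under eq_fun do rewrite -mulN1r.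
    by apply: AAD => //; apply: AAM.
  have A2 : AA (fun x => (1 - h x) / 2)%R by exact: (AAM (AB _ Ah) (AAc _)).
  exact: (AX _ (n * 2 ^ n)%N (AB _ (AX _ n A2))).
- by move=> n x; have /andP[a b] := steep_01 n (h1 x); rewrite ger0_norm.
- move=> x; rewrite indicE (_ : (x \in _) = (0 < h x)%R); first exact: cvg_steep.
  by apply/idP/idP; rewrite in_setE.
Qed.

Let EE : set (set T) := [set A | measurable A /\ dense_in (\1_A)].

Let EEC A : EE A -> EE (~` A).
Proof.
move=> [mA dA]; split; first exact: measurableC.
rewrite (_ : \1_(~` A) = fun x => 1 + -1 * \1_A x)%R; last first.
  apply/funext => x; rewrite !indicE in_setC; case: (x \in A) => /=; ring.
apply: dense_inD; first exact/dense_in_AA/AAc.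
apply: (@dense_inM _ _ 1%R) => //; first exact/dense_in_AA/AAc.
by move=> x; rewrite ger0_norm// indicE; case: (_ \in _).
Qed.

Let EEI A B : EE A -> EE B -> EE (A `&` B).
Proof.
move=> [mA dA] [mB dB]; split; first exact: measurableI.
rewrite indicI; apply: (@dense_inM _ _ 1%R) => // x.
by rewrite ger0_norm// indicE; case: (_ \in _).
Qed.

Let EEU A B : EE A -> EE B -> EE (A `|` B).
Proof. by move=> hA hB; rewrite -(setCK (A `|` B)) setCU; apply/EEC/EEI; exact: EEC. Qed.

Let EEsigma : sigma_algebra setT EE.
Proof.
split.
- split => //; rewrite indic0; exact/dense_in_AA/AAc.
- by move=> A; rewrite setTD; exact: EEC.
move=> F hF; split; first by apply: bigcupT_measurable => i; exact: (hF i).1.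
pose G n := \big[setU/set0]_(i < n) F i.
have hG n : EE (G n).
  rewrite /G; elim: n => [|n ih]; last by rewrite big_ord_recr; exact: EEU.
  by rewrite big_ord0; split => //; rewrite indic0; exact/dense_in_AA/AAc.
apply: (@dense_in_lim (fun n => \1_(G n)) _ 1%R) => [n|n x|x].
- exact: (hG n).2.
- by rewrite ger0_norm// indicE; case: (_ \in _).
- rewrite !indicE; case: (pselect ((\bigcup_i F i) x)) => [h|h].
    have [i _ Fix] := h.
    rewrite (mem_set h); apply: cvg_near_cst; near=> n.
    rewrite indicE mem_set// /G -bigcup_mkord; exists i => //=.
    by near: n; exists i.+1.
  rewrite (memNset h); apply: cvg_near_cst; apply: nearW => n.
  rewrite indicE memNset// /G -bigcup_mkord => -[i _ Fi]; apply: h; by exists i.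
Unshelve. all: by end_near. Qed.

(** The measurable sets with approximable indicator form a sigma-algebra: products of approximants
    handle intersections, and dominated convergence passes from finite to countable unions. *)
Lemma dense_in_indic (G : set (set T)) : @measurable _ T `<=` <<s G >> ->
  (forall A, G A -> measurable A /\ dense_in (\1_A)) ->
  forall A, measurable A -> dense_in (\1_A).
Proof.
move=> mG hG A /mG GA; suff /(_ _ GA)[] : <<s G >> `<=` EE by [].
exact: smallest_sub.
Qed.

Import HBSimple.

Lemma dense_in_integrable (f : T -> R) :
  (forall A, measurable A -> dense_in (\1_A)) ->
  mu.-integrable setT (EFin \o f) -> dense_in f.
Proof.
move=> dA If; have mf : measurable_fun setT f.
  by apply/measurable_EFinP; exact: measurable_int If.
apply: dense_in_L1 => // e e0.
have [g [ig gf /fine_cvgP[fin]]] := approximation_sfun_integrable measurableT If.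
move=> /cvgrPdist_lt/(_ _ e0) /(filterI fin)[n _ /(_ n (leqnn _))][/= h1].
rewrite sub0r normrN => h2.
exists (g n); last first.
  rewrite (eq_integral (fun x => `|(f x)%:E - (g n x)%:E|)); last first.
    by move=> x _; rewrite -EFinB.
  by rewrite -(fineK h1) lee_fin (le_trans (ler_norm _))// ltW.
have -> : (g n : T -> R) = (fun x => \sum_(y <- finmap.enum_fset (fset_set (range (g n))))
    y * \1_(g n @^-1` [set y]) x)%R.
  by apply/funext => x; rewrite {1}fimfunE fsbig_finite.
elim: (finmap.enum_fset _) => [|y s ih].
  by under eq_fun do rewrite big_nil; exact/dense_in_AA/AAc.
under eq_fun do rewrite big_cons; apply: dense_inD; last exact: ih.
apply: (@dense_inM _ _ 1%R); first exact/dense_in_AA/AAc.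
  exact/dA.
by move=> x; rewrite ger0_norm// indicE; case: (_ \in _).
Qed.

End L1_density.

(** * Trigonometric polynomials on the torus *)

Section bounded_Rintegral.
Context d (T : measurableType d) (R : realType) (P : probability T R).
Implicit Types f g : T -> R.

Lemma bounded_integrable f (B : R) : measurable_fun setT f ->
  (forall x, `|f x| <= B) -> P.-integrable setT (EFin \o f).
Proof.
move=> mf fB; apply: measurable_bounded_integrable => //.
  by rewrite (le_lt_trans (probability_le1 _ _))// ltry.
exists B; split; first exact: num_real.
by move=> M BM x _ /=; rewrite (le_trans (fB x))// ltW.
Qed.

Lemma Rintegral_prob_cst (r : R) : \int[P]_x r = r.
Proof. rewrite Rintegral_cst// (_ : _ [set: T] = 1%E) ?mulr1//; exact: probability_setT. Qed.

Lemma EFin_Rintegral f : P.-integrable setT (EFin \o f) ->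
  (\int[P]_x (f x)%:E)%E = (\int[P]_x f x)%:E.
Proof. by move=> fi; rewrite /Rintegral fineK//; exact: integrable_fin_num. Qed.

Lemma Rintegral_dist f g : P.-integrable setT (EFin \o f) ->
  P.-integrable setT (EFin \o g) ->
  (`|\int[P]_x f x - \int[P]_x g x|%R%:E <= \int[P]_x (`|f x - g x|%R)%:E)%E.
Proof.
move=> fi gi.
have fgi : P.-integrable setT (EFin \o (fun x => f x - g x)).
  by rewrite (_ : _ \o _ = (fun x => (EFin \o f) x - (EFin \o g) x)%E)//; exact: integrableB.
rewrite -RintegralB//; apply: (@le_trans _ _ (\int[P]_x `|f x - g x|)%:E).
  by rewrite lee_fin; apply: le_normr_Rintegral.
rewrite -EFin_Rintegral//.
by rewrite (_ : _ \o _ = abse \o (EFin \o (fun x => f x - g x)))//; exact: integrable_abse.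
Qed.

End bounded_Rintegral.

Lemma cosD2pi_int (R : realType) (x : R) (k : int) : cos (x + 2 * pi * k%:~R) = cos x.
Proof.
have h (y : R) (n : nat) : cos (y + 2 * pi * n%:R) = cos y.
  by rewrite -(periodicn (@cosD2pi R) n y); congr (cos _); rewrite -[pi *+ 2]mulr_natl mulr_natr.
case: k => n; first exact: h.
by rewrite NegzE mulrNz mulrN -(h (x - _) n.+1) -pmulrn subrK.
Qed.

Section real_continuous.
Context (R : realType) (T : topologicalType).
Implicit Types f g : T -> R.

Lemma continuous_add f g :
  continuous f -> continuous g -> continuous (fun x => f x + g x).
Proof. by move=> cf cg x; exact: (@continuousD R R^o T f g x (cf x) (cg x)). Qed.

Lemma continuous_mul f g :
  continuous f -> continuous g -> continuous (fun x => f x * g x).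
Proof. by move=> cf cg x; exact: (@continuousM R T f g x (cf x) (cg x)). Qed.

End real_continuous.

Section trig.
Context (R : realType) (N : nat).
Implicit Types (q : 'rV[int]_N) (x : 'rV[R]_N).

Definition dotq q x : R := \sum_i (q ord0 i)%:~R * x ord0 i.

(** A phase replaces complex exponentials: products, translates and derivatives of such modes are
    combinations of such modes, and the sine is the phase [- (pi / 2)]. *)
Definition cosq q (th : R) x : R := cos (2 * pi * dotq q x + th).

Lemma dotqDl q r x : dotq (q + r) x = dotq q x + dotq r x.
Proof. by rewrite -big_split/=; apply: eq_bigr => i _; rewrite mxE intrD mulrDl. Qed.

Lemma dotqNl q x : dotq (- q) x = - dotq q x.
Proof. by rewrite -sumrN; apply: eq_bigr => i _; rewrite mxE mulrNz mulNr. Qed.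

Lemma dotqMnl q n x : dotq (q *+ n) x = n%:R * dotq q x.
Proof.
by rewrite mulr_sumr; apply: eq_bigr => i _; rewrite mulmxnE rmorphMn/= mulrnAl mulr_natl.
Qed.

Lemma dotq0l x : dotq 0 x = 0.
Proof. by rewrite /dotq big1// => i _; rewrite mxE mul0r. Qed.

Lemma dotqDr q x y : dotq q (x + y) = dotq q x + dotq q y.
Proof. by rewrite -big_split/=; apply: eq_bigr => i _; rewrite mxE mulrDr. Qed.

Lemma dotqNr q x : dotq q (- x) = - dotq q x.
Proof. by rewrite -sumrN; apply: eq_bigr => i _; rewrite mxE mulrN. Qed.

Lemma dotqZr q (c : R) x : dotq q (c *: x) = c * dotq q x.
Proof. by rewrite mulr_sumr; apply: eq_bigr => i _; rewrite mxE mulrCA. Qed.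

Lemma dotq_delta q i : dotq q (delta_mx ord0 i) = (q ord0 i)%:~R.
Proof.
rewrite /dotq (bigD1 i)//= mxE !eqxx mulr1 big1 ?addr0// => j ji.
by rewrite mxE eqxx (negbTE ji) mulr0.
Qed.

Lemma cosq_period q th x (z : 'I_N -> int) :
  cosq q th (x + \row_i (z i)%:~R) = cosq q th x.
Proof.
rewrite /cosq dotqDr mulrDr addrAC.
rewrite (_ : dotq q (\row_i _) = (\sum_i q ord0 i * z i)%:~R) ?cosD2pi_int//.
rewrite /dotq (big_morph _ (@intrD R) (erefl : 0%:~R = 0)).
by apply: eq_bigr => i _; rewrite mxE intrM.
Qed.

Lemma cosq_abs q th x : `|cosq q th x| <= 1.
Proof. exact: cos_max. Qed.

Lemma continuous_dotq q : continuous (dotq q).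
Proof.
apply: (@continuous_big R^o 'I_N +%R 0 xpredT _ 'rV[R]_N (index_enum _)
  (fun i x => (q ord0 i)%:~R * x ord0 i)) => [|i _ x]; first exact: add_continuous.
by apply: continuousM; [exact: cst_continuous|exact: coord_continuous].
Qed.

Lemma continuous_cosq q th : continuous (cosq q th).
Proof.
move=> x; apply: continuous_comp; last exact: continuous_cos.
apply: continuousD; last exact: cst_continuous.
by apply: continuousM; [exact: cst_continuous|exact: continuous_dotq].
Qed.

Lemma measurable_cosq q th : measurable_fun setT (cosq q th).
Proof. by apply: continuous_rV_measurable; exact: continuous_cosq. Qed.

Lemma cosqM q th r eta x : cosq q th x * cosq r eta x =
  2^-1 * cosq (q + r) (th + eta) x + 2^-1 * cosq (q - r) (th - eta) x.
Proof.
rewrite /cosq dotqDl dotqDl dotqNl.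
rewrite (_ : _ * (_ + _) + (th + eta) =
  (2 * pi * dotq q x + th) + (2 * pi * dotq r x + eta)); last by ring.
rewrite (_ : _ * (_ - _) + (th - eta) =
  (2 * pi * dotq q x + th) - (2 * pi * dotq r x + eta)); last by ring.
set a := _ + th; set b := _ + eta; rewrite (cosD a b) (cosB a b); lra.
Qed.

Lemma cosq_shift q th x h :
  cosq q th (x + h) = cosq q (2 * pi * dotq q h + th) x.
Proof. by rewrite /cosq dotqDr mulrDr addrA. Qed.

Lemma cosq_scale q th n x : cosq q th (n%:R *: x) = cosq (q *+ n) th x.
Proof. by rewrite /cosq dotqZr dotqMnl. Qed.

Lemma cosq0 th x : cosq 0 th x = cos th.
Proof. by rewrite /cosq dotq0l mulr0 add0r. Qed.

Inductive trig : ('rV[R]_N -> R) -> Prop :=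
| trig0 : trig (fun=> 0)
| trigS p c q th : trig p -> trig (fun x => c * cosq q th x + p x).

Lemma trig_mono c q th : trig (fun x => c * cosq q th x).
Proof. by have := trigS c q th trig0; under eq_fun do rewrite addr0. Qed.

Lemma trigD p p' : trig p -> trig p' -> trig (fun x => p x + p' x).
Proof.
move=> tp tp'; elim: tp => [|{}p c q th tp ih].
  by under eq_fun do rewrite add0r.
by under eq_fun do rewrite -addrA; exact: trigS.
Qed.

Lemma trigZ c p : trig p -> trig (fun x => c * p x).
Proof.
elim=> [|{}p c' q th tp ih].
  by under eq_fun do rewrite mulr0; exact: trig0.
by under eq_fun do rewrite mulrDr mulrA; exact: trigS.
Qed.

Lemma trig_cst c : trig (fun=> c).
Proof.
by have := trig_mono c 0 0; under eq_fun do rewrite cosq0 cos0 mulr1.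
Qed.

Lemma trigM p p' : trig p -> trig p' -> trig (fun x => p x * p' x).
Proof.
move=> tp tp'; elim: tp => [|{}p c q th tp ih].
  by under eq_fun do rewrite mul0r; exact: trig0.
under eq_fun do rewrite mulrDl; apply: trigD => //.
elim: tp' => [|{ih}{}p' c' q' th' tp' ih].
  by under eq_fun do rewrite mulr0; exact: trig0.
under eq_fun do rewrite mulrDr mulrACA cosqM; apply: trigD => //.
by apply: trigZ; apply: trigD; exact: trig_mono.
Qed.

Lemma continuous_trig p : trig p -> continuous p.
Proof.
elim=> [|{}p c q th tp ih]; first exact: cst_continuous.
apply: continuous_add => //; apply: continuous_mul; first exact: cst_continuous.
exact: continuous_cosq.
Qed.

Lemma measurable_trig p : trig p -> measurable_fun setT p.
Proof. by move=> tp; apply: continuous_rV_measurable; exact: continuous_trig. Qed.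

Lemma bounded_trig p : trig p -> exists B : R, forall x, `|p x| <= B.
Proof.
elim=> [|{}p c q th tp [B pB]]; first by exists 0 => x; rewrite normr0.
exists (`|c| + B) => x; apply: le_trans (ler_normD _ _) _; apply: lerD => //.
by rewrite normrM ler_piMr// cosq_abs.
Qed.

Definition tproj (x : 'rV[R]_N) : 'rV[R]_N := \row_i (x ord0 i - (Num.floor (x ord0 i))%:~R).

Lemma tproj_cell x : cell (tproj x).
Proof.
move=> i; rewrite mxE subr_ge0 Num.Theory.floor_le/= ltrBlDl.
by have := Num.Theory.floorD1_gt (x ord0 i); rewrite intrD.
Qed.

Lemma tprojE (T : Type) (f : 'rV[R]_N -> T) x : Defs.periodic f -> f (tproj x) = f x.
Proof.
move=> pf; rewrite -(pf _ (fun i => Num.floor (x ord0 i))); congr (f _).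
by apply/rowP => i; rewrite !mxE subrK.
Qed.

End trig.

(** * Density of trigonometric polynomials in L^1 *)

Section trig_density.
Context (R : realType) (N : nat).

(** [(1 + b) / 2] is the midpoint of the arc from [b] to 1 on the circle, and both ends are at angle
    [pi (1 - b)] from it; the cosine exceeds its value at the ends exactly inside the arc. *)
Lemma cos_gt_arc (b t : R) : 0 <= b < 1 -> 0 <= t < 1 ->
  (cos (pi * (1 - b)) < cos (2 * pi * t - pi * (1 + b))) = (b < t).
Proof.
move=> /andP[b0 b1] /andP[t0 t1]; have pi0 := pi_gt0 R.
have cosP (y z : R) : 0 <= y <= pi -> 0 <= z <= pi -> (cos z < cos y) = (y < z).
  by move=> hy hz; rewrite ltr_cos// in_itv.
have h1 : 0 <= pi * (1 - b) <= pi by nra.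
case: (ltP b t) => bt.
  have [h|h] := leP 0 (2 * pi * t - pi * (1 + b)).
    by rewrite cosP//; [nra|apply/andP; nra].
  by rewrite -[X in _ < cos X]opprK cosN cosP//; [nra|apply/andP; nra].
apply/negbTE; rewrite -leNgt.
have [h|h] := leP (- pi) (2 * pi * t - pi * (1 + b)).
  by rewrite -[X in cos X <= _]opprK cosN leNgt cosP// -?leNgt; [nra|apply/andP; nra].
rewrite -(cosD2pi_int (2 * pi * t - _) 1) mulr1.
by rewrite leNgt cosP// -?leNgt; [nra|apply/andP; nra].
Qed.

(** Inside the cell a half-space is an arc in one variable, so a single mode minus a constant
    detects it. For [b] outside [0,1) the cell lies on one side, and a constant does. *)
Lemma trig_halfspace (i : 'I_N) (b : R) : exists h, [/\ trig h,
  forall x : 'rV[R]_N, -1 <= h x <= 1 &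
  forall x : 'rV[R]_N, cell x -> (0 < h x) = (b < x ord0 i)].
Proof.
have [b0|b0] := ltP b 0.
  exists (fun=> 1); split; [exact: trig_cst|by move=> x; rewrite lexx andbT; lra|].
  by move=> x /(_ i)/andP[x0 _]; rewrite ltr01 (lt_le_trans b0).
have [b1|b1] := leP 1 b.
  exists (fun=> -1); split; [exact: trig_cst|by move=> x; rewrite lexx/=; lra|].
  by move=> x /(_ i)/andP[_ x1]; rewrite oppr_gt0 ltr10 (lt_gtF (lt_le_trans x1 b1)).
exists (fun x => 2^-1 * cosq (delta_mx ord0 i) (- (pi * (1 + b))) x
        + - (cos (pi * (1 - b)) / 2)); split.
- apply: trigS; exact: trig_cst.
- move=> x; have := cosq_abs (delta_mx ord0 i) (- (pi * (1 + b))) x.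
  have := cos_max (pi * (1 - b)); rewrite !ler_norml => /andP[? ?] /andP[? ?].
  by apply/andP; split; lra.
move=> x /(_ i) xi; rewrite -(@cos_gt_arc b (x ord0 i)) ?b0//.
rewrite /cosq /dotq (bigD1 i)//= mxE !eqxx mul1r big1 ?addr0; last first.
  by move=> j ji; rewrite mxE (negbTE ji) andbF mul0r.
set A := cos _; set B := cos _; apply/idP/idP; lra.
Qed.

(** Stated for every finite measure carried by the cell, because the uniqueness argument for the
    torus measure uses it for a sum of two probabilities. *)
Lemma trig_dense (mu : {finite_measure set 'rV[R]_N -> \bar R}) (f : 'rV[R]_N -> R) (e : R) :
  mu (~` @cell R N) = 0%E -> mu.-integrable setT (EFin \o f) -> 0 < e ->
  exists2 p, trig p & (\int[mu]_x (`|f x - p x|)%:E <= e%:E)%E.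
Proof.
move=> mu0 fi e0.
pose dn := dense_in mu (@trig R N).
suff [_ /(_ _ e0)//] : dn f.
have dAA p : trig p -> dn p by apply: dense_in_AA => q; exact: measurable_trig.
apply: (dense_in_integrable (@measurable_trig R N) (@bounded_trig R N)
  (@trig_cst R N) (@trigD R N) (@trigM R N)) => //.
apply: (dense_in_indic (@measurable_trig R N) (@bounded_trig R N)
  (@trig_cst R N) (@trigD R N) (@trigM R N) (@measurable_rV_halfspaces R N)).
move=> A [i [b ->]]; have mA := measurable_halfspace i b.
split => //.
have [h [th h1 hb]] := trig_halfspace i b.
have mh : measurable [set x : 'rV[R]_N | 0 < h x].
  rewrite -[X in measurable X]setTI.
  rewrite (_ : [set x | _] = h @^-1` `]0, +oo[%classic).
    exact: measurable_trig.
  by apply/seteqP; split => x /=; rewrite in_itv/= andbT.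
apply: (dense_in_L1 (@measurable_trig R N)); first exact: measurable_indic.
move=> {e0}e e0; exists (\1_[set x | 0 < h x]).
  exact: (dense_in_gt0 mu (@measurable_trig R N)
  (@trig_cst R N) (@trigD R N) (@trigM R N)).
rewrite (ae_eq_integral (cst 0%E))//.
- by rewrite integral0 lee_fin ltW.
- by apply: measurable_absB; exact: measurable_indic.
- exists (~` @cell R N); split => //.
    by apply: measurableC; exact: measurable_cell.
  move=> x /= hx cx; apply: hx => _; congr EFin.
  rewrite !indicE (_ : (x \in _) = (x \in [set x | 0 < h x])) ?subrr ?normr0//.
  by apply/idP/idP; rewrite !in_setE/= hb.
Qed.

End trig_density.

(** * Fourier modes and invariance of the torus integral *)

Section torus_integral.
Context (R : realType).
Local Notation P := (torusP R).

Lemma torusP_rec n (f : 'rV[R]_n.+1 -> R) (B : R) : measurable_fun setT f ->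
  (forall x, `|f x| <= B) ->
  (\int[P n.+1]_x (f x)%:E =
   \int[@unif01 R]_t \int[P n]_v (f (rowcons (t, v)))%:E)%E.
Proof.
move=> mf fB /=; rewrite integral_distribution; first last.
- apply: (@bounded_integrable _ _ _ _ (f \o @rowcons R n) B).
    exact: measurableT_comp (@measurable_rowcons R n).
  by move=> x /=.
- exact/measurable_EFinP.
rewrite -integral12_prod_meas1//.
apply: (@bounded_integrable _ _ _ _ (f \o @rowcons R n) B).
  exact: measurableT_comp (@measurable_rowcons R n).
by move=> x /=.
Qed.

Lemma integral_unif01_cos (k : int) (th : R) : k != 0 ->
  (\int[@unif01 R]_t (cos (2 * pi * (k%:~R * t) + th))%:E = 0)%E.
Proof.
move=> k0; have pi0 := pi_gt0 R.
have c0 : 2 * pi * k%:~R != 0 :> R.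
  by rewrite mulf_neq0 ?intr_eq0// mulf_neq0// gt_eqF.
rewrite -(integral_restr (m := @lebesgue_measure R) (P := @unif01 R)
  (D := `[0%R, 1%R[%classic))//.
pose c := 2 * pi * k%:~R : R.
pose F (t : R) := sin (2 * pi * (k%:~R * t) + th) / c.
have dF (t : R) : is_derive t 1 F (cos (2 * pi * (k%:~R * t) + th)).
  rewrite /F; apply: is_derive_eq.
  by rewrite /GRing.scale/= !mulr0 !add0r !addr0 mulr1 -/c mulrCA mulVf// mulr1.
have cc : continuous (fun t : R => cos (2 * pi * (k%:~R * t) + th)).
  have c1 : continuous (fun t : R => 2 * pi * (k%:~R * t) + th).
    apply: continuous_add; last exact: cst_continuous.
    apply: continuous_mul; first exact: cst_continuous.
    by apply: continuous_mul; [exact: cst_continuous|move=> ?; exact: cvg_id].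
  by move=> t; apply: continuous_comp; [exact: c1|exact: continuous_cos].
rewrite integral_itv_bndo_bndc; last first.
  by apply/measurable_EFinP/measurable_funTS; exact: continuous_measurable_fun.
rewrite (@continuous_FTC2 _ _ F)//.
- rewrite /F mulr1 !mulr0 add0r -/c.
  suff -> : sin (c + th) = sin th by rewrite -EFinB subrr.
  rewrite -!cosBpihalf -(cosD2pi_int (th - _) k); congr (cos _).
  by rewrite /c; ring.
- exact: continuous_subspaceT.
- have cF : continuous F.
    move=> t; apply: differentiable_continuous; apply/derivable1_diffP.
    exact: ex_derive.
  split=> [t _||]; first exact: ex_derive.
    by apply: cvg_at_right_filter; exact: cF.
  by apply: cvg_at_left_filter; exact: cF.
- by move=> t _; rewrite derive1E; exact: derive_val.
Qed.

Lemma dotq_rowcons n (q : 'rV[int]_n.+1) (t : R) (v : 'rV[R]_n) :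
  dotq q (rowcons (t, v)) =
  (q ord0 ord0)%:~R * t + dotq (\row_i q ord0 (lift ord0 i)) v.
Proof.
rewrite /dotq big_ord_recl rowcons0; congr (_ + _).
by apply: eq_bigr => i _; rewrite rowconsS mxE.
Qed.

Lemma integral_cosq n (q : 'rV[int]_n) (th : R) : q != 0 ->
  \int[P n]_x cosq q th x = 0.
Proof.
rewrite /Rintegral => q0; suff -> : (\int[P n]_x (cosq q th x)%:E = 0)%E by [].
elim: n q th q0 => [q th|n ih q th q0].
  by rewrite (_ : q = 0) ?eqxx//; apply/rowP => -[].
rewrite (@torusP_rec _ _ 1); first last.
- exact: cosq_abs.
- exact: measurable_cosq.
pose q' : 'rV[int]_n := \row_i q ord0 (lift ord0 i).
have E t v : cosq q th (rowcons (t, v)) =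
    cosq q' (2 * pi * ((q ord0 ord0)%:~R * t) + th) v.
  by rewrite /cosq dotq_rowcons; congr (cos _); rewrite /q'; ring.
have [q'0|q'0] := eqVneq q' 0; last first.
  apply: integral0_eq => t _; under eq_integral do rewrite E.
  exact: ih.
rewrite (eq_integral (fun t : measurableTypeR R => (cos (2 * pi * ((q ord0 ord0)%:~R * t) + th))%:E)).
  apply: integral_unif01_cos; apply: contra_neq q0 => q00.
  apply/rowP => i; rewrite mxE; have [->//|] := eqVneq i ord0.
  rewrite eq_sym => /unlift_some[j -> _].
  by have := congr1 (fun r : 'rV[int]_n => r ord0 j) q'0; rewrite !mxE.
move=> t _; under eq_integral do rewrite E q'0 cosq0.
by rewrite integral_cst// [X in (_ * X)%E]probability_setT mule1.
Qed.

Lemma measurable_floor_set (S : set int) : measurable [set t : R | S (Num.floor t)].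
Proof.
rewrite (_ : [set t | _] = \bigcup_(k in S) `[k%:~R, (k + 1)%:~R[%classic); last first.
  apply/seteqP; split=> [t /= St|t [k /= Sk]].
    exists (Num.floor t) => //=.
    by rewrite in_itv/= Num.Theory.floor_le Num.Theory.floorD1_gt.
  by rewrite in_itv/= => /Num.Theory.floor_def ->.
rewrite bigcup_mkcond; apply: countable_bigcupT_measurable => // k.
by case: ifPn.
Qed.

Lemma measurable_floor_int : measurable_fun setT (fun t : R => (Num.floor t)%:~R : R).
Proof.
by move=> _ Y mY; rewrite setTI; exact: (measurable_floor_set [set k | Y k%:~R]).
Qed.

Lemma measurable_tproj n : measurable_fun setT (@tproj R n).
Proof.
apply/measurable_rVP => i; under eq_fun do rewrite mxE.
apply: measurable_funB; first exact: measurable_coord.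
exact: (measurableT_comp measurable_floor_int (@measurable_coord R n i)).
Qed.

(** Trigonometric polynomials have equal integrals, and one that is close to [f] in L^1 of the sum
    measure is close for both probabilities at once. *)
Lemma torusP_unique n (Q : probability 'rV[R]_n R) (f : 'rV[R]_n -> R) (B : R) :
  Q (~` @cell R n) = 0%E ->
  (forall q th, q != 0 -> \int[Q]_x cosq q th x = 0) ->
  measurable_fun setT f -> (forall x, `|f x| <= B) ->
  \int[Q]_x f x = \int[P n]_x f x.
Proof.
move=> Q0 Qcos mf fB.
have trigE p : trig p -> \int[Q]_x p x = \int[P n]_x p x.
  elim=> [|{}p c q th tp ih].
    by rewrite !Rintegral_prob_cst.
  have [C pC] := bounded_trig tp.
  have icos (Z : probability 'rV[R]_n R) : Z.-integrable setT (EFin \o cosq q th).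
    by apply: (@bounded_integrable _ _ _ _ _ 1); [exact: measurable_cosq|exact: cosq_abs].
  have ip (Z : probability 'rV[R]_n R) : Z.-integrable setT (EFin \o p).
    by apply: bounded_integrable pC; exact: measurable_trig.
  have ic (Z : probability 'rV[R]_n R) : Z.-integrable setT (EFin \o (fun x => c * cosq q th x)).
    have [D cD] := bounded_trig (trig_mono c q th).
    by apply: bounded_integrable cD; exact: measurable_trig (trig_mono c q th).
  rewrite (RintegralD measurableT (ic Q) (ip Q)).
  rewrite (RintegralD measurableT (ic (P n)) (ip (P n))) ih; congr (_ + _).
  rewrite (RintegralZl c measurableT (icos Q)).
  rewrite (RintegralZl c measurableT (icos (P n))); congr (_ * _).
  have [->|q0] := eqVneq q 0; last by rewrite Qcos// integral_cosq.
  by under eq_Rintegral do rewrite cosq0; rewrite Rintegral_prob_cst; 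
    under eq_Rintegral do rewrite cosq0; rewrite Rintegral_prob_cst.
have finmu : fin_num_fun (measure_add Q (P n)).
  move=> U mU; rewrite measure_addE fin_numD.
  by rewrite !fin_num_measure.
pose mu : {finite_measure set 'rV[R]_n -> \bar R} :=
  HB.pack (Measure.sort (measure_add Q (P n))) (Measure.class (measure_add Q (P n)))
    (Measure_isFinite.Build _ _ _ (Measure.sort (measure_add Q (P n))) finmu).
have mu0 : mu (~` @cell R n) = 0%E.
  transitivity (Q (~` @cell R n) + P n (~` @cell R n))%E; first exact: measure_addE.
  by rewrite Q0 torusP_cell adde0.
have [fQ fP] : Q.-integrable setT (EFin \o f) /\ (P n).-integrable setT (EFin \o f).
  by split; exact: bounded_integrable fB.
have fmu : mu.-integrable setT (EFin \o f).
  apply: measurable_bounded_integrable => //.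
    by rewrite -ge0_fin_numE// finmu.
  exists B; split; first exact: num_real.
  by move=> M BM x _ /=; rewrite (le_trans (fB x))// ltW.
apply/eqP; rewrite -subr_eq0 -normr_le0; apply/ler_addgt0Pr => e e0; rewrite add0r.
have [p tp] := trig_dense mu0 fmu e0.
have mp := measurable_trig tp; have [C pC] := bounded_trig tp.
have mfp : measurable_fun setT (fun x => (`|f x - p x|)%:E) by exact: measurable_absB.
rewrite (ge0_integral_measure_add Q (P n))// => he.
have key (Z : probability 'rV[R]_n R) :
    (`|\int[Z]_x f x - \int[Z]_x p x|%R%:E <= \int[Z]_x (`|f x - p x|%R)%:E)%E.
  by apply: Rintegral_dist; [exact: bounded_integrable fB|exact: bounded_integrable pC].
rewrite -lee_fin; apply: le_trans he; apply: le_trans (leeD (key Q) (key (P n))).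
rewrite -EFinD lee_fin -(trigE _ tp) -[X in _ <= _ + X]normrN.
by apply: le_trans (ler_normD _ _); rewrite opprB addrA subrK.
Qed.

(** The image of the torus measure under [S], folded back into the cell by [tproj], has vanishing
    nonzero modes, so [torusP_unique] identifies it. Translations and dilations are then treated
    without a change of variables. *)
Lemma torus_push n (S : 'rV[R]_n -> 'rV[R]_n) (f : 'rV[R]_n -> R) (B : R) :
  measurable_fun setT S ->
  (forall q th, q != 0 -> \int[P n]_x cosq q th (S x) = 0) ->
  measurable_fun setT f -> (forall x, `|f x| <= B) -> Defs.periodic f ->
  \int[P n]_x f (S x) = \int[P n]_x f x.
Proof.
move=> mS Scos mf fB pf.
have mtS : measurable_fun setT (@tproj R n \o S).
  exact: measurableT_comp (@measurable_tproj n) mS.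
pose X : {mfun 'rV[R]_n >-> 'rV[R]_n} := HB.pack (@tproj R n \o S) (isMeasurableFun.Build _ _ _ _ _ mtS).
have E (g : 'rV[R]_n -> R) C : measurable_fun setT g -> (forall x, `|g x| <= C) ->
    \int[distribution (P n) X]_x g x = \int[P n]_x g (tproj (S x)).
  move=> mg gC; rewrite /Rintegral integral_distribution//; first exact/measurable_EFinP.
  apply: (@bounded_integrable _ _ _ _ (g \o X) C); last by move=> x /=.
  exact: (measurableT_comp mg mtS).
transitivity (\int[distribution (P n) X]_x f x).
  by rewrite (E _ B)//; apply: eq_Rintegral => x _; rewrite tprojE.
apply: (torusP_unique (B := B)) => //.
- transitivity (P n set0); last exact: measure0.
  congr (P n _); apply/seteqP; split => // x /=; apply; exact: tproj_cell.
- move=> q th q0; rewrite (E _ 1); [|exact: measurable_cosq|exact: cosq_abs].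
  rewrite -[RHS](Scos q th q0); apply: eq_Rintegral => x _.
  by apply: tprojE => y z; exact: cosq_period.
Qed.

Lemma torus_translate n (h : 'rV[R]_n) (f : 'rV[R]_n -> R) (B : R) :
  measurable_fun setT f -> (forall x, `|f x| <= B) -> Defs.periodic f ->
  \int[P n]_x f (x + h) = \int[P n]_x f x.
Proof.
apply: torus_push.
  apply/measurable_rVP => i; under eq_fun do rewrite mxE.
  by apply: measurable_funD => //; exact: measurable_coord.
move=> q th q0; under eq_Rintegral do rewrite cosq_shift.
exact: integral_cosq.
Qed.

Lemma torus_scale n k (f : 'rV[R]_n -> R) (B : R) : (0 < k)%N ->
  measurable_fun setT f -> (forall x, `|f x| <= B) -> Defs.periodic f ->
  \int[P n]_x f (k%:R *: x) = \int[P n]_x f x.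
Proof.
move=> k0; apply: torus_push.
  apply/measurable_rVP => i; under eq_fun do rewrite mxE.
  by apply: measurable_funM => //; exact: measurable_coord.
move=> q th q0; under eq_Rintegral do rewrite cosq_scale.
apply: integral_cosq; apply: contra_neq q0 => qk0; apply/rowP => i.
have := congr1 (fun r : 'rV[int]_n => r ord0 i) qk0; rewrite mulmxnE !mxE => /eqP.
by rewrite mulrn_eq0 eqn0Ngt k0/= => /eqP.
Qed.

End torus_integral.

(** * Differentiation on the torus *)

Section derivatives.
Context (R : realType) (N : nat).
Implicit Types (x v : 'rV[R]_N).

Lemma is_derive_line (f : 'rV[R]_N -> R) x v (t : R) :
  derivable f (x + t *: v) v ->
  is_derive t 1 (fun s => f (x + s *: v)) ('D_v f (x + t *: v)).
Proof.
have E : (fun h : R => h^-1 *: (((fun s => f (x + s *: v)) \o shift t) (h *: 1)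
            - f (x + t *: v))) =
  (fun h : R => h^-1 *: ((f \o shift (x + t *: v)) (h *: v) - f (x + t *: v))).
  apply/funext => h /=; congr (_ *: (f _ - _)).
  by rewrite [h%:A]mulr1 scalerDl addrCA.
by move=> df; split; rewrite /derivable /derive E.
Qed.

Lemma derive_period (W : normedModType R) (f : 'rV[R]_N -> W) v :
  Defs.periodic f -> Defs.periodic ('D_v f).
Proof.
move=> pf x z; rewrite /derive.
suff -> : (fun h : R => h^-1 *: ((f \o shift (x + \row_i (z i)%:~R)) (h *: v)
    - f (x + \row_i (z i)%:~R))) =
  (fun h : R => h^-1 *: ((f \o shift x) (h *: v) - f x)) by [].
by apply/funext => h /=; rewrite addrA !pf.
Qed.

Lemma periodic_bounded (f : 'rV[R]_N -> R) : Defs.periodic f -> continuous f ->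
  exists B : R, forall x, `|f x| <= B.
Proof.
move=> pf cf.
have cK : compact [set x : 'rV[R]_N | forall i, `[0, 1]%classic (x ord0 i)].
  by apply: (@rV_compact R N (fun=> `[0, 1]%classic)) => i; exact: segment_compact.
have [B [_ hB]] : bounded_set (f @` [set x : 'rV[R]_N | forall i, `[0, 1]%classic (x ord0 i)]).
  apply: compact_bounded; apply: continuous_compact => //.
  exact: continuous_subspaceT.
exists (B + 1) => x; rewrite -(tprojE x pf); apply: (hB (B + 1)).
  by rewrite ltrDl.
exists (tproj x) => // i /=; rewrite in_itv/=.
by have /andP[-> /ltW ->] := tproj_cell x i.
Qed.

(** Difference quotients have integral zero by translation invariance, are bounded by the mean value
    theorem, and converge to the derivative; dominated convergence concludes. *)
Lemma Rintegral_derive0 (f : 'rV[R]_N -> R) k : Defs.periodic f ->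
  (forall x, differentiable f x) -> continuous ('D_(evec R k) f) ->
  \int[torusP R N]_x 'D_(evec R k) f x = 0.
Proof.
move=> pf df cg; set e := evec R k; set g := 'D_e f.
have cf : continuous f by move=> x; exact: differentiable_continuous.
have pg : Defs.periodic g by exact: derive_period.
have [B gB] := periodic_bounded pg cg.
have [C fC] := periodic_bounded pf cf.
have mf := continuous_rV_measurable cf; have mg := continuous_rV_measurable cg.
pose G n x := n.+1%:R * (f (x + n.+1%:R^-1 *: e) - f x).
have mfs (h : 'rV[R]_N) : measurable_fun setT (fun x => f (x + h)).
  apply: (measurableT_comp mf); apply/measurable_rVP => i.
  under eq_fun do rewrite mxE.
  by apply: measurable_funD => //; exact: measurable_coord.
have mG n : measurable_fun setT (G n).
  by apply: measurable_funM => //; apply: measurable_funB.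
have GB n x : `|G n x| <= B.
  have t0 : 0 <= n.+1%:R^-1 :> R by [].
  have [||c _] := @MVT_segment _ (fun s => f (x + s *: e)) (fun s => g (x + s *: e)) _ _ t0.
  - move=> s _; apply: is_derive_line; exact: diff_derivable.
  - apply: continuous_subspaceT => s.
    have /derivable1_diffP : derivable (fun s : R => f (x + s *: e)) s 1.
      by have [] := is_derive_line (@diff_derivable _ _ _ f (x + s *: e) e (df _)).
    exact: differentiable_continuous.
  rewrite scale0r addr0 subr0 /G => ->.
  by rewrite mulrCA divff ?mulr1 ?gB// pnatr_eq0.
have iG n : (torusP R N).-integrable setT (EFin \o G n) by exact: bounded_integrable (GB n).
have intG n : \int[torusP R N]_x G n x = 0.
  have i1 : (torusP R N).-integrable setT (EFin \o (fun x => f (x + n.+1%:R^-1 *: e))).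
    by apply: (@bounded_integrable _ _ _ _ _ C).
  have i2 : (torusP R N).-integrable setT (EFin \o f) by exact: bounded_integrable fC.
  have i3 : (torusP R N).-integrable setT (EFin \o (fun x => f (x + n.+1%:R^-1 *: e) - f x)).
    by rewrite (_ : _ \o _ = (fun x => (f (x + n.+1%:R^-1 *: e))%:E - (f x)%:E)%E)//; exact: integrableB.
  rewrite /G RintegralZl// RintegralB//.
  by rewrite (torus_translate _ mf fC pf) subrr mulr0.
have Gg x : G n x @[n --> \oo] --> g x.
  have dfx : derivable f x e by exact: diff_derivable.
  have h1 : h^-1 *: ((f \o shift x) (h *: e) - f x) @[h --> (0 : R)^'] --> g x := dfx.
  have /cvg_at_rightP/(_ (fun n => n.+1%:R^-1)) h2 := cvg_dnbhs_at_right h1.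
  have h3 : (forall n : nat, 0 < n.+1%:R^-1 :> R) /\ n.+1%:R^-1 @[n --> \oo] --> (0 : R).
    by split=> [n|]; [rewrite invr_gt0|exact: cvg_harmonic].
  have := h2 h3; rewrite (_ : (fun n => _) = G ^~ x)//.
  by apply/funext => n /=; rewrite invrK [_ + x]addrC.
have mGE n : measurable_fun setT (EFin \o G n) by exact/measurable_EFinP.
have iB : (torusP R N).-integrable setT (EFin \o cst B).
  by apply: finite_measure_integrable_cst.
have mgE : measurable_fun setT (EFin \o g) by exact/measurable_EFinP.
have [||_ _] := dominated_convergence measurableT mGE mgE _ iB _.
- by apply: aeW => x _; apply: cvg_EFin; [exact: nearW|exact: Gg].
- by apply: aeW => x n _ /=; rewrite lee_fin.
rewrite (_ : (fun n => _) = fun=> 0%E); last first.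
  by apply/funext => n; rewrite EFin_Rintegral// intG.
move=> /cvg_lim => /(_ (@ereal_hausdorff R)); rewrite lim_cst// => h.
by rewrite /Rintegral -h.
Qed.

End derivatives.

(** * Bounded measurable functions *)

Section bmeas.
Context d (T : measurableType d) (R : realType).
Implicit Types f g : T -> R.

(** Stable under all the operations used below and integrable for every probability, so that
    linearity and monotonicity of integrals need no separate integrability conditions. *)
Definition bmeas f := measurable_fun setT f /\ exists B : R, forall x, `|f x| <= B.

Lemma bmeas_cst (c : R) : bmeas (fun=> c).
Proof. by split => //; exists `|c|. Qed.

Lemma bmeasD f g : bmeas f -> bmeas g -> bmeas (fun x => f x + g x).
Proof.
move=> [mf [B fB]] [mg [C gC]]; split; first exact: measurable_funD.
by exists (B + C) => x; rewrite (le_trans (ler_normD _ _))// lerD.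
Qed.

Lemma bmeasM f g : bmeas f -> bmeas g -> bmeas (fun x => f x * g x).
Proof.
move=> [mf [B fB]] [mg [C gC]]; split; first exact: measurable_funM.
by exists (B * C) => x; rewrite normrM ler_pM.
Qed.

Lemma bmeasN f : bmeas f -> bmeas (fun x => - f x).
Proof.
move=> bf; rewrite (_ : (fun x => _) = fun x => -1 * f x).
  by apply: bmeasM => //; exact: bmeas_cst.
by apply/funext => x; rewrite mulN1r.
Qed.

Lemma bmeasB f g : bmeas f -> bmeas g -> bmeas (fun x => f x - g x).
Proof. by move=> bf bg; apply: bmeasD => //; exact: bmeasN. Qed.

Lemma bmeas_sum (I : Type) (s : seq I) (f : I -> T -> R) :
  (forall i, bmeas (f i)) -> bmeas (fun x => \sum_(i <- s) f i x).
Proof.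
move=> bf; elim: s => [|i s ih].
  by under eq_fun do rewrite big_nil; exact: bmeas_cst.
by under eq_fun do rewrite big_cons; exact: bmeasD.
Qed.

Lemma bmeas_norm f : bmeas f -> bmeas (fun x => `|f x|).
Proof.
move=> [mf [B fB]]; split; first exact: measurableT_comp.
by exists B => x; rewrite normr_id.
Qed.

Lemma bmeas_indic (E : set T) : measurable E -> bmeas (\1_E : T -> R).
Proof.
move=> mE; split; first exact: measurable_indic.
by exists 1 => x; rewrite ger0_norm// indicE; case: (_ \in _).
Qed.

Variable P : probability T R.

Lemma bmeas_integrable f : bmeas f -> P.-integrable setT (EFin \o f).
Proof. by move=> [mf [B fB]]; exact: bounded_integrable fB. Qed.

Lemma bRintD f g : bmeas f -> bmeas g ->
  \int[P]_x (f x + g x) = \int[P]_x f x + \int[P]_x g x.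
Proof. by move=> bf bg; rewrite RintegralD//; exact: bmeas_integrable. Qed.

Lemma bRintB f g : bmeas f -> bmeas g ->
  \int[P]_x (f x - g x) = \int[P]_x f x - \int[P]_x g x.
Proof. by move=> bf bg; rewrite RintegralB//; exact: bmeas_integrable. Qed.

Lemma bRintZ (c : R) f : bmeas f -> \int[P]_x (c * f x) = c * \int[P]_x f x.
Proof. by move=> bf; rewrite RintegralZl//; exact: bmeas_integrable. Qed.

Lemma bRint_sum (I : Type) (s : seq I) (f : I -> T -> R) :
  (forall i, bmeas (f i)) ->
  \int[P]_x (\sum_(i <- s) f i x) = \sum_(i <- s) \int[P]_x f i x.
Proof.
move=> bf; elim: s => [|i s ih].
  by under eq_Rintegral do rewrite big_nil; rewrite big_nil Rintegral_prob_cst.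
under eq_Rintegral do rewrite big_cons.
by rewrite bRintD// ?ih ?big_cons//; exact: bmeas_sum.
Qed.

Lemma bRint_le f g : bmeas f -> bmeas g -> (forall x, f x <= g x) ->
  \int[P]_x f x <= \int[P]_x g x.
Proof.
by move=> bf bg fg; apply: le_Rintegral => //; exact: bmeas_integrable.
Qed.

Lemma bRint_norm f : bmeas f -> `|\int[P]_x f x| <= \int[P]_x `|f x|.
Proof. by move=> bf; apply: le_normr_Rintegral => //; exact: bmeas_integrable. Qed.

Lemma bRint_dist f g : bmeas f -> bmeas g ->
  `|\int[P]_x f x - \int[P]_x g x| <= \int[P]_x `|f x - g x|.
Proof. by move=> bf bg; rewrite -bRintB//; apply: bRint_norm; exact: bmeasB. Qed.

Lemma bRint_le_cst f (c : R) : bmeas f -> (forall x, f x <= c) -> \int[P]_x f x <= c.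
Proof.
move=> bf fc; rewrite -[leRHS](Rintegral_prob_cst P).
by apply: bRint_le => //; exact: bmeas_cst.
Qed.

Lemma bRint_ge_cst f (c : R) : bmeas f -> (forall x, c <= f x) -> c <= \int[P]_x f x.
Proof.
move=> bf fc; rewrite -[leLHS](Rintegral_prob_cst P).
by apply: bRint_le => //; exact: bmeas_cst.
Qed.

Lemma bRint_EFin f : bmeas f -> (\int[P]_x (f x)%:E)%E = (\int[P]_x f x)%:E.
Proof. by move=> bf; rewrite EFin_Rintegral//; exact: bmeas_integrable. Qed.

End bmeas.

Lemma bmeas_periodic (R : realType) (N : nat) (f : 'rV[R]_N -> R) :
  Defs.periodic f -> continuous f -> bmeas f.
Proof.
move=> pf cf; split; first exact: continuous_rV_measurable.
exact: periodic_bounded.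
Qed.

Lemma bmeas_cosq (R : realType) (N : nat) (q : 'rV[int]_N) (th : R) : bmeas (cosq q th).
Proof.
by split; [exact: measurable_cosq|exists 1 => x; exact: cosq_abs].
Qed.

(** * Vector-valued trigonometric fields and their derivatives *)

Section vector_trig.
Context (R : realType) (N : nat).

Lemma differentiable_cosq (q : 'rV[int]_N) (th : R) (x : 'rV[R]_N) :
  differentiable (cosq q th) x.
Proof.
apply: (@differentiable_comp _ _ R^o R^o (fun x => 2 * pi * dotq q x + th) (@cos R)); last first.
  by apply/derivable1_diffP; exact: ex_derive.
apply: (@differentiableD _ _ R^o (fun x => 2 * pi * dotq q x) (cst th)) => //.
apply: (@differentiableZ _ _ R^o (dotq q) (2 * pi)).
rewrite /dotq.
have -> : (fun x : 'rV[R]_N => \sum_i (q ord0 i)%:~R * x ord0 i) =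
    \sum_i (fun x : 'rV[R]_N => (q ord0 i)%:~R * x ord0 i).
  by apply/funext => y; rewrite fct_sumE.
apply: differentiable_sum => i.
apply: (@differentiableZ _ _ R^o (fun x : 'rV[R]_N => x ord0 i)).
exact: differentiable_coord.
Qed.

Lemma derive_cosq (q : 'rV[int]_N) (th : R) (v x : 'rV[R]_N) :
  'D_v (cosq q th) x = 2 * pi * dotq q v * cosq q (th + pi / 2) x.
Proof.
have := @is_derive_line R N (cosq q th) x v 0.
rewrite scale0r addr0 => /(_ (@diff_derivable _ _ _ _ _ _ (differentiable_cosq _ _ _))) h.
have <- : 'D_1 (fun s : R => cosq q th (x + s *: v)) 0 = 'D_v (cosq q th) x.
  by rewrite derive_val.
rewrite (_ : (fun s : R => _) = (fun s => cos (2 * pi * dotq q v * s + (2 * pi * dotq q x + th)))).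
  have -> : cosq q (th + pi / 2) x = - sin (2 * pi * dotq q x + th).
    by rewrite /cosq addrA cosDpihalf.
  by rewrite derive_val /GRing.scale/= mulr0 add0r addr0 !mulr1 mulrC.
by apply/funext => s; rewrite /cosq dotqDr dotqZr; congr (cos _); ring.
Qed.

Context (d : nat).

Inductive vtrig : ('rV[R]_N -> 'rV[R]_d) -> Prop :=
| vtrig0 : vtrig (fun=> 0)
| vtrigS u a q th : vtrig u -> vtrig (fun x => cosq q th x *: a + u x).

Lemma vtrig_diff u x : vtrig u -> differentiable u x.
Proof.
elim=> [|{}u a q th tu ih]; first exact: differentiable_cst.
apply: (@differentiableD _ _ _ (fun x => cosq q th x *: a) u) => //.
by apply: differentiableZl; exact: differentiable_cosq.
Qed.

Lemma derive_vtrigS u a q th v x : vtrig u ->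
  'D_v (fun x => cosq q th x *: a + u x) x =
  cosq q (th + pi / 2) x *: ((2 * pi * dotq q v) *: a) + 'D_v u x.
Proof.
move=> tu.
have dc : differentiable (fun x => cosq q th x *: a) x.
  by apply: differentiableZl; exact: differentiable_cosq.
rewrite (@deriveD _ _ _ (fun x => cosq q th x *: a) u); [|exact: diff_derivable|
  by apply: diff_derivable; exact: vtrig_diff].
congr (_ + _); rewrite deriveE// diffZl; last exact: differentiable_cosq.
by rewrite -deriveE ?derive_cosq ?scalerA 1?mulrC//; exact: differentiable_cosq.
Qed.

Lemma vtrig_derive u v : vtrig u -> vtrig ('D_v u).
Proof.
elim=> [|{}u a q th tu ih].
  rewrite (_ : 'D_v _ = fun=> 0); first exact: vtrig0.
  by apply/funext => x; rewrite derive_cst.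
rewrite (_ : 'D_v _ = fun x => cosq q (th + pi / 2) x *:
    ((2 * pi * dotq q v) *: a) + 'D_v u x); first exact: vtrigS.
by apply/funext => x; rewrite derive_vtrigS.
Qed.

Lemma vtrig_smooth_torus u : vtrig u -> smooth_torus u.
Proof.
move=> tu; split=> [s x|].
  apply: vtrig_diff; elim: s => //= v s ih; exact: vtrig_derive.
elim: tu => // {}u a q th tu ih x z.
by rewrite cosq_period ih.
Qed.

Lemma vtrigD u w : vtrig u -> vtrig w -> vtrig (fun x => u x + w x).
Proof.
move=> tu tw; elim: tu => [|{}u a q th tu ih].
  by under eq_fun do rewrite add0r.
by under eq_fun do rewrite -addrA; exact: vtrigS.
Qed.

Lemma vtrig_cst a : vtrig (fun=> a).
Proof.
have := @vtrigS _ a (0 : 'rV[int]_N) 0 vtrig0.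
by under eq_fun do rewrite addr0 cosq0 cos0 scale1r.
Qed.

Lemma vtrig_coord u i : vtrig u -> trig (fun x => u x ord0 i).
Proof.
elim=> [|{}u a q th tu ih].
  by under eq_fun do rewrite mxE; exact: trig0.
by under eq_fun do rewrite mxE mxE mulrC; exact: trigS.
Qed.

Lemma bmeas_trig (p : 'rV[R]_N -> R) : trig p -> bmeas p.
Proof. by move=> tp; split; [exact: measurable_trig|exact: bounded_trig]. Qed.

End vector_trig.

(** * Trigonometric fields in the kernel of the operator *)

Section A_trig.
Context (R : realType) (N d l : nat) (A : 'I_N -> 'M[R]_(d, l)).
Local Notation P := (torusP R N).

Definition isymbol (q : 'rV[int]_N) : 'M[R]_(d, l) := symbol A (map_mx intr q).

Lemma isymbolE q : isymbol q = \sum_k (q ord0 k)%:~R *: A k.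
Proof. by apply: eq_bigr => k _; rewrite mxE. Qed.

Lemma isymbolD q r : isymbol (q + r) = isymbol q + isymbol r.
Proof.
by rewrite !isymbolE -big_split/=; apply: eq_bigr => k _; rewrite mxE intrD scalerDl.
Qed.

Lemma isymbolMn q n : isymbol (q *+ n) = n%:R *: isymbol q.
Proof.
rewrite !isymbolE scaler_sumr; apply: eq_bigr => k _.
by rewrite mulmxnE rmorphMn/= scalerA mulr_natl.
Qed.

(** Each amplitude lies in the kernel of the symbol at its frequency, which makes the mode a
    solution, and frequency zero is excluded, which makes the mean vanish: all these fields are
    admissible in the definition of quasiconvexity. *)
Inductive Atrig : ('rV[R]_N -> 'rV[R]_d) -> Prop :=
| Atrig0 : Atrig (fun=> 0)
| AtrigS u a q th : q != 0 -> a *m isymbol q = 0 -> Atrig u ->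
    Atrig (fun x => cosq q th x *: a + u x).

Lemma Atrig_vtrig u : Atrig u -> vtrig u.
Proof. by elim=> [|{}u a q th _ _ _]; [exact: vtrig0|exact: vtrigS]. Qed.

Lemma Atrig_mono a q th : q != 0 -> a *m isymbol q = 0 ->
  Atrig (fun x => cosq q th x *: a).
Proof.
move=> q0 aq; have := AtrigS th q0 aq Atrig0.
by under eq_fun do rewrite addr0.
Qed.

Lemma AtrigD u w : Atrig u -> Atrig w -> Atrig (fun x => u x + w x).
Proof.
move=> tu tw; elim: tu => [|{}u a q th q0 aq tu ih].
  by under eq_fun do rewrite add0r.
by under eq_fun do rewrite -addrA; exact: AtrigS.
Qed.

Lemma Atrig_sum (I : Type) (s : seq I) (u : I -> 'rV[R]_N -> 'rV[R]_d) :
  (forall i, Atrig (u i)) -> Atrig (fun x => \sum_(i <- s) u i x).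
Proof.
move=> tu; elim: s => [|i s ih].
  by under eq_fun do rewrite big_nil; exact: Atrig0.
by under eq_fun do rewrite big_cons; exact: AtrigD.
Qed.

Lemma Atrig_dilate u n : (0 < n)%N -> Atrig u -> Atrig (fun x => u (n%:R *: x)).
Proof.
move=> n0; elim=> [|{}u a q th q0 aq tu ih]; first exact: Atrig0.
under eq_fun do rewrite cosq_scale; apply: AtrigS => //.
  apply: contra_neq q0 => qn0; apply/rowP => i.
  have := congr1 (fun r : 'rV[int]_N => r ord0 i) qn0; rewrite mulmxnE !mxE => /eqP.
  by rewrite mulrn_eq0 eqn0Ngt n0/= => /eqP.
by rewrite isymbolMn -scalemxAr aq scaler0.
Qed.

Lemma Atrig_mean u i : Atrig u -> \int[P]_x u x ord0 i = 0.
Proof.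
elim=> [|{}u a q th q0 aq tu ih].
  by under eq_Rintegral do rewrite mxE; rewrite Rintegral_prob_cst.
under eq_Rintegral do rewrite mxE mxE mulrC.
rewrite bRintD ?ih.
- by rewrite bRintZ ?integral_cosq ?mulr0 ?addr0//; exact: bmeas_cosq.
- by apply: bmeasM; [exact: bmeas_cst|exact: bmeas_cosq].
- by apply: bmeas_trig; apply: vtrig_coord; exact: Atrig_vtrig.
Qed.

Lemma Atrig_free u x : Atrig u -> \sum_k ('D_(evec R k) u x *m A k) = 0.
Proof.
elim=> [|{}u a q th q0 aq tu ih].
  by rewrite big1// => k _; rewrite derive_cst mul0mx.
under eq_bigr do rewrite (derive_vtrigS _ _ _ _ _ (Atrig_vtrig tu)) mulmxDl.
rewrite big_split/= ih addr0.
transitivity ((cosq q (th + pi / 2) x * (2 * pi)) *: (a *m isymbol q)); last first.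
  by rewrite aq scaler0.
rewrite isymbolE mulmx_sumr scaler_sumr; apply: eq_bigr => k _.
by rewrite dotq_delta -!scalemxAl -scalemxAr !scalerA !mulrA.
Qed.

Lemma tint_bmeas (f : 'rV[R]_N -> R) : bmeas f -> tint f = (\int[P]_x f x)%:E.
Proof. by move=> bf; rewrite tintE bRint_EFin. Qed.

Lemma smooth_coord m (f : 'rV[R]_N -> 'rV[R]_m) i : smooth_torus f ->
  [/\ Defs.periodic (fun x => f x ord0 i),
   forall x, differentiable (fun x => f x ord0 i) x &
   forall v x, 'D_v (fun x => f x ord0 i) x = 'D_v f x ord0 i].
Proof.
move=> [sf pf]; have df x : differentiable f x := sf [::] x; split.
- by move=> x z; rewrite pf.
- move=> x; apply: (@differentiable_comp _ _ _ _ f (fun M : 'rV[R]_m => M ord0 i)) => //.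
  exact: differentiable_coord.
- move=> v x.
  have dc y : differentiable (fun M : 'rV[R]_m => M ord0 i : R^o) y by exact: differentiable_coord.
  rewrite deriveE; last first.
    by apply: (@differentiable_comp _ _ _ _ f (fun M : 'rV[R]_m => M ord0 i)).
  rewrite (@diff_comp _ _ _ R^o f (fun M : 'rV[R]_m => M ord0 i))//= deriveE//.
  pose lc := (fun M : 'rV[R]_m => M ord0 i : R^o).
  have lin : linear lc by move=> c M M'; rewrite /lc !mxE.
  pose L : {linear 'rV[R]_m -> R^o} := HB.pack lc (GRing.isLinear.Build _ _ _ _ lc lin).
  by have := @diff_lin _ _ _ L (f x) (@coord_continuous _ _ _ ord0 i) => /= ->.
Qed.

Lemma bmeas_smooth_coord m (f : 'rV[R]_N -> 'rV[R]_m) i : smooth_torus f ->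
  bmeas (fun x => f x ord0 i).
Proof.
move=> sf; have [pf df _] := smooth_coord i sf; apply: bmeas_periodic => // x.
exact: differentiable_continuous.
Qed.

Lemma smooth_torus_derive m (f : 'rV[R]_N -> 'rV[R]_m) v : smooth_torus f ->
  smooth_torus ('D_v f).
Proof.
move=> [sf pf]; split; last exact: derive_period.
move=> s x; have E : @Defs.iterD R N _ s ('D_v f) = @Defs.iterD R N _ (rcons s v) f by elim: s => //= w s ->.
by rewrite E; exact: sf.
Qed.

Lemma integration_by_parts_torus m m' (f : 'rV[R]_N -> 'rV[R]_m)
    (g : 'rV[R]_N -> 'rV[R]_m') i j k : smooth_torus f -> smooth_torus g ->
  \int[P]_x (f x ord0 i * 'D_(evec R k) g x ord0 j) =
  - \int[P]_x ('D_(evec R k) f x ord0 i * g x ord0 j).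
Proof.
move=> sf sg.
have [pfi dfi Dfi] := smooth_coord i sf; have [pgj dgj Dgj] := smooth_coord j sg.
have sDf := smooth_torus_derive (evec R k) sf.
have sDg := smooth_torus_derive (evec R k) sg.
pose h := (fun x => f x ord0 i) * (fun x => g x ord0 j) : 'rV[R]_N -> R.
have hE x : 'D_(evec R k) h x = f x ord0 i * 'D_(evec R k) g x ord0 j +
    'D_(evec R k) f x ord0 i * g x ord0 j.
  rewrite deriveM; [|exact: diff_derivable|exact: diff_derivable].
  by rewrite Dfi Dgj /GRing.scale/= [X in _ + X]mulrC.
have b1 : bmeas (fun x => f x ord0 i * 'D_(evec R k) g x ord0 j).
  by apply: bmeasM; exact: bmeas_smooth_coord.
have b2 : bmeas (fun x => 'D_(evec R k) f x ord0 i * g x ord0 j).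
  by apply: bmeasM; exact: bmeas_smooth_coord.
apply/eqP; rewrite -subr_eq0 opprK -bRintD//; apply/eqP.
under eq_Rintegral do rewrite -hE.
apply: Rintegral_derive0.
- by move=> x z; rewrite /h /GRing.mul/= pfi pgj.
- by move=> x; apply: differentiableM.
- rewrite (_ : 'D_(evec R k) h = fun x => f x ord0 i * 'D_(evec R k) g x ord0 j +
    'D_(evec R k) f x ord0 i * g x ord0 j); last by apply/funext.
  have cc n (w : 'rV[R]_N -> 'rV[R]_n) p : smooth_torus w ->
      continuous (fun x => w x ord0 p).
    by move=> sw x; apply: differentiable_continuous; have [_ + _] := smooth_coord p sw; exact.
  by apply: continuous_add; apply: continuous_mul; exact: cc.
Qed.

Lemma kerA_smooth phi : smooth_torus phi ->
  (forall y, \sum_k ('D_(evec R k) phi y *m A k) = 0) -> kerA A phi.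
Proof.
move=> sphi free psi spsi.
have E x : \sum_k (phi x *m A k *m ('D_(evec R k) psi x)^T) ord0 ord0 =
   \sum_k \sum_j \sum_i A k i j * (phi x ord0 i * 'D_(evec R k) psi x ord0 j).
  apply: eq_bigr => k _; rewrite mxE; apply: eq_bigr => j _.
  by rewrite !mxE mulr_suml; apply: eq_bigr => i _; ring.
have b k j i : bmeas (fun x => A k i j * (phi x ord0 i * 'D_(evec R k) psi x ord0 j)).
  apply: bmeasM; first exact: bmeas_cst.
  apply: bmeasM; apply: bmeas_smooth_coord => //; exact: smooth_torus_derive.
have b' k j i : bmeas (fun x => A k i j * ('D_(evec R k) phi x ord0 i * psi x ord0 j)).
  apply: bmeasM; first exact: bmeas_cst.
  apply: bmeasM; apply: bmeas_smooth_coord => //; exact: smooth_torus_derive.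
rewrite (_ : (fun x => _) = (fun x => \sum_k \sum_j \sum_i A k i j *
  (phi x ord0 i * 'D_(evec R k) psi x ord0 j))); last exact/funext.
rewrite tint_bmeas; last by do 3 (apply: bmeas_sum => ?).
congr EFin; rewrite bRint_sum; last by move=> ?; do 2 (apply: bmeas_sum => ?).
under eq_bigr => k _.
  rewrite bRint_sum; last by move=> ?; apply: bmeas_sum => ?.
  under eq_bigr => j _.
    rewrite bRint_sum//.
    under eq_bigr => i _.
      rewrite bRintZ ?integration_by_parts_torus//; last first.
        by apply: bmeasM; apply: bmeas_smooth_coord => //; exact: smooth_torus_derive.
      rewrite mulrN -bRintZ; last first.
        by apply: bmeasM; apply: bmeas_smooth_coord => //; exact: smooth_torus_derive.
      over.
    rewrite sumrN -bRint_sum//.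
    over.
  rewrite sumrN -bRint_sum; last by move=> ?; apply: bmeas_sum => ?.
  over.
rewrite sumrN -bRint_sum; last by move=> ?; do 2 (apply: bmeas_sum => ?).
rewrite (_ : (fun x => _) = fun=> 0) ?Rintegral_prob_cst ?oppr0//.
apply/funext => x; transitivity (((\sum_k ('D_(evec R k) phi x *m A k)) *m (psi x)^T) ord0 ord0).
  rewrite mulmx_suml summxE; apply: eq_bigr => k _; rewrite mxE.
  apply: eq_bigr => j _; rewrite !mxE mulr_suml; apply: eq_bigr => i _; ring.
by rewrite free mul0mx mxE.
Qed.

Lemma kerA_coef (u : 'rV[R]_N -> 'rV[R]_d) q th : (forall i, bmeas (fun x => u x ord0 i)) -> kerA A u ->
  (\row_i \int[P]_x (u x ord0 i * cosq q th x)) *m isymbol q = 0.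
Proof.
move=> bu ku; apply/rowP => j; rewrite [in RHS]mxE.
(* Differentiation advances the phase by [pi / 2], so the test field starts at [th - pi / 2] for its
   derivatives to be multiples of [cosq q th]. *)
pose psi : 'rV[R]_N -> 'rV[R]_l := fun x => cosq q (th - pi / 2) x *: delta_mx ord0 j.
have tpsi : vtrig psi.
  have := @vtrigS R N l _ (delta_mx ord0 j) q (th - pi / 2) (@vtrig0 R N l).
  by under eq_fun do rewrite addr0.
have Dpsi k x : 'D_(evec R k) psi x =
    (2 * pi * (q ord0 k)%:~R * cosq q th x) *: delta_mx ord0 j.
  have := @derive_vtrigS R N l _ (delta_mx ord0 j) q (th - pi / 2) (evec R k) x (@vtrig0 R N l).
  rewrite (_ : (fun x => _ + _) = psi); last by apply/funext => y; rewrite addr0.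
  by move=> ->; rewrite derive_cst addr0 subrK scalerA dotq_delta mulrC.
have := ku psi (vtrig_smooth_torus tpsi).
have E x : \sum_k (u x *m A k *m ('D_(evec R k) psi x)^T) ord0 ord0 =
    2 * pi * \sum_i isymbol q i j * (u x ord0 i * cosq q th x).
  under eq_bigr do rewrite Dpsi linearZ/= -scalemxAr mxE trmx_delta -colE mxE.
  rewrite mulr_sumr; under eq_bigr do rewrite mxE mulr_sumr.
  rewrite exchange_big/=; apply: eq_bigr => i _.
  rewrite isymbolE summxE mulr_suml mulr_sumr; apply: eq_bigr => k _.
  by rewrite !mxE; ring.
have bi i : bmeas (fun x => isymbol q i j * (u x ord0 i * cosq q th x)).
  by apply: bmeasM; [exact: bmeas_cst|apply: bmeasM => //; exact: bmeas_cosq].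
rewrite (_ : (fun x => _) = (fun x => 2 * pi * \sum_i isymbol q i j * (u x ord0 i * cosq q th x))); last exact/funext.
rewrite tint_bmeas; last by apply: bmeasM; [exact: bmeas_cst|exact: bmeas_sum].
rewrite bRintZ; last exact: bmeas_sum.
move=> [] /eqP; rewrite mulf_eq0 mulf_eq0 pnatr_eq0/= gt_eqF ?pi_gt0//= => /eqP h.
rewrite mxE -[RHS]h bRint_sum//; apply: eq_bigr => i _; rewrite mxE mulrC bRintZ//.
by apply: bmeasM => //; exact: bmeas_cosq.
Qed.

End A_trig.

(** * Fejer means *)

Section fejer.
Context (R : realType) (N : nat).
Local Notation P := (torusP R N).
Implicit Types (u w : 'rV[R]_N -> R) (x y : 'rV[R]_N).

Definition freq m (j : {ffun 'I_N -> 'I_m.+1}) : 'rV[int]_N := \row_i (j i : nat)%:Z.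

Lemma freq_inj m : injective (@freq m).
Proof.
move=> j k jk; apply/ffunP => i; apply: val_inj.
by have := congr1 (fun q : 'rV[int]_N => q ord0 i) jk; rewrite !mxE => -[].
Qed.

Definition fejer_card m : R := #|{ffun 'I_N -> 'I_m.+1}|%:R.

Lemma fejer_card_gt0 m : 0 < fejer_card m.
Proof. by rewrite ltr0n card_ffun card_ord expn_gt0. Qed.

(** The squared modulus of the sum of the exponentials of frequency [freq j], divided by their
    number: the product Fejer kernel, written through cosines of differences of frequencies. *)
Definition fejer_kernel m (z : 'rV[R]_N) : R :=
  (fejer_card m)^-1 * \sum_j \sum_k cosq (@freq m j - @freq m k) 0 z.

Definition fejer m u x := \int[P]_y (fejer_kernel m (x - y) * u y).

Lemma fejer_kernel_ge0 m z : 0 <= fejer_kernel m z.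
Proof.
rewrite mulr_ge0//; first by rewrite invr_ge0 ltW// fejer_card_gt0.
pose a j := 2 * pi * dotq (@freq m j) z.
rewrite (_ : \sum_j _ = (\sum_j cos (a j)) ^+ 2 + (\sum_j sin (a j)) ^+ 2).
  by rewrite addr_ge0// sqr_ge0.
rewrite !expr2 !mulr_suml -big_split/=; apply: eq_bigr => j _.
rewrite !mulr_sumr -big_split/=; apply: eq_bigr => k _.
by rewrite /cosq dotqDl dotqNl mulrBr addr0 -/(a j) -/(a k) cosB.
Qed.

Lemma cosq_sub q x y : cosq q 0 (x - y) =
  cosq q 0 x * cosq q 0 y + cosq q (- (pi / 2)) x * cosq q (- (pi / 2)) y.
Proof. by rewrite /cosq dotqDr dotqNr mulrBr !addr0 cosB !cosBpihalf. Qed.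

Lemma fejer_kernelE m x y : fejer_kernel m (x - y) = (fejer_card m)^-1 *
  \sum_j \sum_k (cosq (@freq m j - @freq m k) 0 x * cosq (@freq m j - @freq m k) 0 y +
    cosq (@freq m j - @freq m k) (- (pi / 2)) x * cosq (@freq m j - @freq m k) (- (pi / 2)) y).
Proof.
by congr (_ * _); apply: eq_bigr => j _; apply: eq_bigr => k _; rewrite cosq_sub.
Qed.

Lemma bmeas_fejer_kernel m x : bmeas (fun y => fejer_kernel m (x - y)).
Proof.
rewrite (_ : (fun y => _) = (fun y => (fejer_card m)^-1 * \sum_j \sum_k
  (cosq (@freq m j - @freq m k) 0 x * cosq (@freq m j - @freq m k) 0 y +
  cosq (@freq m j - @freq m k) (- (pi / 2)) x * cosq (@freq m j - @freq m k) (- (pi / 2)) y))).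
  apply: bmeasM; first exact: bmeas_cst.
  apply: bmeas_sum => j; apply: bmeas_sum => k.
  by apply: bmeasD; apply: bmeasM; try exact: bmeas_cst; exact: bmeas_cosq.
by apply/funext => y; rewrite fejer_kernelE.
Qed.

Lemma fejerE m u x : bmeas u -> fejer m u x = (fejer_card m)^-1 *
  \sum_j \sum_k (cosq (@freq m j - @freq m k) 0 x *
                  \int[P]_y (u y * cosq (@freq m j - @freq m k) 0 y) +
    cosq (@freq m j - @freq m k) (- (pi / 2)) x *
                  \int[P]_y (u y * cosq (@freq m j - @freq m k) (- (pi / 2)) y)).
Proof.
move=> bu; rewrite /fejer.
have bc q th : bmeas (fun y => u y * cosq q th y) by apply: bmeasM => //; exact: bmeas_cosq.
have bc' q th (c : R) : bmeas (fun y => c * (u y * cosq q th y)).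
  by apply: bmeasM => //; exact: bmeas_cst.
rewrite (_ : (fun y => _) = (fun y => (fejer_card m)^-1 * \sum_j \sum_k
  (cosq (@freq m j - @freq m k) 0 x * (u y * cosq (@freq m j - @freq m k) 0 y) +
  cosq (@freq m j - @freq m k) (- (pi / 2)) x * (u y * cosq (@freq m j - @freq m k) (- (pi / 2)) y)))).
  rewrite bRintZ; last by do 2 (apply: bmeas_sum => ?); exact: bmeasD.
  congr (_ * _); rewrite bRint_sum; last by move=> ?; apply: bmeas_sum => ?; exact: bmeasD.
  apply: eq_bigr => j _; rewrite bRint_sum; last by move=> ?; exact: bmeasD.
  by apply: eq_bigr => k _; rewrite bRintD// !bRintZ.
apply/funext => y; rewrite fejer_kernelE -mulrA mulr_suml; congr (_ * _).
apply: eq_bigr => j _; rewrite mulr_suml; apply: eq_bigr => k _; ring.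
Qed.

Lemma sum_diag m (F : {ffun 'I_N -> 'I_m.+1} -> {ffun 'I_N -> 'I_m.+1} -> R) :
  (forall j k, j != k -> F j k = 0) -> \sum_j \sum_k F j k = \sum_j F j j.
Proof.
move=> F0; apply: eq_bigr => j _; rewrite (bigD1 j)//= big1 ?addr0// => k kj.
by rewrite F0// eq_sym.
Qed.

Lemma freqB_neq0 m (j k : {ffun 'I_N -> 'I_m.+1}) : j != k -> @freq m j - @freq m k != 0.
Proof. by apply: contra_neq => /eqP; rewrite subr_eq0 => /eqP/freq_inj. Qed.

Lemma trig_fejer m u : bmeas u -> trig (fejer m u).
Proof.
move=> bu; rewrite (_ : fejer m u = (fun x => (fejer_card m)^-1 *
  \sum_j \sum_k (cosq (@freq m j - @freq m k) 0 x *
                  \int[P]_y (u y * cosq (@freq m j - @freq m k) 0 y) +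
    cosq (@freq m j - @freq m k) (- (pi / 2)) x *
                  \int[P]_y (u y * cosq (@freq m j - @freq m k) (- (pi / 2)) y)))); last first.
  by apply/funext => x; exact: fejerE.
have ts (I : Type) (s : seq I) (f : I -> 'rV[R]_N -> R) : (forall i, trig (f i)) ->
    trig (fun x => \sum_(i <- s) f i x).
  move=> tf; elim: s => [|i s ih].
    by under eq_fun do rewrite big_nil; exact: trig0.
  by under eq_fun do rewrite big_cons; exact: trigD.
apply: trigZ; apply: (ts) => j; apply: (ts) => k.
by under eq_fun do rewrite ![cosq _ _ _ * _]mulrC; apply: trigD; exact: trig_mono.
Qed.

(** Frequency zero occurs for the pairs [j = k] alone, and there are [fejer_card m] of them. *)
Lemma Rintegral_fejer m u : bmeas u -> \int[P]_x fejer m u x = \int[P]_x u x.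
Proof.
move=> bu; rewrite (_ : fejer m u = (fun x => (fejer_card m)^-1 *
  \sum_j \sum_k (cosq (@freq m j - @freq m k) 0 x *
                  \int[P]_y (u y * cosq (@freq m j - @freq m k) 0 y) +
    cosq (@freq m j - @freq m k) (- (pi / 2)) x *
                  \int[P]_y (u y * cosq (@freq m j - @freq m k) (- (pi / 2)) y)))); last first.
  by apply/funext => x; exact: fejerE.
have bc q th (c : R) : bmeas (fun x => cosq q th x * c :> R).
  by apply: bmeasM; [exact: bmeas_cosq|exact: bmeas_cst].
rewrite bRintZ; last by do 2 (apply: bmeas_sum => ?); exact: bmeasD.
rewrite bRint_sum; last by move=> ?; apply: bmeas_sum => ?; exact: bmeasD.
under eq_bigr do (rewrite bRint_sum; last by move=> ?; exact: bmeasD).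
have cint q th (c : R) : \int[P]_x (cosq q th x * c) = c * \int[P]_x cosq q th x.
  by under eq_Rintegral do rewrite mulrC; rewrite bRintZ//; exact: bmeas_cosq.
rewrite sum_diag; last first.
  by move=> j k jk; rewrite bRintD// !cint !integral_cosq ?freqB_neq0// !mulr0 addr0.
under eq_bigr => j _.
  rewrite bRintD// !cint subrr.
  under eq_Rintegral do rewrite cosq0 cos0 mulr1.
  under [X in _ * X + _]eq_Rintegral do rewrite cosq0 cos0.
  under [X in _ + _ * X]eq_Rintegral do rewrite cosq0 cosN cos_pihalf.
  rewrite !Rintegral_prob_cst mulr0 addr0 mulr1; over.
by rewrite sumr_const -mulr_natl mulrA mulVf ?mul1r// gt_eqF// fejer_card_gt0.
Qed.

Lemma fejer_cst m (c : R) x : fejer m (fun=> c) x = c.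
Proof.
rewrite fejerE; last exact: bmeas_cst.
have cint q th : \int[P]_y (c * cosq q th y) = c * \int[P]_x cosq q th x.
  by rewrite bRintZ//; exact: bmeas_cosq.
rewrite sum_diag; last first.
  by move=> j k jk; rewrite !cint !integral_cosq ?freqB_neq0// !mulr0 addr0.
under eq_bigr => j _.
  rewrite !cint subrr.
  under [X in _ * (_ * X) + _]eq_Rintegral do rewrite cosq0 cos0.
  under [X in _ + _ * (_ * X)]eq_Rintegral do rewrite cosq0 cosN cos_pihalf.
  rewrite !Rintegral_prob_cst !cosq0 cos0 !mulr0 addr0 mulr1 mul1r; over.
by rewrite sumr_const -mulr_natl mulrA mulVf ?mul1r// gt_eqF// fejer_card_gt0.
Qed.

Lemma fejer_le m u w x : bmeas u -> bmeas w -> (forall y, u y <= w y) ->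
  fejer m u x <= fejer m w x.
Proof.
move=> bu bw uw; have bK := bmeas_fejer_kernel m x.
apply: bRint_le; [exact: bmeasM|exact: bmeasM|].
by move=> y; rewrite ler_wpM2l// fejer_kernel_ge0.
Qed.

Lemma fejerB m u w x : bmeas u -> bmeas w ->
  fejer m (fun y => u y - w y) x = fejer m u x - fejer m w x.
Proof.
move=> bu bw; have bK := bmeas_fejer_kernel m x.
by rewrite /fejer; under eq_Rintegral do rewrite mulrBr; rewrite bRintB//; exact: bmeasM.
Qed.

Lemma fejerD m u w x : bmeas u -> bmeas w ->
  fejer m (fun y => u y + w y) x = fejer m u x + fejer m w x.
Proof.
move=> bu bw; have bK := bmeas_fejer_kernel m x.
by rewrite /fejer; under eq_Rintegral do rewrite mulrDr; rewrite bRintD//; exact: bmeasM.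
Qed.

Lemma fejerZ m (c : R) u x : bmeas u -> fejer m (fun y => c * u y) x = c * fejer m u x.
Proof.
move=> bu; have bK := bmeas_fejer_kernel m x.
by rewrite /fejer; under eq_Rintegral do rewrite mulrCA; rewrite bRintZ//; exact: bmeasM.
Qed.

Lemma fejer_bound m u (B : R) x : bmeas u -> (forall y, `|u y| <= B) ->
  `|fejer m u x| <= B.
Proof.
move=> bu uB; rewrite ler_norml -{1}(fejer_cst m (- B) x) -{2}(fejer_cst m B x).
by apply/andP; split; apply: fejer_le => //; try exact: bmeas_cst;
  move=> y; have := uB y; rewrite ler_norml => /andP[].
Qed.

(** Positivity of the kernel gives [|fejer m u| <= fejer m |u|] pointwise, and Fejer means preserve
    integrals. *)
Lemma fejer_contract m u : bmeas u -> \int[P]_x `|fejer m u x| <= \int[P]_x `|u x|.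
Proof.
move=> bu; have bn := bmeas_norm bu; rewrite -(Rintegral_fejer m bn).
apply: bRint_le.
- by apply: bmeas_norm; apply: bmeas_trig; exact: trig_fejer.
- by apply: bmeas_trig; exact: trig_fejer.
move=> x; have bK := bmeas_fejer_kernel m x.
apply: le_trans (bRint_norm _ _) _; first exact: bmeasM.
apply: bRint_le; [by apply: bmeas_norm; exact: bmeasM|exact: bmeasM|].
by move=> y; rewrite normrM ger0_norm// fejer_kernel_ge0.
Qed.

End fejer.

(** * Convergence of Fejer means *)

Section fejer_limit.
Context (R : realType) (N : nat).
Local Notation P := (torusP R N).

(** Equals [max 0 (m + 1 - |t|)], the weight of frequency [t] in the one-dimensional Fejer kernel
    before normalization. *)
Definition cnt1 m (t : int) : R :=
  \sum_(a < m.+1) \sum_(b < m.+1) ((a : nat)%:Z - (b : nat)%:Z == t)%:R.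

Lemma cnt1N m t : cnt1 m (- t) = cnt1 m t.
Proof.
rewrite /cnt1 exchange_big/=; apply: eq_bigr => a _; apply: eq_bigr => b _.
by rewrite -opprB eqr_opp.
Qed.

Lemma cnt1_le m t : cnt1 m t <= m.+1%:R.
Proof.
rewrite -[m.+1 in leRHS]card_ord -sum1_card natr_sum; apply: ler_sum => a _.
have [[b /eqP hb]|h] := pselect (exists b : 'I_m.+1, (a : nat)%:Z - (b : nat)%:Z == t).
  rewrite (bigD1 b)//= hb eqxx big1 ?addr0// => c cb.
  case: eqP => // hc; case/eqP: cb; apply: val_inj; apply/eqP; rewrite -eqz_nat.
  by rewrite -(inj_eq oppr_inj) -(inj_eq (addrI (a : nat)%:Z)) hb hc.
by rewrite big1// => b _; case: eqP => // hb; case: h; exists b; rewrite hb.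
Qed.

Lemma cnt1_ge m (n : nat) : m.+1%:R - n%:R <= cnt1 m n%:Z.
Proof.
apply: (@le_trans _ _ (\sum_(a < m.+1) (n <= a)%N%:R)).
  elim: m.+1 => [|k ih]; first by rewrite big_ord0 sub0r oppr_le0.
  rewrite big_ord_recr/= -natr1; case: (leqP n k) => nk /=.
    by rewrite addrAC lerD2r.
  rewrite addr0 (@le_trans _ _ 0)//; last by apply: sumr_ge0.
  by rewrite subr_le0 natr1 ler_nat.
apply: ler_sum => a _; case: leqP => na /=; last by apply: sumr_ge0.
have h : (a - n < m.+1)%N by rewrite (leq_ltn_trans (leq_subr _ _)).
rewrite (bigD1 (Ordinal h))//= -subzn// subKr eqxx lerDl.
exact: sumr_ge0.
Qed.

Lemma cnt1_cvg t : cnt1 m t / m.+1%:R @[m --> \oo] --> (1 : R).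
Proof.
have [n ->] : exists n : nat, (fun m => cnt1 m t / m.+1%:R) = (fun m => cnt1 m n%:Z / m.+1%:R).
  case: t => n; first by exists n.
  by exists n.+1; apply/funext => m; rewrite NegzE cnt1N.
apply: (@squeeze_cvgr _ _ _ _ (fun m => 1 - n%:R * m.+1%:R^-1) (fun=> 1)).
- apply: nearW => m; rewrite ler_pdivrMr// mul1r cnt1_le andbT.
  by rewrite ler_pdivlMr// mulrBl mul1r divfK ?pnatr_eq0// cnt1_ge.
- rewrite -[X in _ --> X]subr0 -[X in _ - X](mulr0 n%:R); apply: cvgB; first exact: cvg_cst.
  by apply: cvgMr; exact: cvg_harmonic.
- exact: cvg_cst.
Qed.

Definition fejer_coef m (r : 'rV[int]_N) : R :=
  (fejer_card R N m)^-1 * \sum_j \sum_k (@freq N m j - @freq N m k == r)%:R.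

Lemma fejer_coefE m r : fejer_coef m r = \prod_i (cnt1 m (r ord0 i) / m.+1%:R).
Proof.
rewrite big_split/= prodr_const card_ord mulrC.
rewrite /fejer_coef /fejer_card card_ffun !card_ord natrX exprVn; congr (_ * _).
rewrite bigA_distr_bigA/=; apply: eq_bigr => j _.
rewrite bigA_distr_bigA/=; apply: eq_bigr => k _.
have [h|h] := eqVneq (freq j - freq k) r.
  by rewrite big1// => i _; rewrite -h !mxE eqxx.
have [i hi] : exists i, (j i : nat)%:Z - (k i : nat)%:Z != r ord0 i.
  apply/existsP; apply: contraNT h => /existsPn h; apply/eqP/rowP => i.
  by rewrite !mxE; apply/eqP; have := h i; rewrite negbK.
by rewrite (bigD1 i)//= (negbTE hi) mul0r.
Qed.

Lemma fejer_coef_cvg r : fejer_coef m r @[m --> \oo] --> (1 : R).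
Proof.
rewrite (_ : (fun m => _) = (fun m => \prod_i (cnt1 m (r ord0 i) / m.+1%:R))); last first.
  by apply/funext => m; exact: fejer_coefE.
rewrite [X in _ --> X](_ : 1 = \prod_(i < N) 1); last by rewrite big1.
apply: (@cvg_big R^o _ *%R 1 xpredT _ nat \oo _
  (fun i m => cnt1 m (r ord0 i) / m.+1%:R) (fun=> 1)).
  exact: mul_continuous.
by move=> i _; exact: cnt1_cvg.
Qed.

Lemma Rintegral_cosq q th : \int[P]_x cosq q th x = (q == 0)%:R * cos th.
Proof.
have [->|q0] := eqVneq q 0; last by rewrite integral_cosq// mul0r.
by under eq_Rintegral do rewrite cosq0; rewrite Rintegral_prob_cst mul1r.
Qed.

Lemma Rintegral_cosqM q th r eta : \int[P]_x (cosq r th x * cosq q eta x) =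
  2^-1 * ((q == - r)%:R * cos (th + eta)) + 2^-1 * ((q == r)%:R * cos (th - eta)).
Proof.
under eq_Rintegral do rewrite cosqM.
have b c p et : bmeas (fun x : 'rV[R]_N => c * cosq p et x).
  by apply: bmeasM; [exact: bmeas_cst|exact: bmeas_cosq].
rewrite bRintD// !bRintZ; try exact: bmeas_cosq.
have -> : (q == - r) = (r + q == 0) by rewrite addrC addr_eq0.
have -> : (q == r) = (r - q == 0) by rewrite subr_eq0 eq_sym.
by rewrite !Rintegral_cosq.
Qed.

(** A real mode contains both frequencies [r] and [- r], hence the mean of the two coefficients. *)
Lemma fejer_cosq m r th x : fejer m (cosq r th) x =
  2^-1 * (fejer_coef m r + fejer_coef m (- r)) * cosq r th x.
Proof.
rewrite fejerE; last exact: bmeas_cosq.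
rewrite /fejer_coef -mulrDr -big_split/= mulrA [2^-1 * _]mulrC -!mulrA; congr (_ * _).
rewrite mulr_suml mulr_sumr; apply: eq_bigr => j _.
rewrite -big_split/= mulr_suml mulr_sumr; apply: eq_bigr => k _.
rewrite !Rintegral_cosqM addr0 subr0 opprK cosDpihalf cosBpihalf.
set q := _ - freq k; rewrite /cosq addr0 cosBpihalf.
set D := 2 * pi * dotq r x.
have cq : (q == r)%:R * cos (2 * pi * dotq q x) = (q == r)%:R * cos D.
  by have [->|] := eqVneq q r; rewrite ?mul0r.
have sq : (q == r)%:R * sin (2 * pi * dotq q x) = (q == r)%:R * sin D.
  by have [->|] := eqVneq q r; rewrite ?mul0r.
have cq' : (q == - r)%:R * cos (2 * pi * dotq q x) = (q == - r)%:R * cos D.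
  by have [->|] := eqVneq q (- r); rewrite ?mul0r// dotqNl mulrN cosN.
have sq' : (q == - r)%:R * sin (2 * pi * dotq q x) = - ((q == - r)%:R * sin D).
  by have [->|] := eqVneq q (- r); rewrite ?mul0r ?oppr0// dotqNl mulrN sinN mulrN.
rewrite (cosD D th).
transitivity (2^-1 * (((q == - r)%:R * cos (2 * pi * dotq q x)) * cos th +
  ((q == r)%:R * cos (2 * pi * dotq q x)) * cos th +
  ((q == - r)%:R * sin (2 * pi * dotq q x)) * sin th -
  ((q == r)%:R * sin (2 * pi * dotq q x)) * sin th)); first by ring.
by rewrite cq sq cq' sq'; ring.
Qed.

Lemma fejer_trig_unif (p : 'rV[R]_N -> R) (e : R) : trig p -> 0 < e ->
  \forall m \near \oo, forall x, `|fejer m p x - p x| <= e.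
Proof.
move=> tp; elim: tp e => [e e0|{}p c r th tp ih e e0].
  apply: nearW => m x; rewrite fejer_cst subrr normr0 ltW//.
have e2 : 0 < e / 2 by rewrite divr_gt0.
have h : 2^-1 * (fejer_coef m r + fejer_coef m (- r)) @[m --> \oo] --> (1 : R).
  rewrite [X in _ --> X](_ : 1 = 2^-1 * (1 + 1)); last by field.
  by apply: cvgMr; apply: cvgD; exact: fejer_coef_cvg.
have c1 : 0 < e / 2 / (`|c| + 1) by rewrite divr_gt0// ltr_pwDr.
move/cvgrPdist_le : h => /(_ _ c1) h.
apply: filterS2 h (ih _ e2) => m h1 h2 x.
rewrite fejerD; [|by apply: bmeasM; [exact: bmeas_cst|exact: bmeas_cosq]|exact: bmeas_trig].
rewrite fejerZ ?fejer_cosq; last exact: bmeas_cosq.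
rewrite opprD addrACA (le_trans (ler_normD _ _))// (splitr e) lerD//.
set k := 2^-1 * _ in h1 *.
rewrite (_ : _ - _ = c * (k - 1) * cosq r th x); last by ring.
rewrite normrM (le_trans (ler_piMr _ (cosq_abs _ _ _)))// normrM distrC.
rewrite (@le_trans _ _ ((`|c| + 1) * (e / 2 / (`|c| + 1))))//.
  by apply: ler_pM => //; rewrite lerDl.
by rewrite mulrC divfK// gt_eqF// ltr_pwDr.
Qed.

(** Uniform convergence on trigonometric polynomials extends by density, as Fejer means contract the
    L^1 norm. *)
Lemma fejer_L1 (u : 'rV[R]_N -> R) : bmeas u ->
  \int[P]_x `|fejer m u x - u x| @[m --> \oo] --> (0 : R).
Proof.
move=> bu; apply/cvgrPdist_le => e e0.
have e3 : 0 < e / 3 by rewrite divr_gt0.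
have [p tp] := trig_dense (@torusP_cell R N) (bmeas_integrable P bu) e3.
have bp := bmeas_trig tp; have bup := bmeasB bu bp.
rewrite bRint_EFin; last exact: bmeas_norm.
rewrite lee_fin => up.
have := fejer_trig_unif tp e3; apply: filterS => m hm.
have bF w : bmeas w -> bmeas (fejer m w) by move=> bw; apply: bmeas_trig; exact: trig_fejer.
rewrite sub0r normrN ger0_norm; last by apply: Rintegral_ge0.
apply: (@le_trans _ _ (\int[P]_x (`|fejer m (fun y => u y - p y) x| +
    (`|fejer m p x - p x| + `|u x - p x|)))).
  apply: bRint_le.
  - by apply: bmeas_norm; apply: bmeasB => //; exact: bF.
  - apply: bmeasD; first by apply: bmeas_norm; exact: bF.
    by apply: bmeasD; apply: bmeas_norm => //; apply: bmeasB => //; exact: bF.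
  move=> x; rewrite fejerB//.
  rewrite (_ : fejer m u x - u x = (fejer m u x - fejer m p x) +
    ((fejer m p x - p x) + - (u x - p x))); last by ring.
  apply: le_trans (ler_normD _ _) _; rewrite lerD2l.
  by apply: le_trans (ler_normD _ _) _; rewrite normrN.
have b1 : bmeas (fun x => `|fejer m (fun y => u y - p y) x|) by apply: bmeas_norm; exact: bF.
have b2 : bmeas (fun x => `|fejer m p x - p x|).
  by apply: bmeas_norm; apply: bmeasB => //; exact: bF.
have b3 : bmeas (fun x => `|u x - p x|) by exact: bmeas_norm.
rewrite bRintD//; last exact: bmeasD.
rewrite bRintD//.
have -> : e = e / 3 + (e / 3 + e / 3) by field.
apply: lerD; first exact: le_trans (fejer_contract _ _) up.
by apply: lerD => //; exact: bRint_le_cst.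
Qed.

End fejer_limit.

(** * Fejer means of solutions *)

Section vector_fejer.
Context (R : realType) (N d l : nat) (A : 'I_N -> 'M[R]_(d, l)).
Local Notation P := (torusP R N).
Implicit Types u w : 'rV[R]_N -> 'rV[R]_d.

Definition vbmeas u := forall i, bmeas (fun x => u x ord0 i).

Definition vmean u : 'rV[R]_d := \row_i \int[P]_x u x ord0 i.

Definition vfejer m u x : 'rV[R]_d := \row_i fejer m (fun y => u y ord0 i) x.

Lemma norm_le_sum (x : 'rV[R]_d) : `|x| <= \sum_i `|x ord0 i|.
Proof.
rewrite norm_rV_le; last exact: sumr_ge0.
apply/forallP => i; rewrite (bigD1 i)//= lerDl; exact: sumr_ge0.
Qed.

Lemma vbmeas_vtrig u : vtrig u -> vbmeas u.
Proof. by move=> tu i; apply: bmeas_trig; exact: vtrig_coord. Qed.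

Lemma vbmeas_meas u : vbmeas u -> measurable_fun setT u.
Proof. by move=> bu; apply/measurable_rVP => i; exact: (bu i).1. Qed.

Lemma vbmeas_bounded u : vbmeas u -> exists B : R, forall x, `|u x| <= B.
Proof.
move=> bu; have h i : exists B : R, forall x, `|u x ord0 i| <= B by exact: (bu i).2.
exists (\sum_i sval (cid (h i))) => x; apply: le_trans (norm_le_sum _) _.
by apply: ler_sum => i _; exact: (svalP (cid (h i))).
Qed.

Lemma vbmeasD u w : vbmeas u -> vbmeas w -> vbmeas (fun x => u x + w x).
Proof. by move=> bu bw i; under eq_fun do rewrite mxE; exact: bmeasD. Qed.

Lemma vbmeasB u w : vbmeas u -> vbmeas w -> vbmeas (fun x => u x - w x).
Proof. by move=> bu bw i; under eq_fun do rewrite !mxE; exact: bmeasB. Qed.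

Lemma vbmeas_cst (a : 'rV[R]_d) : vbmeas (fun=> a).
Proof. by move=> i; exact: bmeas_cst. Qed.

Lemma vbmeas_comp u (f : 'rV[R]_d -> R) : vbmeas u -> continuous f ->
  bmeas (fun x => f (u x)).
Proof.
move=> bu cf; split.
  exact: (measurableT_comp (continuous_rV_measurable cf) (vbmeas_meas bu)).
have [B uB] := vbmeas_bounded bu.
have cK : compact [set x : 'rV[R]_d | `|x| <= B].
  apply: bounded_closed_compact.
    by exists B; split; [exact: num_real|move=> M BM x /= /le_trans; apply; exact: ltW].
  rewrite (_ : [set x | _] = Num.norm @^-1` [set y : R | y <= B])//.
  apply: preimage_closed; [by move=> x _; exact: norm_continuous|exact: closed_le].
have [C [_ hC]] : bounded_set (f @` [set x : 'rV[R]_d | `|x| <= B]).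
  apply: compact_bounded; apply: continuous_compact => //.
  exact: continuous_subspaceT.
exists (C + 1) => x; apply: (hC (C + 1)); first by rewrite ltrDl.
by exists (u x) => //=.
Qed.

Lemma vbmeas_norm u : vbmeas u -> bmeas (fun x => `|u x|).
Proof. by move=> bu; apply: (vbmeas_comp bu); exact: norm_continuous. Qed.

(** In the double sum of the Fejer mean, the pairs [j = k] add up to the mean of [u]; the other
    pairs have nonzero frequency and, by [kerA_coef], amplitudes in the kernel of the symbol. *)
Lemma vfejer_Atrig m u : vbmeas u -> kerA A u ->
  exists2 w, Atrig A w & forall x, vfejer m u x = vmean u + w x.
Proof.
move=> bu ku.
pose C q th : 'rV[R]_d := \row_i \int[P]_x (u x ord0 i * cosq q th x).
pose t j k x := let q := @freq N m j - @freq N m k in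
  cosq q 0 x *: ((fejer_card R N m)^-1 *: C q 0) +
  cosq q (- (pi / 2)) x *: ((fejer_card R N m)^-1 *: C q (- (pi / 2))).
exists (fun x => \sum_j \sum_k (if j == k then 0 else t j k x)).
  apply: Atrig_sum => j; apply: Atrig_sum => k.
  case: eqP => [_|/eqP jk]; first exact: Atrig0.
  by apply: AtrigD; apply: Atrig_mono; rewrite ?freqB_neq0//
    -scalemxAl kerA_coef ?scaler0.
move=> x; apply/rowP => i; rewrite !mxE fejerE//.
pose F j k := (fejer_card R N m)^-1 * (cosq (@freq N m j - @freq N m k) 0 x *
   \int[P]_y (u y ord0 i * cosq (freq j - freq k) 0 y) +
   cosq (freq j - freq k) (- (pi / 2)) x *
   \int[P]_y (u y ord0 i * cosq (freq j - freq k) (- (pi / 2)) y)).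
transitivity (\sum_j \sum_k F j k).
  by rewrite mulr_sumr; apply: eq_bigr => j _; rewrite mulr_sumr.
transitivity (\sum_j \sum_k ((if j == k then F j k else 0) +
                             (if j == k then 0 else F j k))).
  apply: eq_bigr => j _; apply: eq_bigr => k _.
  by case: ifP; rewrite ?addr0 ?add0r.
under eq_bigr do rewrite big_split/=.
rewrite big_split/=; congr (_ + _).
  rewrite sum_diag; last by move=> j k /negbTE ->.
  rewrite (eq_bigr (fun=> (fejer_card R N m)^-1 * \int[P]_x u x ord0 i)).
    rewrite sumr_const -mulr_natl mulrA divff ?mul1r// gt_eqF//.
    exact: fejer_card_gt0.
  move=> j _; rewrite eqxx /F subrr !cosq0 cos0 cosN cos_pihalf mul0r addr0 mul1r.
  by congr (_ * _); apply: eq_Rintegral => y _; rewrite cosq0 cos0 mulr1.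
rewrite summxE; apply: eq_bigr => j _; rewrite summxE; apply: eq_bigr => k _.
case: ifP => _; first by rewrite mxE.
by rewrite /t /F !mxE; ring.
Qed.

Lemma vfejer_bound m u (B : R) x : vbmeas u -> (forall y, `|u y| <= B) ->
  `|vfejer m u x| <= B.
Proof.
move=> bu uB; have B0 : 0 <= B := le_trans (normr_ge0 _) (uB 0).
rewrite norm_rV_le//; apply/forallP => i; rewrite mxE; apply: fejer_bound => // y.
exact: le_trans (coord_le_norm _ _) (uB y).
Qed.

Lemma vbmeas_vfejer m u : vbmeas u -> vbmeas (vfejer m u).
Proof.
move=> bu i; under eq_fun do rewrite mxE.
by apply: bmeas_trig; exact: trig_fejer.
Qed.

Lemma vfejer_L1 u : vbmeas u ->
  \int[P]_x `|vfejer m u x - u x| @[m --> \oo] --> (0 : R).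
Proof.
move=> bu.
apply: (@squeeze_cvgr _ _ _ _ (fun=> 0)
  (fun m => \sum_i \int[P]_x `|fejer m (fun y => u y ord0 i) x - u x ord0 i|)).
- apply: nearW => m; rewrite Rintegral_ge0//=.
  have bi i : bmeas (fun x => `|fejer m (fun y => u y ord0 i) x - u x ord0 i|).
    by apply: bmeas_norm; apply: bmeasB => //; apply: bmeas_trig; exact: trig_fejer.
  rewrite -bRint_sum//; apply: bRint_le; [|exact: bmeas_sum|].
    by apply: vbmeas_norm; apply: vbmeasB => //; exact: vbmeas_vfejer.
  by move=> x; apply: le_trans (norm_le_sum _) _; apply: ler_sum => i _; rewrite !mxE.
- exact: cvg_cst.
- rewrite [X in _ --> X](_ : 0 = \sum_(i < d) 0); last by rewrite big1.
  apply: (@cvg_big R^o _ +%R 0 xpredT _ nat \oo _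
    (fun i m => \int[P]_x `|fejer m (fun y => u y ord0 i) x - u x ord0 i|) (fun=> 0)).
    exact: add_continuous.
  by move=> i _; exact: fejer_L1.
Qed.

End vector_fejer.

(** * Weak convergence of rapidly oscillating functions *)

Section oscillation.
Context (R : realType) (N : nat).
Local Notation P := (torusP R N).

Lemma cos_lt1 (t : R) : 0 < `|t| < 1 -> cos (2 * pi * t) != 1.
Proof.
move=> /andP[t0 t1]; have pi0 := pi_gt0 R.
have -> : cos (2 * pi * t) = cos (pi * `|t| + pi * `|t|).
  have [h|h] := leP 0 t; first by rewrite ger0_norm//; congr cos; ring.
  by rewrite ltr0_norm// -cosN; congr cos; ring.
have s0 : 0 < sin (pi * `|t|) by apply: sin_gt0_pi; rewrite mulr_gt0//= gtr_pMr.
have := cos2Dsin2 (pi * `|t|); rewrite cosD => h; apply/eqP; nra.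
Qed.

Lemma rotation_fixed (a b c s : R) : c != 1 ->
  c * a - s * b = a -> s * a + c * b = b -> a = 0 /\ b = 0.
Proof.
move=> c1 h1 h2.
have : (a ^+ 2 + b ^+ 2) * (1 - c) = 0.
  transitivity (a * (a - (c * a - s * b)) + b * (b - (s * a + c * b))); first by ring.
  by rewrite h1 h2 !subrr !mulr0 addr0.
move/eqP; rewrite mulf_eq0 subr_eq0 [1 == _]eq_sym (negbTE c1) orbF.
by rewrite paddr_eq0 ?sqr_ge0// !sqrf_eq0 => /andP[/eqP a0 /eqP b0].
Qed.

(** Translation by [e_i / n] leaves [F (n x)] unchanged and rotates the pair of cosine and sine
    integrals by the angle [2 pi q_i / n]. For [q_i] nonzero the bound on [q] makes this rotation
    nontrivial, so both integrals vanish. *)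
Lemma oscillation_mode (F : 'rV[R]_N -> R) (q : 'rV[int]_N) th n : bmeas F -> Defs.periodic F ->
  q != 0 -> (forall i, `|q ord0 i| < n%:Z) ->
  \int[P]_x (F (n%:R *: x) * cosq q th x) = 0.
Proof.
move=> bF pF q0 qn.
have [i qi] : exists i, q ord0 i != 0.
  apply/existsP; apply: contraNT q0 => /existsPn h; apply/eqP/rowP => i.
  by rewrite mxE; apply/eqP; have := h i; rewrite negbK.
have n0 : (0 < n)%N by rewrite -ltz_nat; exact: le_lt_trans (normr_ge0 _) (qn i).
have nR : n%:R != 0 :> R by rewrite pnatr_eq0 -lt0n.
have pFn : Defs.periodic (fun x => F (n%:R *: x)).
  move=> x z; rewrite scalerDr -[RHS](pF _ (fun i => n%:Z * z i)); congr (F (_ + _)).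
  by apply/rowP => k; rewrite !mxE intrM.
have bFn : bmeas (fun x : 'rV[R]_N => F (n%:R *: x)).
  have [mF [B FB]] := bF; split; last by exists B.
  apply: (measurableT_comp mF); apply/measurable_rVP => k.
  under eq_fun do rewrite mxE.
  by apply: measurable_funM => //; exact: measurable_coord.
pose I t := \int[P]_x (F (n%:R *: x) * cosq q t x).
have bI t : bmeas (fun x : 'rV[R]_N => F (n%:R *: x) * cosq q t x).
  by apply: bmeasM => //; exact: bmeas_cosq.
pose al : R := 2 * pi * ((q ord0 i)%:~R / n%:R).
have IE t : I t = cos t * I 0 - sin t * I (- (pi / 2)).
  rewrite /I -!bRintZ// -bRintB.
  - apply: eq_Rintegral => x _; rewrite {1}/cosq cosD.
    rewrite {1}/cosq addr0 [in RHS]/cosq cosBpihalf; ring.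
  - by apply: bmeasM => //; exact: bmeas_cst.
  - by apply: bmeasM => //; exact: bmeas_cst.
have Ial t : I (al + t) = I t.
  have [mG [B GB]] := bI t.
  rewrite /I -(torus_translate (n%:R^-1 *: delta_mx ord0 i) mG GB); last first.
    by move=> x z; rewrite pFn cosq_period.
  apply: eq_Rintegral => x _; rewrite cosq_shift dotqZr dotq_delta.
  rewrite scalerDr scalerA divff// scale1r.
  have -> : delta_mx ord0 i = \row_k ((k == i)%:Z)%:~R :> 'rV[R]_N.
    by apply/rowP => k; rewrite !mxE eqxx/=; case: (k == i).
  by rewrite pF [n%:R^-1 * _]mulrC.
have qn1 : 0 < `|(q ord0 i)%:~R / n%:R : R| < 1.
  apply/andP; split; first by rewrite normr_gt0 mulf_neq0 ?intr_eq0 ?invr_eq0.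
  rewrite normrM normfV ltr_pdivrMr ?normr_gt0// mul1r normr_nat.
  by have := qn i; rewrite -(ltr_int R) intr_norm.
have al1 : cos al != 1 := cos_lt1 qn1.
have h1 := Ial 0; have h2 := Ial (- (pi / 2)).
rewrite addr0 (IE al) in h1.
rewrite (IE (al - pi / 2)) cosBpihalf (_ : sin (al - pi / 2) = - cos al) in h2; last first.
  by rewrite sinB sin_pihalf cos_pihalf mulr0 mulr1 sub0r.
rewrite mulNr opprK in h2.
have [a0 b0] := rotation_fixed al1 h1 h2.
by rewrite -/(I th) IE a0 b0 !mulr0 subr0.
Qed.

(** Once [n] exceeds the frequencies of [p] the identity is exact, and the threshold does not depend
    on [F]. This uniformity later allows the oscillating function to change with [n]. *)
Lemma oscillation_trig (p : 'rV[R]_N -> R) : trig p -> \forall n \near \oo, forall F : 'rV[R]_N -> R,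
  bmeas F -> Defs.periodic F ->
  \int[P]_x (F (n%:R *: x) * p x) = \int[P]_x F x * \int[P]_x p x.
Proof.
have bFn (F : 'rV[R]_N -> R) n : bmeas F -> bmeas (fun x : 'rV[R]_N => F (n%:R *: x)).
  move=> [mF [B FB]]; split; last by exists B.
  apply: (measurableT_comp mF); apply/measurable_rVP => k.
  under eq_fun do rewrite mxE.
  by apply: measurable_funM => //; exact: measurable_coord.
elim=> [|{}p c q th tp ih].
  apply: nearW => n F bF pF; under eq_Rintegral do rewrite mulr0.
  by rewrite Rintegral_prob_cst mulr0.
have h : \forall n \near \oo, (0 < n)%N /\ forall i, `|q ord0 i| < n%:Z.
  exists (\sum_i `|q ord0 i|%N).+1 => // n /= hn; split; first exact: leq_ltn_trans hn.
  move=> i; rewrite -abszE ltz_nat (leq_trans _ hn)// ltnS (bigD1 i)//=.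
  exact: leq_addr.
apply: filterS2 h ih => n [n0 hn] ih F bF pF.
have bc : bmeas (fun x : 'rV[R]_N => c * cosq q th x).
  by apply: bmeasM; [exact: bmeas_cst|exact: bmeas_cosq].
have bp := bmeas_trig tp; have bF' := bFn F n bF.
have bFc : bmeas (fun x : 'rV[R]_N => F (n%:R *: x) * cosq q th x).
  by apply: bmeasM => //; exact: bmeas_cosq.
under eq_Rintegral do rewrite mulrDr mulrCA.
rewrite bRintD; [|by apply: bmeasM => //; exact: bmeas_cst|exact: bmeasM].
rewrite ih// bRintZ// [in RHS]bRintD// mulrDr; congr (_ + _).
rewrite bRintZ; last exact: bmeas_cosq.
have [->|q0] := eqVneq q 0; last by rewrite oscillation_mode// integral_cosq// !mulr0.
have -> : cosq (0 : 'rV[int]_N) th = fun=> cos th by apply/funext => x; rewrite cosq0.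
rewrite Rintegral_prob_cst; under eq_Rintegral do rewrite mulrC.
have [mF [B FB]] := bF.
by rewrite bRintZ// (torus_scale n0 mF FB pF); ring.
Qed.

Lemma oscillation (g : 'rV[R]_N -> R) (e : R) : P.-integrable setT (EFin \o g) ->
  0 < e -> \forall n \near \oo, forall (F : 'rV[R]_N -> R) (B : R),
  measurable_fun setT F -> (forall x, `|F x| <= B) -> Defs.periodic F ->
  `|\int[P]_x (F (n%:R *: x) * g x) - \int[P]_x F x * \int[P]_x g x| <= B * e.
Proof.
move=> ig e0; have e2 : 0 < e / 2 by rewrite divr_gt0.
have [p tp gp] := trig_dense (@torusP_cell R N) ig e2.
have bp := bmeas_trig tp; have ip := bmeas_integrable P bp.
have igp : P.-integrable setT (EFin \o (fun x => g x - p x)).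
  by rewrite (_ : _ \o _ = (fun x => (EFin \o g) x - (EFin \o p) x)%E)//; exact: integrableB.
have igpn : P.-integrable setT (EFin \o (fun x => `|g x - p x|)).
  by rewrite (_ : _ \o _ = abse \o (EFin \o (fun x => g x - p x)))//; exact: integrable_abse.
have {}gp : \int[P]_x `|g x - p x| <= e / 2 by rewrite -lee_fin -EFin_Rintegral.
apply: filterS (oscillation_trig tp) => n hn F B mF FB pF.
have bF : bmeas F by split => //; exists B.
have bF' : bmeas (fun x : 'rV[R]_N => F (n%:R *: x)).
  split; last by exists B.
  apply: (measurableT_comp mF); apply/measurable_rVP => k.
  under eq_fun do rewrite mxE.
  by apply: measurable_funM => //; exact: measurable_coord.
have B0 : 0 <= B := le_trans (normr_ge0 _) (FB 0).
have iFh h : P.-integrable setT (EFin \o h) ->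
    P.-integrable setT (EFin \o (fun x => F (n%:R *: x) * h x)).
  move=> ih; have mh : measurable_fun setT h by apply/measurable_EFinP; exact: measurable_int ih.
  apply: (@le_integrable _ _ _ P _ measurableT _ (fun x => B%:E * (EFin \o h) x)%E) => //.
  - by apply/measurable_EFinP; apply: measurable_funM => //; exact: bF'.1.
  - move=> x _ /=; rewrite lee_fin normrM normrM (ger0_norm B0).
    by rewrite ler_wpM2r.
  - exact: integrableZl.
have E : \int[P]_x (F (n%:R *: x) * g x) - \int[P]_x F x * \int[P]_x g x =
   \int[P]_x (F (n%:R *: x) * (g x - p x)) - \int[P]_x F x * \int[P]_x (g x - p x).
  rewrite RintegralB// mulrBr -(hn F bF pF).
  under [in RHS]eq_Rintegral do rewrite mulrBr.
  by rewrite RintegralB//; [ring|exact: iFh|exact: iFh].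
rewrite E (le_trans (ler_normB _ _))// (splitr e) mulrDr; apply: lerD.
  apply: le_trans (le_normr_Rintegral _ (iFh _ igp)) _ => //.
  apply: (@le_trans _ _ (\int[P]_x (B * `|g x - p x|))).
    apply: le_Rintegral => //.
    - rewrite (_ : _ \o _ = abse \o (EFin \o (fun x => F (n%:R *: x) * (g x - p x))))//.
      exact/integrable_abse/iFh.
    - rewrite (_ : _ \o _ = (fun x => B%:E * (EFin \o (fun x => `|g x - p x|)%R) x)%E)//.
      exact: integrableZl.
    - by move=> x _; rewrite normrM ler_wpM2r.
  by rewrite RintegralZl// ler_wpM2l.
rewrite normrM; apply: ler_pM => //.
  apply: le_trans (bRint_norm _ bF) _; apply: bRint_le_cst => //; exact: bmeas_norm.
exact: le_trans (le_normr_Rintegral _ igp) gp.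
Qed.

End oscillation.

(** * Gluing of oscillating fields *)

Lemma norm_mulmx_le (R : realType) m n (b : 'rV[R]_m) (W : 'M[R]_(m, n)) :
  `|b *m W| <= `|b| * \sum_i \sum_j `|W i j|.
Proof.
apply: le_trans (norm_le_sum _) _.
rewrite exchange_big/= mulr_sumr; apply: ler_sum => j _; rewrite mxE.
apply: le_trans (ler_norm_sum _ _ _) _; rewrite mulr_sumr; apply: ler_sum => i _.
by rewrite normrM ler_wpM2r// coord_le_norm.
Qed.

(** * Stability of the kernel of the symbol *)

Section kernel_lsc.
Context (R : realType) (N d l : nat) (A : 'I_N -> 'M[R]_(d, l)).

Lemma enormZ n (c : R) (x : 'rV[R]_n) : enorm (c *: x) = `|c| * enorm x.
Proof.
rewrite /enorm; under eq_bigr do rewrite mxE exprMn.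
by rewrite -mulr_sumr sqrtrM ?sqr_ge0// sqrtr_sqr.
Qed.

Lemma enorm_gt0 n (x : 'rV[R]_n) : x != 0 -> 0 < enorm x.
Proof.
move=> x0; rewrite sqrtr_gt0 lt_neqAle sumr_ge0 ?andbT; last by move=> i _; exact: sqr_ge0.
apply: contra_neq x0 => /esym h; apply/rowP => i; rewrite mxE; apply/eqP.
have /eqP := h; rewrite psumr_eq0; last by move=> j _; exact: sqr_ge0.
by move=> /allP/(_ i); rewrite mem_index_enum sqrf_eq0; exact.
Qed.

Lemma isymbol_rank (q r : 'rV[int]_N) : constant_rank A -> q != 0 -> r != 0 ->
  \rank (isymbol A q) = \rank (isymbol A r).
Proof.
move=> cr q0 r0.
have nz (p : 'rV[int]_N) : p != 0 -> map_mx intr p != 0 :> 'rV[R]_N.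
  apply: contra_neq => h; apply/rowP => i; rewrite mxE.
  by have /eqP := congr1 (fun s : 'rV[R]_N => s ord0 i) h; rewrite !mxE intr_eq0 => /eqP.
have unit (p : 'rV[int]_N) : p != 0 ->
    enorm ((enorm (map_mx intr p : 'rV[R]_N))^-1 *: (map_mx intr p : 'rV[R]_N)) = 1.
  move=> /nz/enorm_gt0 p0; rewrite enormZ ger0_norm ?invr_ge0 ?ltW//.
  by rewrite mulVf// gt_eqF.
have sym (p : 'rV[int]_N) : p != 0 ->
    \rank (kermx (symbol A ((enorm (map_mx intr p : 'rV[R]_N))^-1 *: map_mx intr p))) =
    (d - \rank (isymbol A p))%N.
  move=> /nz/enorm_gt0 p0; rewrite mxrank_ker.
  rewrite (_ : symbol A _ = (enorm (map_mx intr p : 'rV[R]_N))^-1 *: isymbol A p).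
    by rewrite mxrank_scale_nz// invr_neq0// gt_eqF.
  by rewrite scaler_sumr; apply: eq_bigr => k _; rewrite mxE scalerA.
have := cr _ _ (unit _ q0) (unit _ r0); rewrite !sym// => h.
have := rank_leq_row (isymbol A q); have := rank_leq_row (isymbol A r) => h1 h2.
by rewrite -(subKn h2) h subKn.
Qed.

(* The rank of [M + t B] being that of [M], the rows of [X (M + t B)], where
   [X M Y = 1], still span the row space of [M + t B]; the correction of [a]
   only has to be made along the rows of [X]. *)
Lemma kernel_perturb (M B : 'M[R]_(d, l)) (a : 'rV[R]_d) (e : R) :
  a *m M = 0 -> 0 < e -> exists2 t0 : R, 0 < t0 &
  forall t, 0 < t -> t <= t0 -> \rank (M + t *: B)%R = \rank M ->
    exists2 a', a' *m (M + t *: B) = 0 & `|a' - a| <= e.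
Proof.
move=> aM e0.
pose X := pinvmx (col_base M); pose Y := pinvmx (row_base M).
have XMY : X *m M *m Y = 1%:M.
  have : X *m (col_base M *m row_base M) *m Y = 1%:M.
    rewrite mulmxA mulVpmx ?col_base_full// mul1mx mulmxVp//.
    exact: row_base_free.
  by rewrite mulmx_base.
pose c1 := \sum_i \sum_j `|(X *m B *m Y) i j|.
pose c2 := \sum_i \sum_j `|X i j|.
have c10 : 0 <= c1 by apply: sumr_ge0 => i _; exact: sumr_ge0.
have c20 : 0 <= c2 by apply: sumr_ge0 => i _; exact: sumr_ge0.
pose c3 := `|a *m B *m Y|; have c30 : 0 <= c3 by exact: normr_ge0.
have c1p : 0 < c1 + 1 by exact: ltr_wpDl.
have c2p : 0 < c2 + 1 by exact: ltr_wpDl.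
have c3p : 0 < c3 + 1 by exact: ltr_wpDl.
(* The first bound gives [|b| <= 2 |b G|] for [G = 1 + t X B Y], hence invertibility; the second
   keeps the correction [b X] below [e]. *)
exists (Num.min (2 * (c1 + 1))^-1 (e / (2 * (c3 + 1) * (c2 + 1)))).
  by rewrite lt_min invr_gt0 mulr_gt0//= divr_gt0// !mulr_gt0.
move=> t t0; rewrite le_min => /andP[tc1 tc2] rk.
set Mt := M + t *: B; have rkMt : \rank Mt = \rank M := rk.
pose G := X *m Mt *m Y.
have GE : G = 1%:M + t *: (X *m B *m Y).
  by rewrite /G /Mt mulmxDr mulmxDl XMY -scalemxAr -scalemxAl.
have Gle (b : 'rV[R]_(\rank M)) : `|b| <= 2 * `|b *m G|.
  have h : `|t *: (b *m (X *m B *m Y))| <= 2^-1 * `|b|.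
    rewrite normrZ gtr0_norm//; apply: (@le_trans _ _ (t * (`|b| * c1))).
      by rewrite ler_wpM2l ?(ltW t0)// norm_mulmx_le.
    rewrite mulrCA [leLHS]mulrC ler_wpM2r//.
    apply: (@le_trans _ _ ((2 * (c1 + 1))^-1 * (c1 + 1))).
      by rewrite ler_pM ?(ltW t0)// lerDl.
    by rewrite invfM -mulrA mulVf ?mulr1// gt_eqF.
  have -> : b *m G = b + t *: (b *m (X *m B *m Y)).
    by rewrite GE mulmxDr mulmx1 -scalemxAr.
  have := lerB_dist b (- (t *: (b *m (X *m B *m Y)))); rewrite normrN opprK; lra.
have Gu : G \in unitmx.
  rewrite -row_free_unit -kermx_eq0; apply/eqP/row_matrixP => i; rewrite row0.
  have := Gle (row i (kermx G)); rewrite -row_mul mulmx_ker row0 normr0 mulr0.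
  by rewrite normr_le0 => /eqP.
have aMt : a *m Mt = t *: (a *m B) by rewrite /Mt mulmxDr aM add0r scalemxAr.
pose b := a *m Mt *m Y *m invmx G.
have bG : b *m G = a *m Mt *m Y by rewrite /b mulmxKV.
have bn : `|b| <= 2 * (t * c3).
  by rewrite (le_trans (Gle b))// bG aMt -scalemxAl normrZ gtr0_norm.
exists (a - b *m X); last first.
  rewrite addrAC subrr sub0r normrN (le_trans (norm_mulmx_le _ _))//.
  apply: (@le_trans _ _ (2 * (t * (c3 + 1)) * (c2 + 1))).
    rewrite ler_pM ?lerDl// (le_trans bn)// ler_pM2l// ler_pM2l//.
    by rewrite lerDl.
  rewrite (_ : _ * _ = t * (2 * (c3 + 1) * (c2 + 1))); last by ring.
  by rewrite -ler_pdivlMr// !mulr_gt0.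
have sub : (Mt <= X *m Mt)%MS.
  have h := mxrank_leqif_sup (submxMl X Mt).
  rewrite -h; apply/eqP/anti_leq; rewrite h.1 /= rkMt.
  apply: leq_trans (mxrankM_maxl (X *m Mt) Y).
  by rewrite mxrank_unit.
have /submxP[c hc] : ((a - b *m X) *m Mt <= X *m Mt)%MS.
  exact: submx_trans (submxMl _ _) sub.
(* Multiplication by [Y] turns [(a - b X) Mt = c X Mt] into [c G = 0], because [b] was chosen with
   [b G = a Mt Y]. *)
have : c *m G = 0.
  rewrite /G mulmxA -hc mulmxBl mulmxBl.
  have -> : b *m X *m Mt *m Y = b *m G by rewrite /G !mulmxA.
  by rewrite bG subrr.
move=> /(congr1 (mulmx^~ (invmx G))); rewrite mulmxK// mul0mx => c0.
by rewrite hc c0 mul0mx.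
Qed.

(** After division by [n] the symbol at [n q + k] is a perturbation with [t = 1/n] of that at [q];
    constant rank supplies the equality of ranks that [kernel_perturb] requires. *)
Lemma kernel_lsc q k (a : 'rV[R]_d) (e : R) : constant_rank A -> q != 0 ->
  a *m isymbol A q = 0 -> 0 < e ->
  \forall n \near \oo, q *+ n + k != 0 /\
    exists2 a', a' *m isymbol A (q *+ n + k) = 0 & `|a' - a| <= e.
Proof.
move=> cr q0 aq e0.
have [t0 t00 ht] := kernel_perturb (isymbol A k) aq e0.
have [i qi] : exists i, q ord0 i != 0.
  apply/existsP; apply: contraNT q0 => /existsPn h; apply/eqP/rowP => i.
  by rewrite mxE; apply/eqP; have := h i; rewrite negbK.
near=> n.
have n1 : t0^-1 <= n%:R by near: n; exact: nbhs_infty_ger.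
have n0 : 0 < n%:R :> R by rewrite (lt_le_trans _ n1)// invr_gt0.
have nk : `|k ord0 i|%:~R + 1 <= n%:R :> R by near: n; exact: nbhs_infty_ger.
have qk0 : q *+ n + k != 0.
  apply/eqP => h; have := congr1 (fun s : 'rV[int]_N => s ord0 i) h.
  rewrite mxE mulmxnE mxE => /eqP; rewrite addr_eq0 => /eqP hk.
  have : (n%:R : R) <= `|k ord0 i|%:~R.
    rewrite -normrN -hk normrMn rmorphMn/= -[leLHS]mul1r mulr_natr.
    by rewrite lerMn2r (_ : 1 = 1%:~R)// ler_int -gtz0_ge1 normr_gt0 qi orbT.
  by move=> h2; have := le_trans nk h2; rewrite gerDl ler10.
split=> //.
have E : isymbol A (q *+ n + k) = n%:R *: (isymbol A q + n%:R^-1 *: isymbol A k).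
  by rewrite isymbolD isymbolMn scalerDr scalerA divff ?scale1r// gt_eqF.
have [|||a' ha' aa'] := ht n%:R^-1; last by exists a' => //; rewrite E -scalemxAr ha' scaler0.
- by rewrite invr_gt0.
- by rewrite -[t0]invrK lef_pV2// posrE invr_gt0.
- rewrite -(isymbol_rank cr qk0 q0) E mxrank_scale_nz// gt_eqF//.
Unshelve. all: by end_near. Qed.

End kernel_lsc.

(** * Modulated oscillations close to the kernel *)

Section gluing.
Context (R : realType) (N d l : nat) (A : 'I_N -> 'M[R]_(d, l)).
Hypothesis cr : constant_rank A.
Local Notation P := (torusP R N).

(** The product of modes at [k] and [n q] splits into modes at [n q + k] and [n q - k]. The
    amplitude [a] need not be in the kernels there, but for large [n] it is close to amplitudes that
    are. *)
Lemma glue_mode q th (a : 'rV[R]_d) chi (e : R) : q != 0 -> a *m isymbol A q = 0 ->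
  trig chi -> 0 < e -> \forall n \near \oo,
  exists2 w, Atrig A w &
    forall x : 'rV[R]_N, `|w x - (chi x * cosq q th (n%:R *: x)) *: a| <= e.
Proof.
move=> q0 aq tchi; elim: tchi e => [e e0|{}chi c k et tchi ih e e0].
  apply: nearW => n; exists (fun=> 0); first exact: Atrig0.
  by move=> x; rewrite mul0r scale0r subrr normr0 ltW.
have e2 : 0 < e / 2 by rewrite divr_gt0.
(* Each of the two new modes has weight [c / 2], so this accuracy costs at most [e / 4] apiece; the
   remaining [e / 2] is left for the tail [chi]. *)
have e3 : 0 < e / 2 / (`|c| + 1) by rewrite divr_gt0// ltr_wpDl.
near=> n.
have [qk [a1 a1k a1a]] : q *+ n + k != 0 /\ exists2 a', a' *m isymbol A (q *+ n + k) = 0 &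
    `|a' - a| <= e / 2 / (`|c| + 1) by near: n; exact: kernel_lsc.
have [qk' [a2 a2k a2a]] : q *+ n - k != 0 /\ exists2 a', a' *m isymbol A (q *+ n - k) = 0 &
    `|a' - a| <= e / 2 / (`|c| + 1) by near: n; exact: kernel_lsc.
have [w Aw hw] : exists2 w, Atrig A w & forall x : 'rV[R]_N,
    `|w x - (chi x * cosq q th (n%:R *: x)) *: a| <= e / 2 by near: n; exact: ih.
exists (fun x => cosq (q *+ n + k) (th + et) x *: ((c / 2) *: a1) +
  (cosq (q *+ n - k) (th - et) x *: ((c / 2) *: a2) + w x)).
  apply: AtrigS => //; first by rewrite -scalemxAl a1k scaler0.
  by apply: AtrigS => //; rewrite -scalemxAl a2k scaler0.
move=> x.
have -> : (c * cosq k et x + chi x) * cosq q th (n%:R *: x) =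
  c / 2 * cosq (q *+ n + k) (th + et) x + (c / 2 * cosq (q *+ n - k) (th - et) x +
  chi x * cosq q th (n%:R *: x)).
  rewrite cosq_scale; transitivity (c * (cosq (q *+ n) th x * cosq k et x) +
    chi x * cosq (q *+ n) th x); first by ring.
  by rewrite cosqM; ring.
set C1 := cosq _ _ _; set C2 := cosq _ _ _; set C3 := chi x * _.
have -> : C1 *: ((c / 2) *: a1) + (C2 *: ((c / 2) *: a2) + w x) -
    (c / 2 * C1 + (c / 2 * C2 + C3)) *: a =
  (c / 2 * C1) *: (a1 - a) + ((c / 2 * C2) *: (a2 - a) + (w x - C3 *: a)).
  by apply/rowP => i; rewrite !mxE; ring.
have hc (C : R) (b : 'rV[R]_d) : `|C| <= 1 -> `|b - a| <= e / 2 / (`|c| + 1) ->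
    `|(c / 2 * C) *: (b - a)| <= e / 4.
  move=> C1' ba; rewrite normrZ normrM.
  apply: (@le_trans _ _ ((`|c| + 1) / 2 * 1 * (e / 2 / (`|c| + 1)))).
    apply: ler_pM => //.
    apply: ler_pM => //; rewrite normrM [`|2^-1|]ger0_norm ?invr_ge0//; lra.
  have : `|c| + 1 != 0 by rewrite gt_eqF// ltr_wpDl.
  by move: (`|c| + 1) => s s0; rewrite (_ : s / 2 * 1 * (e / 2 / s) = e / 4)//; field.
have h1 : `|(c / 2 * C1) *: (a1 - a)| <= e / 4 by apply: hc => //; exact: cosq_abs.
have h2 : `|(c / 2 * C2) *: (a2 - a)| <= e / 4 by apply: hc => //; exact: cosq_abs.
have h3 := hw x.
apply: le_trans (ler_normD _ _) _.
have := ler_normD ((c / 2 * C2) *: (a2 - a)) (w x - C3 *: a); lra.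
Unshelve. all: by end_near. Qed.

Lemma glue_trig psi chi (e : R) : Atrig A psi -> trig chi -> 0 < e ->
  \forall n \near \oo, exists2 w, Atrig A w &
    forall x : 'rV[R]_N, `|w x - chi x *: psi (n%:R *: x)| <= e.
Proof.
move=> tpsi tchi; elim: tpsi e => [e e0|{}psi a q th q0 aq tpsi ih e e0].
  apply: nearW => n; exists (fun=> 0); first exact: Atrig0.
  by move=> x; rewrite scaler0 subrr normr0 ltW.
have e2 : 0 < e / 2 by rewrite divr_gt0.
apply: filterS2 (glue_mode th q0 aq tchi e2) (ih _ e2) => n [w1 A1 h1] [w2 A2 h2].
exists (fun x => w1 x + w2 x); first exact: AtrigD.
move=> x; rewrite scalerDr scalerA opprD addrACA (splitr e).
by apply: le_trans (ler_normD _ _) _; apply: lerD.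
Qed.

Lemma vbmeas_dilate (u : 'rV[R]_N -> 'rV[R]_d) n : vbmeas u ->
  vbmeas (fun x => u (n%:R *: x)).
Proof.
move=> bu i; have [mu [B uB]] := bu i; split; last by exists B.
apply: (measurableT_comp mu); apply/measurable_rVP => k.
under eq_fun do rewrite mxE.
by apply: measurable_funM => //; exact: measurable_coord.
Qed.

Lemma vbmeasZ (z : 'rV[R]_N -> R) (u : 'rV[R]_N -> 'rV[R]_d) : bmeas z -> vbmeas u ->
  vbmeas (fun x => z x *: u x).
Proof. by move=> bz bu i; under eq_fun do rewrite mxE; exact: bmeasM. Qed.

(** A bounded measurable [z] is approximated by trigonometric polynomials in L^1, not uniformly,
    which is why the uniform error of [glue_trig] becomes an integral. *)
Lemma glue (z : 'rV[R]_N -> R) psi (e : R) : bmeas z -> Atrig A psi -> 0 < e ->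
  \forall n \near \oo, exists2 w, Atrig A w &
    \int[P]_x `|w x - z x *: psi (n%:R *: x)| <= e.
Proof.
move=> bz Apsi e0; have bpsi := vbmeas_vtrig (Atrig_vtrig Apsi).
have [B0 psiB0] := vbmeas_bounded bpsi.
pose B := `|B0| + 1; have B1 : 0 < B by exact: ltr_wpDl.
have psiB x : `|psi x| <= B.
  by rewrite (le_trans (psiB0 x))// (le_trans (ler_norm _))// lerDl.
have e2 : 0 < e / 2 by rewrite divr_gt0.
have e3 : 0 < e / 2 / B by rewrite divr_gt0.
have [chi tchi] := trig_dense (@torusP_cell R N) (bmeas_integrable P bz) e3.
have bchi := bmeas_trig tchi; have bzc := bmeas_norm (bmeasB bz bchi).
rewrite bRint_EFin// lee_fin => zchi.
apply: filterS (glue_trig Apsi tchi e2) => n [w Aw hw]; exists w => //.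
have bw := vbmeas_vtrig (Atrig_vtrig Aw).
apply: (@le_trans _ _ (\int[P]_x (e / 2 + B * `|z x - chi x|))).
  apply: bRint_le.
  - apply: vbmeas_norm; apply: vbmeasB => //; apply: vbmeasZ => //.
    exact: vbmeas_dilate.
  - by apply: bmeasD; [exact: bmeas_cst|apply: bmeasM => //; exact: bmeas_cst].
  move=> x; rewrite (_ : w x - z x *: psi (n%:R *: x) = (w x - chi x *: psi (n%:R *: x)) -
     (z x - chi x) *: psi (n%:R *: x)); last by apply/rowP => i; rewrite !mxE; ring.
  apply: le_trans (ler_normB _ _) _; apply: lerD => //.
  by rewrite normrZ mulrC ler_wpM2r.
rewrite bRintD; [|exact: bmeas_cst|by apply: bmeasM => //; exact: bmeas_cst].
rewrite Rintegral_prob_cst bRintZ// [leRHS](splitr e) lerD2l.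
by rewrite mulrC -ler_pdivlMr.
Qed.

End gluing.

(** * Laminates and the quasiconvex envelope *)

Section lipschitz.
Context (R : realType) (d : nat).
Implicit Types f g : 'rV[R]_d -> R.

Definition lip (L : R) f := forall x y, `|f x - f y| <= L * `|x - y|.

Lemma lip_continuous L f : lip L f -> continuous f.
Proof.
move=> fL x.
apply/(@cvgrPdist_lt R R^o _ _ (@nbhs_filter 'rV[R]_d x) f (f x)) => e e0.
have L1 : 0 < `|L| + 1 by exact: ltr_wpDl.
apply/nbhs_ballP; exists (e / (`|L| + 1)) => /=; first by rewrite divr_gt0.
move=> y; rewrite -ball_normE/= => xy; apply: (le_lt_trans (fL x y)).
apply: (@le_lt_trans _ _ ((`|L| + 1) * `|x - y|)).
  by rewrite ler_wpM2r// (le_trans (ler_norm _))// lerDl.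
by rewrite mulrC -ltr_pdivlMr.
Qed.

End lipschitz.

(** * Lamination of kernel fields *)

Section laminate.
Context (R : realType) (N d l : nat) (A : 'I_N -> 'M[R]_(d, l)).
Hypothesis cr : constant_rank A.
Local Notation P := (torusP R N).

(** The labels are the boxes of a grid of side [e] covering the cube of radius [B]; the shift by [B]
    makes the floors natural numbers. *)
Lemma simple_approx (phi : 'rV[R]_N -> 'rV[R]_d) (e : R) : vbmeas phi -> 0 < e ->
  exists (I : finType) (ka : 'rV[R]_N -> I) (p : I -> 'rV[R]_d),
    (forall i, measurable (ka @^-1` [set i])) /\
    forall y, `|phi y - p (ka y)| <= e.
Proof.
move=> bphi e0; have [B phiB] := vbmeas_bounded bphi.
pose t (y : 'rV[R]_N) i := (phi y ord0 i + B) / e.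
have ti y i : 0 <= t y i.
  rewrite divr_ge0 ?(ltW e0)// -lerBlDr sub0r.
  by have := le_trans (coord_le_norm _ i) (phiB y); rewrite ler_norml => /andP[].
have tM y i : t y i <= (2 * B) / e.
  rewrite ler_pM2r ?invr_gt0// mulr_natl mulr2n lerD2r.
  by have := le_trans (coord_le_norm _ i) (phiB y); rewrite ler_norml => /andP[].
pose M := `|Num.floor ((2 * B) / e)|%N.
have fM y i : (`|Num.floor (t y i)| < M.+1)%N.
  rewrite ltnS -lez_nat !gez0_abs ?floor_ge0//; last exact: le_trans (tM y i).
  exact: le_floor.
exists {ffun 'I_d -> 'I_M.+1}, (fun y => [ffun i => inord `|Num.floor (t y i)|%N]),
  (fun k : {ffun 'I_d -> 'I_M.+1} => \row_i ((k i : nat)%:R * e - B)); split.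
  move=> k; rewrite (_ : _ @^-1` _ = \bigcap_(i in [set: 'I_d])
    ((fun y => t y i) @^-1` [set r | (inord `|Num.floor r|%N : 'I_M.+1) = k i])); last first.
    apply/seteqP; split=> y /=; first by move=> <- i _; rewrite ffunE.
    by move=> h; apply/ffunP => i; rewrite ffunE h.
  apply: fin_bigcap_measurable => // i _; rewrite -[X in measurable X]setTI.
  have mt : measurable_fun setT (fun y => t y i).
    by apply: measurable_funM => //; apply: measurable_funD => //; exact: (bphi i).1.
  by apply: mt => //; exact: (measurable_floor_set [set z | inord `|z|%N = k i]).
move=> y; rewrite norm_rV_le ?(ltW e0)//; apply/forallP => i; rewrite !mxE ffunE inordK//.
have E : (`|Num.floor (t y i)|%N)%:R = (Num.floor (t y i))%:~R :> R.
  by rewrite pmulrn gez0_abs// floor_ge0.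
have -> : phi y ord0 i = t y i * e - B by rewrite divfK ?gt_eqF//; ring.
rewrite E; have := Num.Theory.floor_le (t y i); have := Num.Theory.floorD1_gt (t y i).
rewrite intrD; move: (t y i) ((_)%:~R) => s f h1 h2.
rewrite (_ : _ - _ = (s - f) * e); last by ring.
by rewrite normrM (gtr0_norm e0) ler_piMl ?(ltW e0)// ger0_norm; lra.
Qed.

Definition pmass (I : finType) (ka : 'rV[R]_N -> I) i : R :=
  \int[P]_x \1_(ka @^-1` [set i]) x.

Lemma pmass_ge0 I ka i : 0 <= @pmass I ka i.
Proof. by apply: Rintegral_ge0 => x _; rewrite indicE. Qed.

Lemma sum_indic_fiber (I : finType) (ka : 'rV[R]_N -> I) (h : I -> R) y :
  \sum_i \1_(ka @^-1` [set i]) y * h i = h (ka y).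
Proof.
rewrite (bigD1 (ka y))//= indicE mem_set// mul1r big1 ?addr0// => i ik.
by rewrite indicE memNset ?mul0r// => /= kai; rewrite kai eqxx in ik.
Qed.

Lemma Rintegral_fibers (I : finType) (ka : 'rV[R]_N -> I) (h : I -> R) :
  (forall i, measurable (ka @^-1` [set i])) ->
  \int[P]_y h (ka y) = \sum_i pmass ka i * h i.
Proof.
move=> mk; under eq_Rintegral do rewrite -sum_indic_fiber.
rewrite bRint_sum; last first.
  by move=> i; apply: bmeasM; [exact: bmeas_indic|exact: bmeas_cst].
apply: eq_bigr => i _; under eq_Rintegral do rewrite mulrC.
by rewrite bRintZ; [exact: mulrC|exact: bmeas_indic].
Qed.

Lemma bmeas_fibers (I : finType) (ka : 'rV[R]_N -> I) (h : I -> 'rV[R]_N -> R) :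
  (forall i, measurable (ka @^-1` [set i])) -> (forall i, bmeas (h i)) ->
  bmeas (fun y => h (ka y) y).
Proof.
move=> mk bh; rewrite (_ : (fun y => _) =
    (fun y => \sum_i \1_(ka @^-1` [set i]) y * h i y)).
  by apply: bmeas_sum => i; apply: bmeasM => //; exact: bmeas_indic.
by apply/funext => y; rewrite (sum_indic_fiber ka (fun i => h i y)).
Qed.

Lemma glue_many (I : finType) (ka : 'rV[R]_N -> I) (psi : I -> 'rV[R]_N -> 'rV[R]_d) (e : R) :
  (forall i, measurable (ka @^-1` [set i])) -> (forall i, Atrig A (psi i)) -> 0 < e ->
  \forall n \near \oo, exists2 w, Atrig A w &
    \int[P]_y `|w y - psi (ka y) (n%:R *: y)| <= e.
Proof.
move=> mk Apsi e0; pose c : R := #|I|%:R + 1.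
have c0 : 0 < c by exact: ltr_wpDl.
have ec : 0 < e / c by rewrite divr_gt0.
have bpsi i := vbmeas_vtrig (Atrig_vtrig (Apsi i)).
have h : \forall n \near \oo, forall i, exists2 w, Atrig A w &
    \int[P]_y `|w y - (\1_(ka @^-1` [set i]) y : R) *: psi i (n%:R *: y)| <= e / c.
  by apply: filter_forall => i; apply: (glue cr (bmeas_indic _ (mk i)) (Apsi i) ec).
apply: filterS h => n hn; pose w i := s2val (cid2 (hn i)).
have Aw i : Atrig A (w i) := s2valP (cid2 (hn i)).
have hw i := s2valP' (cid2 (hn i)); rewrite -/(w _) in hw.
exists (fun y => \sum_i w i y); first exact: Atrig_sum.
have bw i := vbmeas_vtrig (Atrig_vtrig (Aw i)).
pose D i y := w i y - (\1_(ka @^-1` [set i]) y : R) *: psi i (n%:R *: y).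
have bD i : bmeas (fun y => `|D i y|).
  apply: vbmeas_norm; apply: vbmeasB => //; apply: vbmeasZ; first exact: bmeas_indic.
  exact: vbmeas_dilate.
apply: (@le_trans _ _ (\int[P]_y \sum_i `|D i y|)).
  apply: bRint_le; last first.
  - move=> y; apply: le_trans (ler_norm_sum _ _ _); rewrite sumrB.
    suff -> : \sum_i (\1_(ka @^-1` [set i]) y : R) *: psi i (n%:R *: y) = psi (ka y) (n%:R *: y) by [].
    apply/rowP => j; rewrite summxE -(sum_indic_fiber ka (fun i => psi i (n%:R *: y) ord0 j)).
    by apply: eq_bigr => i _; rewrite mxE.
  - exact: bmeas_sum.
  apply: vbmeas_norm; apply: vbmeasB; first exact/vbmeas_vtrig/Atrig_vtrig/Atrig_sum.
  move=> j; apply: (bmeas_fibers (h := fun i y => psi i (n%:R *: y) ord0 j)) => // i.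
  exact: vbmeas_dilate.
rewrite bRint_sum//; apply: (@le_trans _ _ (\sum_(i : I) e / c)).
  by apply: ler_sum => i _; exact: hw.
rewrite sumr_const -mulr_natl mulrCA ler_piMr ?(ltW e0)//.
by rewrite ler_pdivrMr// mul1r lerDl.
Qed.

(** On the piece labelled [i] the field [phi] is nearly the constant [p i], and adding [psi i (n y)]
    there stays in the kernel up to a small L^1 error; for large [n] each piece sees the full
    average of its oscillation. One [n], hence one [w], serves all [j]. The term [L * de] pays for
    freezing [phi]. *)
Lemma laminate (I J : finType) (f : J -> 'rV[R]_d -> R) (L : R) ka (p : I -> 'rV[R]_d)
    (phi : 'rV[R]_N -> 'rV[R]_d) (psi : I -> 'rV[R]_N -> 'rV[R]_d) (de e : R) x :
  (forall j, lip L (f j)) -> 0 <= L -> Atrig A phi -> (forall i, Atrig A (psi i)) ->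
  (forall i, measurable (ka @^-1` [set i])) ->
  (forall y, `|phi y - p (ka y)| <= de) -> 0 < e ->
  exists2 w, Atrig A w & forall j,
    `|\int[P]_y f j (x + w y) -
      \sum_i pmass ka i * \int[P]_y f j (x + p i + psi i y)| <= L * de + e.
Proof.
move=> fL L0 Aphi Apsi mk hde e0.
have cf j : continuous (f j) := lip_continuous (fL j).
have bphi := vbmeas_vtrig (Atrig_vtrig Aphi).
have bpsi i := vbmeas_vtrig (Atrig_vtrig (Apsi i)).
have bf j (z : 'rV[R]_d) (u : 'rV[R]_N -> 'rV[R]_d) : vbmeas u -> bmeas (fun y => f j (z + u y)).
  move=> bu; apply: (vbmeas_comp (u := fun y => z + u y)) => //.
  by apply: vbmeasD => //; exact: vbmeas_cst.
have e1 : 0 < e / 2 / (L + 1) by rewrite !divr_gt0// ltr_wpDl.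
pose c : R := #|I|%:R + 1; have c0 : 0 < c by exact: ltr_wpDl.
pose F j i y := f j (x + p i + psi i y).
have bF j i : bmeas (F j i) by exact: bf.
have pF j i : Defs.periodic (F j i).
  move=> y z; rewrite /F; congr (f j (_ + _)).
  by have [_ ->] := vtrig_smooth_torus (Atrig_vtrig (Apsi i)).
have osc : \forall n \near \oo, forall i, forall j,
    `|\int[P]_y (\1_(ka @^-1` [set i]) y * F j i (n%:R *: y)) -
     pmass ka i * \int[P]_y F j i y| <= e / 2 / c.
  apply: filter_forall => i; apply: filter_forall => j.
  have [mF [B0 FB0]] := bF j i; pose B := `|B0| + 1.
  have B1 : 0 < B by exact: ltr_wpDl.
  have FB y : `|F j i y| <= B.
    by rewrite (le_trans (FB0 y))// (le_trans (ler_norm _))// lerDl.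
  have e2 : 0 < e / 2 / c / B by rewrite !divr_gt0.
  apply: filterS (oscillation (bmeas_integrable P (bmeas_indic _ (mk i))) e2) => n.
  move=> /(_ _ _ mF FB (pF j i)); rewrite [B * _]mulrC divfK ?gt_eqF//.
  by under [X in `|X - _| <= _ -> _]eq_Rintegral do rewrite mulrC; rewrite [_ * \int[P]_x \1__ x]mulrC.
have [n [[w Aw hw] ho]] := filter_ex (filterI (glue_many mk Apsi e1) osc).
exists (fun y => phi y + w y); first exact: AtrigD.
have bw := vbmeas_vtrig (Atrig_vtrig Aw).
move=> j.
have bG : bmeas (fun y => F j (ka y) (n%:R *: y)).
  apply: (bmeas_fibers (h := fun i y => F j i (n%:R *: y))) => // i.
  by apply: bf; exact: vbmeas_dilate.
have bpn : bmeas (fun y => `|w y - psi (ka y) (n%:R *: y)|).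
  apply: vbmeas_norm; apply: vbmeasB => // k.
  apply: (bmeas_fibers (h := fun i y => psi i (n%:R *: y) ord0 k)) => // i.
  exact: vbmeas_dilate.
have h1 : `|\int[P]_y f j (x + (phi y + w y)) - \int[P]_y F j (ka y) (n%:R *: y)| <=
    L * de + e / 2.
  apply: le_trans (bRint_dist _ _ _) _ => //.
    by apply: bf; exact: vbmeasD.
  apply: (@le_trans _ _ (\int[P]_y (L * de + L * `|w y - psi (ka y) (n%:R *: y)|))).
    apply: bRint_le.
    - by apply: bmeas_norm; apply: bmeasB => //; apply: bf; exact: vbmeasD.
    - by apply: bmeasD; [exact: bmeas_cst|apply: bmeasM => //; exact: bmeas_cst].
    move=> y; apply: le_trans (fL _ _ _) _; rewrite -mulrDr ler_wpM2l//.
    rewrite (_ : _ - _ = (phi y - p (ka y)) + (w y - psi (ka y) (n%:R *: y))); last first.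
      by apply/rowP => k; rewrite !mxE; ring.
    by apply: le_trans (ler_normD _ _) _; rewrite lerD2r.
  rewrite bRintD; [|exact: bmeas_cst|by apply: bmeasM => //; exact: bmeas_cst].
  rewrite Rintegral_prob_cst bRintZ// lerD2l.
  apply: (@le_trans _ _ ((L + 1) * (e / 2 / (L + 1)))).
    by apply: ler_pM => //; [exact: Rintegral_ge0|rewrite lerDl].
  by rewrite mulrC divfK// gt_eqF// ltr_wpDl.
have h2 : `|\int[P]_y F j (ka y) (n%:R *: y) -
    \sum_i pmass ka i * \int[P]_y F j i y| <= e / 2.
  under eq_Rintegral => y _ do rewrite -(sum_indic_fiber ka (fun i => F j i (n%:R *: y))).
  rewrite bRint_sum; last first.
    move=> i; apply: bmeasM; first exact: bmeas_indic.
    by apply: bf; exact: vbmeas_dilate.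
  rewrite -sumrB; apply: le_trans (ler_norm_sum _ _ _) _.
  apply: (@le_trans _ _ (\sum_(i : I) e / 2 / c)).
    by apply: ler_sum => i _; exact: ho.
  rewrite sumr_const -[leLHS]mulr_natl mulrCA ler_piMr ?divr_ge0 ?(ltW e0)//.
  by rewrite ler_pdivrMr// mul1r lerDl.
rewrite (_ : e = e / 2 + e / 2) ?addrA; last exact: splitr.
apply: le_trans (ler_distD (\int[P]_y F j (ka y) (n%:R *: y)) _ _) _.
exact: lerD.
Qed.

End laminate.

(** * The quasiconvex envelope *)

Section envelope.
Context (R : realType) (N d l : nat) (A : 'I_N -> 'M[R]_(d, l)).
Hypothesis cr : constant_rank A.
Local Notation P := (torusP R N).

Definition Qset (f : 'rV[R]_d -> R) x : set R :=
  [set r | exists2 phi, Atrig A phi & r = \int[P]_y f (x + phi y)].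

(** The competitors are trigonometric because those can be glued; [Qenv_quasiconvex] recovers smooth
    test fields through Fejer means. *)
Definition Qenv f x : R := inf (Qset f x).

Variables (f : 'rV[R]_d -> R) (L c : R).
Hypotheses (fL : lip L f) (L0 : 0 <= L) (fc : forall x, c <= f x).

Lemma bmeas_lip_comp (g : 'rV[R]_d -> R) (M : R) x (u : 'rV[R]_N -> 'rV[R]_d) :
  lip M g -> vbmeas u -> bmeas (fun y => g (x + u y)).
Proof.
move=> gM bu; apply: (vbmeas_comp (u := fun y => x + u y)).
  by apply: vbmeasD => //; exact: vbmeas_cst.
exact: lip_continuous gM.
Qed.

Lemma Rintegral_lip (g : 'rV[R]_d -> R) (M : R) x x' (u w : 'rV[R]_N -> 'rV[R]_d) :
  lip M g -> 0 <= M -> vbmeas u -> vbmeas w ->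
  \int[P]_y g (x + u y) <= \int[P]_y g (x' + w y) + M * (`|x - x'| + \int[P]_y `|u y - w y|).
Proof.
move=> gM M0 bu bw.
have bg := @bmeas_lip_comp g M.
have bn : bmeas (fun y => `|u y - w y|) by apply: vbmeas_norm; exact: vbmeasB.
have bM : bmeas (fun y => M * (`|x - x'| + `|u y - w y|)).
  by apply: bmeasM; [exact: bmeas_cst|apply: bmeasD => //; exact: bmeas_cst].
apply: (@le_trans _ _ (\int[P]_y (g (x' + w y) + M * (`|x - x'| + `|u y - w y|)))).
  apply: bRint_le; [exact: bg|by apply: bmeasD => //; exact: bg|].
  move=> y; rewrite -lerBlDl (le_trans (ler_norm _))// (le_trans (gM _ _))//.
  rewrite ler_wpM2l// opprD addrACA; exact: ler_normD.
rewrite bRintD//; last exact: bg.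
by rewrite bRintZ ?bRintD ?Rintegral_prob_cst//;
  try apply: bmeasD => //; exact: bmeas_cst.
Qed.

Lemma Qset_lb x : lbound (Qset f x) c.
Proof.
move=> _ [phi Aphi ->]; apply: bRint_ge_cst => //.
exact: (bmeas_lip_comp x fL (vbmeas_vtrig (Atrig_vtrig Aphi))).
Qed.

Lemma Qset_neq0 x : Qset f x !=set0.
Proof. by eexists; exists (fun=> 0); [exact: Atrig0|]. Qed.

Lemma Qenv_le x phi : Atrig A phi -> Qenv f x <= \int[P]_y f (x + phi y).
Proof.
by move=> Aphi; apply: ge_inf; [exists c; exact: Qset_lb|exists phi].
Qed.

Lemma Qenv_approx x (e : R) : 0 < e ->
  exists2 phi, Atrig A phi & \int[P]_y f (x + phi y) <= Qenv f x + e.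
Proof.
move=> e0; have [|_ [phi Aphi ->] h] := @inf_adherent _ (Qset f x) e e0.
  by split; [exact: Qset_neq0|exists c; exact: Qset_lb].
by exists phi => //; exact: ltW.
Qed.

Lemma Qenv_le_id x : Qenv f x <= f x.
Proof.
have := Qenv_le x (Atrig0 A); under eq_Rintegral do rewrite addr0.
by rewrite Rintegral_prob_cst.
Qed.

Lemma Qenv_lip : lip L (Qenv f).
Proof.
have h x y : Qenv f x - Qenv f y <= L * `|x - y|.
  rewrite lerBlDl; apply/ler_addgt0Pr => e e0.
  have [phi Aphi he] := Qenv_approx y e0.
  have bphi := vbmeas_vtrig (Atrig_vtrig Aphi).
  apply: le_trans (Qenv_le x Aphi) _.
  apply: le_trans (Rintegral_lip x y fL L0 bphi bphi) _.
  under [X in `|x - y| + X]eq_Rintegral do rewrite subrr normr0.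
  by rewrite Rintegral_prob_cst addr0; lra.
move=> x y; rewrite ler_norml h andbT lerNl opprB.
by rewrite distrC h.
Qed.

(** On each piece where [x + phi] is almost constant, a near-optimal field for that constant is
    inserted; by [laminate] the outcome competes at [x]. *)
Lemma Qenv_Atrig x phi : Atrig A phi -> Qenv f x <= \int[P]_y Qenv f (x + phi y).
Proof.
move=> Aphi; apply/ler_addgt0Pr => e e0.
have bphi := vbmeas_vtrig (Atrig_vtrig Aphi).
(* The errors below add up to [(2 L + 2) de], which is at most [e]. *)
pose de := e / (3 * L + 2); have L1 : 0 < 3 * L + 2 by rewrite ltr_wpDl ?mulr_ge0.
have de0 : 0 < de by rewrite divr_gt0.
have [I [ka [p [mk hp]]]] := simple_approx bphi de0.
have hpsi i := cid2 (Qenv_approx (x + p i) de0).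
pose psi i := s2val (hpsi i).
have Apsi i : Atrig A (psi i) := s2valP (hpsi i).
have hQ i : \int[P]_y f (x + p i + psi i y) <= Qenv f (x + p i) + de := s2valP' (hpsi i).
have [w Aw /(_ tt)] := laminate cr (J := unit) (f := fun=> f) x (fun=> fL) L0 Aphi Apsi mk hp de0.
rewrite ler_distl => /andP[_ hw].
apply: le_trans (Qenv_le x Aw) _; apply: (le_trans hw).
have h1 : \sum_i pmass ka i * \int[P]_y f (x + p i + psi i y) <=
    \int[P]_y Qenv f (x + p (ka y)) + de.
  rewrite (Rintegral_fibers (fun i => Qenv f (x + p i)))//.
  apply: (@le_trans _ _ (\sum_i pmass ka i * (Qenv f (x + p i) + de))).
    by apply: ler_sum => i _; rewrite ler_wpM2l// pmass_ge0.
  under eq_bigr do rewrite mulrDr; rewrite big_split/= lerD2l.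
  by rewrite -(Rintegral_fibers (fun=> de))// Rintegral_prob_cst.
have bp : vbmeas (fun y => p (ka y)).
  move=> j; apply: (bmeas_fibers (h := fun i _ => p i ord0 j)) => // i; exact: bmeas_cst.
have h2 := Rintegral_lip x x Qenv_lip L0 bp bphi.
rewrite subrr normr0 add0r in h2.
have h3 : \int[P]_y `|p (ka y) - phi y| <= de.
  apply: bRint_le_cst; first by apply: vbmeas_norm; exact: vbmeasB.
  by move=> y; rewrite distrC.
have h4 : L * \int[P]_y `|p (ka y) - phi y| <= L * de by rewrite ler_wpM2l.
have h5 : (3 * L + 2) * de = e by rewrite mulrC divfK// gt_eqF.
have h6 : 0 <= L * de by rewrite mulr_ge0// ltW.
move: h1 h2 h4 h5 h6; set X1 := \sum_i _; set X2 := \int[P]_y _; set X3 := \int[P]_y _.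
by set X4 := \int[P]_y _; lra.
Qed.

(** The Fejer means of a smooth mean zero solution are trigonometric fields of the kernel converging
    in L^1, and the envelope is Lipschitz. *)
Lemma Qenv_quasiconvex : Aquasiconvex A (Qenv f).
Proof.
move=> x phi sphi mphi free.
have bphi : vbmeas phi by move=> i; exact: bmeas_smooth_coord.
have kphi := kerA_smooth sphi free.
have mean0 : vmean phi = 0.
  apply/rowP => i; rewrite !mxE; have := mphi i; rewrite tint_bmeas//.
  by move=> [].
rewrite tint_bmeas; last exact: bmeas_lip_comp Qenv_lip _.
rewrite lee_fin; apply/ler_addgt0Pr => e e0.
have L1 : 0 < L + 1 by rewrite ltr_wpDl.
have e1 : 0 < e / (L + 1) by rewrite divr_gt0.
have /cvgrPdist_le/(_ _ e1) h := vfejer_L1 bphi.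
have [m] := filter_ex h; rewrite sub0r normrN ger0_norm; last exact: Rintegral_ge0.
have [w Aw hw] := vfejer_Atrig m bphi kphi.
rewrite (_ : vfejer m phi = w); last by apply/funext => y; rewrite hw mean0 add0r.
move=> hm; apply: le_trans (Qenv_Atrig x Aw) _.
have bw := vbmeas_vtrig (Atrig_vtrig Aw).
apply: le_trans (Rintegral_lip x x Qenv_lip L0 bw bphi) _.
rewrite subrr normr0 add0r lerD2l.
apply: (@le_trans _ _ ((L + 1) * (e / (L + 1)))).
  by apply: ler_pM => //; [exact: Rintegral_ge0|rewrite lerDl].
by rewrite mulrC divfK// gt_eqF.
Qed.

End envelope.

(** * Separation in finite dimension *)

Section separation.
Context (R : realType) (n : nat).
Implicit Types (r s c z : 'rV[R]_n.+1) (S : set 'rV[R]_n.+1).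

Definition dot c r : R := \sum_i c ord0 i * r ord0 i.

Lemma dotC c r : dot c r = dot r c.
Proof. by apply: eq_bigr => i _; rewrite mulrC. Qed.

Lemma dotDr c r s : dot c (r + s) = dot c r + dot c s.
Proof. by rewrite -big_split/=; apply: eq_bigr => i _; rewrite mxE mulrDr. Qed.

Lemma dotZr c (t : R) r : dot c (t *: r) = t * dot c r.
Proof. by rewrite mulr_sumr; apply: eq_bigr => i _; rewrite mxE mulrCA. Qed.

Lemma dot_ge0 r : 0 <= dot r r.
Proof. by apply: sumr_ge0 => i _; rewrite -expr2 sqr_ge0. Qed.

Lemma dot_sqr_coord r i : r ord0 i ^+ 2 <= dot r r.
Proof.
rewrite /dot (bigD1 i)//= -expr2 lerDl; apply: sumr_ge0 => j _.
by rewrite -expr2 sqr_ge0.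
Qed.

Lemma continuous_dot : continuous (fun r => dot r r).
Proof.
apply: (@continuous_big R^o 'I_n.+1 +%R 0 xpredT _ 'rV[R]_n.+1 (index_enum _)
  (fun i x => x ord0 i * x ord0 i)) => [|i _]; first exact: add_continuous.
by apply: continuous_mul; exact: coord_continuous.
Qed.

Lemma quadratic_ge0 (a b : R) :
  (forall t, 0 < t -> t <= 1 -> 0 <= 2 * t * a + t ^+ 2 * b) -> 0 <= a.
Proof.
move=> h; rewrite leNgt; apply/negP => a0.
have b0 : 0 < b by have := h 1 ltr01 (lexx _); rewrite expr1n; lra.
pose t := Num.min 1 (- a / b).
have t0 : 0 < t by rewrite lt_min ltr01 divr_gt0// oppr_gt0.
have := h t t0; rewrite ge_min lexx => /(_ isT).
have tb : t * b <= - a by rewrite -ler_pdivlMr// /t ge_min lexx orbT.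
rewrite (_ : _ + _ = t * (2 * a + t * b)); last by ring.
by rewrite pmulr_rge0//; lra.
Qed.

(** A nearest point argument on the closure of [S - z] enlarged by upward rays in coordinate 0. The
    rays force separating vectors to satisfy [c_0 >= 0], for which [sep] is available, at the price
    of a one-sided conclusion in that coordinate. The closure absorbs the small errors in the
    convexity of [S]. *)
Lemma near_point_cone S z (e : R) : S !=set0 ->
  (forall s s' (t de : R), S s -> S s' -> 0 < t -> t <= 1 -> 0 < de ->
     exists2 s'', S s'' & `|s'' - (t *: s + (1 - t) *: s')| <= de) ->
  (forall c (de : R), 0 <= c ord0 ord0 -> 0 < de ->
     exists2 s, S s & dot c s <= dot c z + de) ->
  0 < e -> exists2 s, S s & s ord0 ord0 <= z ord0 ord0 + e /\
    forall i, i != ord0 -> `|s ord0 i - z ord0 i| <= e.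
Proof.
move=> [s0 Ss0] cvx sep e0.
pose T0 : set 'rV[R]_n.+1 := [set r | exists2 s, S s & s ord0 ord0 - z ord0 ord0 <= r ord0 ord0 /\
  forall i, i != ord0 -> r ord0 i = s ord0 i - z ord0 i].
have ST0 s : S s -> T0 (s - z).
  by move=> Ss; exists s => //; split=> [|i _]; rewrite !mxE.
pose T := closure T0.
have TP r : T r <-> forall de : R, 0 < de -> exists2 rho, T0 rho & `|r - rho| < de.
  split=> [Tr de de0|h B].
    have [rho [Trho]] := Tr _ (nbhsx_ballx r de de0).
    by rewrite -ball_normE/= => rr; exists rho.
  move=> /nbhs_ballP[de /= de0 hB]; have [rho Trho rr] := h de de0.
  by exists rho; split => //; apply: hB; rewrite -ball_normE.
have cvxT r rho (t : R) : T r -> T0 rho -> 0 < t -> t <= 1 -> T (t *: rho + (1 - t) *: r).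
  move=> /TP Tr [s Ss [s0r sr]] t0 t1; apply/TP => de de0.
  have de3 : 0 < de / 3 by rewrite divr_gt0.
  have [rho' [s' Ss' [s0r' sr']] hr'] := Tr _ de3.
  have [s'' Ss'' hs''] := cvx _ _ _ _ Ss Ss' t0 t1 de3.
  pose m := t *: rho + (1 - t) *: rho'.
  have hs i : `|s'' ord0 i - (t * s ord0 i + (1 - t) * s' ord0 i)| <= de / 3.
    by have := le_trans (coord_le_norm _ i) hs''; rewrite !mxE.
  (* Membership in [T0] is an inequality in coordinate 0, which is raised by [de / 3] to absorb the
     convexity error; the other coordinates must be exactly those of [s'' - z]. *)
  exists (\row_i if i == ord0 then m ord0 ord0 + de / 3 else s'' ord0 i - z ord0 i).
    exists s'' => //; split=> [|i /negbTE i0]; rewrite mxE ?eqxx ?i0//.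
    rewrite !mxE; have := hs ord0; rewrite ler_norml => /andP[_ h].
    have h1 : t * (s ord0 ord0 - z ord0 ord0) <= t * rho ord0 ord0 by rewrite ler_wpM2l// ltW.
    have h2 : (1 - t) * (s' ord0 ord0 - z ord0 ord0) <= (1 - t) * rho' ord0 ord0.
      by rewrite ler_wpM2l// subr_ge0.
    lra.
  rewrite norm_rV_lt//; apply/forallP => i; rewrite !mxE.
  have h1 : `|(1 - t) * (r ord0 i - rho' ord0 i)| <= de / 3.
    rewrite normrM (le_trans _ (ltW hr'))//; apply: (@le_trans _ _ (1 * `|r - rho'|)).
      apply: ler_pM => //; last by have := coord_le_norm (r - rho') i; rewrite !mxE.
      by rewrite ger0_norm ?subr_ge0//; lra.
    by rewrite mul1r.
  move: h1; have := hs i; rewrite !ler_norml ltr_norml => /andP[a1 a2] /andP[b1 b2].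
  have [i0|i0] := eqVneq i ord0.
    by rewrite i0 in a1 a2 b1 b2 *; apply/andP; split; lra.
  by rewrite sr// ; have := sr' i i0 => e1; rewrite e1 in b1 b2; apply/andP; split; lra.
have upT r (t : R) : T r -> 0 < t -> T (r + t *: delta_mx ord0 ord0).
  move=> /TP Tr t0; apply/TP => de de0; have [rho [s Ss [s0r sr]] hr] := Tr _ de0.
  exists (rho + t *: delta_mx ord0 ord0).
    exists s => //; split=> [|i i0]; rewrite !mxE ?eqxx ?mulr1.
      by rewrite (le_trans s0r)// lerDl ltW.
    by rewrite (negbTE i0) mulr0 addr0 sr.
  by rewrite opprD addrACA subrr addr0.
have Ts0 : T (s0 - z) by apply: subset_closure; exact: ST0.
(* Truncation at the norm of one known point gives compactness and does not change the minimum of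
   the norm over [T]. *)
pose K := T `&` [set r | dot r r <= dot (s0 - z) (s0 - z)].
have cK : compact K.
  apply: bounded_closed_compact.
    exists (1 + dot (s0 - z) (s0 - z)); split; first exact: num_real.
    move=> M hM r [_ /= hr]; apply: le_trans (ltW hM).
    rewrite norm_rV_le; last by rewrite addr_ge0// dot_ge0.
    apply/forallP => i; have := le_trans (dot_sqr_coord r i) hr.
    rewrite ler_norml => h; apply/andP; split; nra.
  apply: closedI; first exact: closed_closure.
  rewrite (_ : [set r | _] = (fun r => dot r r) @^-1` [set y : R | y <= dot (s0 - z) (s0 - z)])//.
  by apply: preimage_closed; [move=> x _; exact: continuous_dot|exact: closed_le].
have [c [Tc _] hc] : exists2 c, K c & forall r, K r -> dot c c <= dot r r.
  have K0 : K !=set0 by exists (s0 - z); split => //=.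
  have cd : {within K, continuous (fun r => dot r r)}.
    by apply: continuous_subspaceT; exact: continuous_dot.
  have [c Kc hc] := EVT_min_rV K0 cK cd.
  by exists c => [|r Kr]; [rewrite inE in Kc|apply: hc; rewrite inE].
have minT r : T r -> dot c c <= dot r r.
  move=> Tr; have [h|h] := leP (dot r r) (dot (s0 - z) (s0 - z)); first by apply: hc; split.
  apply: le_trans (ltW h); apply: hc; split => //=.
have dir r : (forall t, 0 < t -> t <= 1 -> T (c + t *: r)) -> 0 <= dot c r.
  move=> h; apply: (@quadratic_ge0 _ (dot r r)) => t t0 t1.
  have := minT _ (h t t0 t1).
  rewrite dotDr dotZr [dot (c + _) c]dotC dotDr dotZr [dot (c + _) r]dotC dotDr dotZr.
  by rewrite [dot r c]dotC; lra.
have c00 : 0 <= c ord0 ord0.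
  have := dir (delta_mx ord0 ord0) (fun t t0 _ => upT _ _ Tc t0).
  rewrite /dot (bigD1 ord0)//= mxE !eqxx mulr1 big1 ?addr0// => i i0.
  by rewrite mxE (negbTE i0) mulr0.
(* If the nearest point [c] were not 0, minimality would give [dot c (s - z) >= dot c c] for every
   [s] in [S], whereas [sep] provides some [s] with at most half of that. *)
have [c0|c0] := eqVneq (dot c c) 0; last first.
  have cp : 0 < dot c c by rewrite lt_neqAle eq_sym c0 dot_ge0.
  have [|s Ss hs] := sep c (dot c c / 2) c00; first by rewrite divr_gt0.
  have := dir ((s - z) - c); rewrite (_ : dot c (s - z - c) = dot c s - dot c z - dot c c); last first.
    by rewrite !dotDr -scaleN1r -[- c]scaleN1r !dotZr; ring.
  suff h : forall t, 0 < t -> t <= 1 -> T (c + t *: (s - z - c)) by move=> /(_ h); lra.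
  move=> t t0 t1; rewrite (_ : c + _ = t *: (s - z) + (1 - t) *: c).
    by apply: cvxT => //; exact: ST0.
  by rewrite scalerBr scalerBl scale1r addrCA.
have ce : c = 0.
  apply/rowP => i; rewrite mxE; apply/eqP; rewrite -sqrf_eq0 eq_le sqr_ge0 andbT.
  by rewrite -c0 dot_sqr_coord.
move/TP : Tc => /(_ _ e0)[rho [s Ss [s0r sr]]]; rewrite ce sub0r normrN => hrho.
exists s => //; split=> [|i i0].
  rewrite -lerBlDl (le_trans s0r)// (le_trans (ler_norm _))//.
  exact: le_trans (coord_le_norm _ _) (ltW hrho).
by rewrite -sr//; exact: le_trans (coord_le_norm _ _) (ltW hrho).
Qed.

End separation.

(** * Functions vanishing at infinity *)

Section ramp.
Context (R : realType).

Definition ramp (t : R) : R := if t <= 0 then 0 else if 1 <= t then 1 else t.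

Lemma ramp_01 t : 0 <= ramp t <= 1.
Proof.
by rewrite /ramp; case: (leP t 0) => h; case: (leP 1 t) => h'; apply/andP; split; lra.
Qed.

Lemma ramp_le0 t : t <= 0 -> ramp t = 0.
Proof. by rewrite /ramp => ->. Qed.

Lemma ramp_ge1 t : 1 <= t -> ramp t = 1.
Proof. by move=> h; rewrite /ramp h; case: leP => // h'; lra. Qed.

Lemma ramp_lip t s : t <= s -> 0 <= ramp s - ramp t <= s - t.
Proof.
move=> ts; rewrite /ramp; case: (leP s 0) => h1; case: (leP t 0) => h2;
  case: (leP 1 s) => h3; case: (leP 1 t) => h4; apply/andP; split; lra.
Qed.

Lemma ramp_dist t s : `|ramp t - ramp s| <= `|t - s|.
Proof.
wlog ts : t s / t <= s.
  move=> h; have [/h//|/ltW/h] := leP t s; by rewrite distrC [`|t - s|]distrC.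
have /andP[h1 h2] := ramp_lip ts.
by rewrite distrC ger0_norm// distrC ger0_norm ?subr_ge0.
Qed.

End ramp.

Section C0_functions.
Context (R : realType) (d : nat).
Implicit Types (f : 'rV[R]_d -> R) (x y : 'rV[R]_d).

Lemma norm_le_enorm x : `|x| <= enorm x.
Proof.
rewrite norm_rV_le ?sqrtr_ge0//; apply/forallP => i.
rewrite -sqrtr_sqr ler_sqrt; last by apply: sumr_ge0 => j _; exact: sqr_ge0.
rewrite (bigD1 i)//= lerDl; apply: sumr_ge0 => j _; exact: sqr_ge0.
Qed.

Lemma enorm_le x : enorm x <= d%:R * `|x|.
Proof.
rewrite -(ger0_norm (mulr_ge0 (ler0n _ d) (normr_ge0 x))) -sqrtr_sqr ler_sqrt ?sqr_ge0//.
apply: (@le_trans _ _ (\sum_(i < d) `|x| ^+ 2)).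
  by apply: ler_sum => i _; rewrite -[x ord0 i ^+ 2]real_normK ?num_real// ler_sqr ?nnegrE// coord_le_norm.
rewrite sumr_const card_ord exprMn -[leLHS]mulr_natl ler_wpM2r ?sqr_ge0//.
by case: d => [|n]; rewrite ?expr0n// ler_eXnr// ler1n.
Qed.

Lemma compact_norm_le (r : R) : compact [set x : 'rV[R]_d | `|x| <= r].
Proof.
apply: bounded_closed_compact.
  by exists r; split; [exact: num_real|move=> M rM x /= /le_trans; apply; exact: ltW].
rewrite (_ : [set x | _] = Num.norm @^-1` [set y : R | y <= r])//.
by apply: preimage_closed; [move=> x _; exact: norm_continuous|exact: closed_le].
Qed.

Lemma unif_continuous_compact f (K : set 'rV[R]_d) (e : R) : continuous f ->
  compact K -> 0 < e ->
  exists2 de : R, 0 < de & forall x y, K x -> `|x - y| <= de -> `|f x - f y| <= e.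
Proof.
move=> cf /compact_near_coveringP cK e0; have e2 : 0 < e / 2 by rewrite divr_gt0.
pose Q n x := forall y, `|x - y| <= n.+1%:R^-1 -> `|f x - f y| <= e.
have [n _ /(_ n (leqnn _)) hn] : \forall n \near \oo, K `<=` Q n; last first.
  by exists n.+1%:R^-1 => // x y Kx; exact: (hn x Kx y).
apply: cK => x Kx.
have /(@cvgrPdist_lt R R^o _ _ (@nbhs_filter 'rV[R]_d x) f (f x))/(_ _ e2) := cf x.
move=> /nbhs_ballP[r /= r0 hr]; have r2 : 0 < r / 2 by rewrite divr_gt0.
exists (ball x (r / 2), [set n | n.+1%:R^-1 < r / 2]).
  split; first exact: nbhsx_ballx.
  have /(@cvgrPdist_lt R R^o)/(_ _ r2) := @cvg_harmonic R.
  by apply: filterS => n; rewrite sub0r normrN /= ger0_norm ?invr_ge0.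
move=> [x' n] /=; rewrite -ball_normE/= => -[xx' nr] y xy.
have h1 : `|f x - f x'| < e / 2.
  by apply: hr; rewrite -ball_normE/= (lt_trans xx')// ltr_pdivrMr// ltr_pMr// ltr1n.
have h2 : `|f x - f y| < e / 2.
  apply: hr; rewrite -ball_normE/= (le_lt_trans (ler_distD x' _ _))// (splitr r).
  by apply: ltrD => //; exact: le_lt_trans xy nr.
rewrite (le_trans (ler_distD (f x) _ _))// (splitr e) distrC.
by apply: lerD; exact: ltW.
Qed.

Lemma C0_continuous f : C0 f -> continuous f. Proof. by case. Qed.

Lemma C0_bounded f : C0 f -> exists2 B : R, 0 < B & forall x, `|f x| <= B.
Proof.
move=> [cf f0]; have [r hr] := f0 1 ltr01.
have [B [_ hB]] : bounded_set (f @` [set x : 'rV[R]_d | `|x| <= `|r| + 1]).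
  apply: compact_bounded; apply: continuous_compact; last exact: compact_norm_le.
  exact: continuous_subspaceT.
exists (`|B| + 1 + 1) => [|x]; first by rewrite ltr_wpDl.
have [h|h] := leP `|x| (`|r| + 1).
  apply: (hB (`|B| + 1 + 1)); last by exists x.
  by rewrite (le_lt_trans (ler_norm _))// -addrA ltrDl.
apply: le_trans (ltW (hr x _)) _; last by rewrite lerDr addr_ge0.
rewrite (lt_le_trans _ (norm_le_enorm x))// (le_lt_trans (ler_norm _))//.
by rewrite (lt_trans _ h)// ltrDl.
Qed.

Lemma C0_unif f (e : R) : C0 f -> 0 < e ->
  exists2 de : R, 0 < de & forall x y, `|x - y| <= de -> `|f x - f y| <= e.
Proof.
move=> [cf f0] e0; have e2 : 0 < e / 2 by rewrite divr_gt0.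
have [r hr] := f0 _ e2.
have far x : `|r| < `|x| -> `|f x| <= e / 2.
  move=> h; apply/ltW/hr; rewrite (lt_le_trans _ (norm_le_enorm x))//.
  exact: le_lt_trans (ler_norm _) h.
have [de de0 hde] := unif_continuous_compact cf (@compact_norm_le (`|r| + 1)) e0.
exists (Num.min de 1) => [|x y]; first by rewrite lt_min de0 ltr01.
rewrite le_min => /andP[xy1 xy2].
have [h|h] := leP `|x| (`|r| + 1); first exact: hde.
have hy : `|r| < `|y|.
  have := ler_distD 0 x y; have := lerB_dist x y; lra.
apply: le_trans (ler_normB _ _) _; rewrite (splitr e); apply: lerD; apply: far => //.
by rewrite (lt_trans _ h)// ltrDl.
Qed.

(** An affine modulus lets L^1 closeness of fields control integrals of a function that need not be
    Lipschitz. Where [|x - y| > de], the bound [2 B] is at most [2 B / de] times the distance. *)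
Lemma C0_dist f (e : R) : C0 f -> 0 < e ->
  exists2 C : R, 0 < C & forall x y, `|f x - f y| <= e + C * `|x - y|.
Proof.
move=> f0 e0; have [B B0 hB] := C0_bounded f0; have [de de0 hde] := C0_unif f0 e0.
exists (2 * B / de) => [|x y]; first by rewrite divr_gt0// mulr_gt0.
have [h|h] := leP `|x - y| de.
  by apply: le_trans (hde _ _ h) _; rewrite lerDl mulr_ge0// divr_ge0 ?mulr_ge0 ?ltW.
apply: le_trans (_ : 2 * B <= _).
  apply: le_trans (ler_normB _ _) _; rewrite mulr_natl mulr2n; exact: lerD.
apply: le_trans (_ : 2 * B / de * `|x - y| <= _); last by rewrite lerDr ltW.
by rewrite -mulrA ler_peMr ?mulr_ge0 ?(ltW B0)// mulrC ler_pdivlMr// mul1r ltW.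
Qed.

Definition cutoff (r : R) x : R := ramp (r + 1 - `|x|).

Lemma cutoff_01 r x : 0 <= cutoff r x <= 1.
Proof. exact: ramp_01. Qed.

Lemma cutoff_eq1 r x : `|x| <= r -> cutoff r x = 1.
Proof. by move=> h; apply: ramp_ge1; lra. Qed.

Lemma cutoff_eq0 r x : r + 1 <= `|x| -> cutoff r x = 0.
Proof. by move=> h; apply: ramp_le0; lra. Qed.

Lemma continuous_cutoff r : continuous (cutoff r).
Proof.
apply: (@lip_continuous _ _ 1) => x y; rewrite mul1r.
apply: le_trans (ramp_dist _ _) _; rewrite distrC.
rewrite (_ : _ - _ = `|x| - `|y|); last by ring.
exact: ler_dist_dist.
Qed.

Lemma C0_cutoff f r : continuous f -> C0 (fun x => f x * cutoff r x).
Proof.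
move=> cf; split; first by apply: continuous_mul => //; exact: continuous_cutoff.
move=> e e0; exists (d%:R * (`|r| + 1)) => x hx; rewrite cutoff_eq0 ?mulr0 ?normr0//.
have h := lt_le_trans hx (enorm_le x).
have d0 : 0 < d%:R :> R.
  rewrite lt_neqAle ler0n andbT eq_sym; apply/eqP => d0.
  by move: h; rewrite d0 !mul0r ltxx.
by move: h; rewrite ltr_pM2l// => h; have := ler_norm r; lra.
Qed.

End C0_functions.

(** * A partition of unity by tents *)

Section tents.
Context (R : realType) (d : nat).

(** The hat function [max 0 (1 - |t|)]; written as a difference of ramps, its integer translates
    telescope. *)
Definition tent1 (t : R) : R := ramp (t + 1) - ramp t.

Lemma tent1_01 t : 0 <= tent1 t <= 1.
Proof.
have /ramp_lip/andP[h1 _] : t <= t + 1 by rewrite lerDl.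
have /andP[_ h2] := ramp_01 (t + 1); have /andP[h3 _] := ramp_01 t.
by rewrite h1 /tent1; lra.
Qed.

Lemma tent1_lip t s : `|tent1 t - tent1 s| <= `|t - s|.
Proof.
wlog ts : t s / t <= s.
  move=> h; have [/h//|/ltW/h] := leP t s; by rewrite distrC [`|t - s|]distrC.
rewrite [leRHS]distrC [`|s - t|]ger0_norm ?subr_ge0// /tent1.
have /ramp_lip/andP[h1 h2] := ts.
have /ramp_lip/andP[h3 h4] : t + 1 <= s + 1 by rewrite lerD2r.
by rewrite ler_norml; apply/andP; split; lra.
Qed.

Lemma tent1_eq0 t : 1 <= `|t| -> tent1 t = 0.
Proof.
rewrite ler_normr /tent1 => /orP[h|h].
  by rewrite !ramp_ge1 ?subrr// (le_trans h)// lerDl.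
by rewrite !ramp_le0 ?subrr//; lra.
Qed.

Lemma sum_tent1 (s : R) n : \sum_(a < n.+1) tent1 (s - a%:R) = ramp (s + 1) - ramp (s - n%:R).
Proof.
elim: n => [|n ih]; first by rewrite big_ord1 /= /tent1 !subr0.
rewrite big_ord_recr/= ih /tent1 -natr1.
by rewrite (_ : s - (n%:R + 1) + 1 = s - n%:R); ring.
Qed.

Variables (m M : nat).

(** Ordinals start at 0, so the shift by [M] centres the grid: step [1/(m+1)], from [-M/(m+1)] to
    [M/(m+1)] along each axis. *)
Definition node (k : {ffun 'I_d -> 'I_(M.*2).+1}) : 'rV[R]_d :=
  \row_i (((k i : nat)%:R - M%:R) / m.+1%:R).

Definition tent (k : {ffun 'I_d -> 'I_(M.*2).+1}) (x : 'rV[R]_d) : R :=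
  \prod_i tent1 (m.+1%:R * x ord0 i + M%:R - (k i : nat)%:R).

Lemma prod_01 (I : Type) (s : seq I) (a : I -> R) : (forall i, 0 <= a i <= 1) ->
  0 <= \prod_(i <- s) a i <= 1.
Proof.
move=> a01; elim: s => [|i s /andP[h1 h2]]; first by rewrite big_nil lexx ler01.
rewrite big_cons; have /andP[h3 h4] := a01 i.
by rewrite mulr_ge0//= -[leRHS]mulr1 ler_pM.
Qed.

Lemma prod_dist (I : Type) (s : seq I) (a b : I -> R) : (forall i, 0 <= a i <= 1) ->
  (forall i, 0 <= b i <= 1) ->
  `|\prod_(i <- s) a i - \prod_(i <- s) b i| <= \sum_(i <- s) `|a i - b i|.
Proof.
move=> a01 b01; elim: s => [|i s ih]; first by rewrite !big_nil subrr normr0.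
rewrite !big_cons; set p := \prod_(j <- s) a j in ih *; set q := \prod_(j <- s) b j in ih *.
have /andP[q0 q1] : 0 <= q <= 1 by exact: prod_01.
have /andP[a0 a1] := a01 i.
rewrite (_ : a i * p - b i * q = a i * (p - q) + (a i - b i) * q); last by ring.
rewrite (le_trans (ler_normD _ _))// addrC !normrM (ger0_norm q0) (ger0_norm a0) lerD//.
  by rewrite ler_piMr.
by rewrite (le_trans _ ih)// ler_piMl.
Qed.

Lemma tent_01 k x : 0 <= tent k x <= 1.
Proof. by apply: prod_01 => i; exact: tent1_01. Qed.

Lemma tent_lip k : lip (d%:R * m.+1%:R) (tent k).
Proof.
move=> x y; apply: le_trans (prod_dist _ _ _) _; try by move=> i; exact: tent1_01.
apply: (@le_trans _ _ (\sum_(i < d) m.+1%:R * `|x - y|)).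
  apply: ler_sum => i _; apply: le_trans (tent1_lip _ _) _.
  rewrite (_ : _ - _ = m.+1%:R * (x ord0 i - y ord0 i)); last by ring.
  rewrite normrM ger0_norm// ler_wpM2l//.
  by have := coord_le_norm (x - y) i; rewrite !mxE.
by rewrite sumr_const card_ord -[leLHS]mulr_natl mulrA.
Qed.

Lemma tent_far k x : m.+1%:R^-1 < `|x - node k| -> tent k x = 0.
Proof.
move=> h; have /existsP[i hi] : [exists i, m.+1%:R^-1 < `|(x - node k) ord0 i|].
  apply: contraTT h; rewrite negb_exists => /forallP h; rewrite -leNgt norm_rV_le ?invr_ge0//.
  by apply/forallP => i; rewrite leNgt.
rewrite /tent (bigD1 i)//= tent1_eq0 ?mul0r//.
move: hi; rewrite !mxE => hi.
rewrite (_ : _ - _ = m.+1%:R * (x ord0 i - ((k i)%:R - M%:R) / m.+1%:R)); last first.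
  by field; rewrite addrC natr1 pnatr_eq0.
by rewrite normrM ger0_norm// -ler_pdivrMl// mulr1 ltW.
Qed.

Lemma sum_tent x : \sum_k tent k x =
  \prod_i (ramp (m.+1%:R * x ord0 i + M%:R + 1) - ramp (m.+1%:R * x ord0 i - M%:R)).
Proof.
rewrite -(bigA_distr_bigA (fun i (a : 'I_(M.*2).+1) =>
  tent1 (m.+1%:R * x ord0 i + M%:R - a%:R))).
apply: eq_bigr => i _; rewrite sum_tent1; congr (_ - ramp _).
by rewrite -addnn natrD; ring.
Qed.

Lemma sum_tent_01 x : 0 <= \sum_k tent k x <= 1.
Proof.
rewrite sum_tent; apply: prod_01 => i.
set t := m.+1%:R * x ord0 i; have M0 : 0 <= M%:R :> R by [].
have /ramp_lip/andP[h1 _] : t - M%:R <= t + M%:R + 1 by lra.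
have /andP[_ h2] := ramp_01 (t + M%:R + 1); have /andP[h3 _] := ramp_01 (t - M%:R).
by rewrite h1/=; lra.
Qed.

Lemma sum_tent_eq1 x : m.+1%:R * `|x| <= M%:R -> \sum_k tent k x = 1.
Proof.
move=> h; rewrite sum_tent big1// => i _.
have : `|m.+1%:R * x ord0 i| <= M%:R.
  by rewrite (le_trans _ h)// normrM ger0_norm// ler_wpM2l// coord_le_norm.
rewrite ler_norml => /andP[h1 h2]; set t := m.+1%:R * _ in h1 h2 *.
by rewrite ramp_ge1 ?ramp_le0 ?subr0//; lra.
Qed.

(** In the cube covered by the nodes the tents sum to one and only nearby nodes contribute. Outside,
    the crude bound [2 B] remains, which [excess] will pay for. *)
Lemma tent_approx (f : 'rV[R]_d -> R) (e B : R) x : 0 <= e ->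
  (forall y, `|f y| <= B) ->
  (forall y, `|x - y| <= m.+1%:R^-1 -> `|f x - f y| <= e) ->
  `|f x - \sum_k f (node k) * tent k x| <= if m.+1%:R * `|x| <= M%:R then e else 2 * B.
Proof.
move=> e0 fB fe; case: ifPn => h.
  rewrite -[f x in leLHS]mulr1 -(sum_tent_eq1 h) mulr_sumr -sumrB.
  apply: le_trans (ler_norm_sum _ _ _) _.
  rewrite -[leRHS]mulr1 -(sum_tent_eq1 h) mulr_sumr; apply: ler_sum => k _.
  have /andP[t0 _] := tent_01 k x.
  rewrite -mulrBl normrM (ger0_norm t0).
  have [hk|hk] := leP `|x - node k| m.+1%:R^-1; first by rewrite ler_wpM2r// fe.
  by rewrite tent_far// !mulr0.
apply: le_trans (ler_normB _ _) _; rewrite mulr_natl mulr2n; apply: lerD => //.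
apply: le_trans (ler_norm_sum _ _ _) _.
have B0 : 0 <= B := le_trans (normr_ge0 _) (fB 0).
apply: (@le_trans _ _ (\sum_k B * tent k x)).
  apply: ler_sum => k _; have /andP[t0 _] := tent_01 k x.
  by rewrite normrM (ger0_norm t0) ler_wpM2r.
by rewrite -mulr_sumr ler_piMr//; have /andP[] := sum_tent_01 x.
Qed.

End tents.

(** * Approximation of finitely many moments *)

Section young_approx.
Context (R : realType) (N d l : nat) (A : 'I_N -> 'M[R]_(d, l)).
Hypotheses (N0 : (0 < N)%N) (cr : constant_rank A).
Local Notation P := (torusP R N).

Lemma measurable_coord_lt (n : nat) (i : 'I_n) (t : R) :
  measurable [set y : 'rV[R]_n | y ord0 i < t].
Proof.
rewrite -[X in measurable X]setTI.
rewrite (_ : [set y | _] = (fun y : 'rV[R]_n => y ord0 i) @^-1` `]-oo, t[%classic).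
  by apply: measurable_coord => //; exact: measurable_itv.
by apply/seteqP; split=> y /=; rewrite in_itv.
Qed.

Lemma torusP_coord (n : nat) (t : R) : 0 <= t <= 1 ->
  \int[torusP R n.+1]_y \1_[set y : 'rV[R]_n.+1 | y ord0 ord0 < t] y = t.
Proof.
move=> /andP[t0 t1].
have mE := measurable_coord_lt (ord0 : 'I_n.+1) t.
have bE := @bmeas_indic _ _ R _ mE.
have [B hB] := bE.2.
rewrite /Rintegral (torusP_rec bE.1 hB).
under eq_integral => s _.
  under eq_integral => v _.
    rewrite (_ : \1_[set y : 'rV[R]_n.+1 | y ord0 ord0 < t] (rowcons (s, v)) =
      \1_(`]-oo, t[%classic) s :> R).
    over.
    rewrite !indicE; congr (nat_of_bool _)%:R; apply/idP/idP; rewrite !inE/= rowcons0 in_itv/=; exact: id.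
  rewrite integral_cst// [X in (_ * X)%E]probability_setT mule1.
  over.
rewrite integral_indic; [|exact: measurableT|exact: (measurable_itv `]-oo, t[)].
rewrite setIT -[t in RHS]/(fine t%:E); congr fine.
change (lebesgue_measure (`]-oo, t[%classic `&` `[0%R, 1%R[%classic) = t%:E).
rewrite (_ : _ `&` _ = `[0%R, t[%classic).
  rewrite lebesgue_measure_itv/= lte_fin; case: ltP => h; first by rewrite oppr0 adde0.
  by congr EFin; apply/eqP; rewrite eq_le t0 h.
apply/seteqP; split=> s /=; rewrite !in_itv/=.
  by move=> [-> /andP[->]].
by move=> /andP[-> st]; rewrite st (lt_le_trans st t1).
Qed.

(** A slab in the first coordinate has the prescribed mass. A positive dimension is used here: for
    [N = 0] the torus is a single atom and cannot be split. *)
Lemma exists_mass (t : R) : 0 <= t <= 1 -> exists ka : 'rV[R]_N -> bool,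
  [/\ forall b, measurable (ka @^-1` [set b]), pmass ka true = t & pmass ka false = 1 - t].
Proof.
case: N N0 => // n _ t01; pose ka (y : 'rV[R]_n.+1) := y ord0 ord0 < t.
have kT : ka @^-1` [set true] = [set y : 'rV[R]_n.+1 | y ord0 ord0 < t] by [].
have mk b : measurable (ka @^-1` [set b]).
  have mT : measurable (ka @^-1` [set true]) by rewrite kT; exact: measurable_coord_lt.
  case: b => //; rewrite (_ : _ @^-1` _ = ~` (ka @^-1` [set true])); first exact: measurableC.
  by apply/seteqP; split=> y /= => [->//|]; case: (ka y).
have pT : pmass ka true = t by rewrite /pmass kT torusP_coord.
exists ka; split => //.
have := Rintegral_fibers (fun=> 1) mk; rewrite Rintegral_prob_cst big_bool/= !mulr1 pT.
by move=> ->; rewrite addrC addrK.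
Qed.

(** [near_point_cone] applied to the set of moment vectors. [f ord0] may be unbounded above; [F] is
    bounded below, so that its envelope can be approximated, because the weight [c ord0 ord0] is
    nonnegative. *)
Lemma young_approx (n : nat) (f : 'I_n.+1 -> 'rV[R]_d -> R) (L e : R) x0 (z : 'rV[R]_n.+1) :
  (forall j, lip L (f j)) -> 0 <= L -> (forall j x, 0 <= f j x) ->
  (forall j x, j != ord0 -> f j x <= 1) ->
  (forall c : 'rV[R]_n.+1, 0 <= c ord0 ord0 ->
     Qenv A (fun x => \sum_j c ord0 j * f j x) x0 <= dot c z) ->
  0 < e ->
  exists2 phi, Atrig A phi & \int[P]_y f ord0 (x0 + phi y) <= z ord0 ord0 + e /\
    forall j, j != ord0 -> `|\int[P]_y f j (x0 + phi y) - z ord0 j| <= e.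
Proof.
move=> fL L0 f0 f1 hQ e0.
pose mom phi : 'rV[R]_n.+1 := \row_j \int[P]_y f j (x0 + phi y).
pose S : set 'rV[R]_n.+1 := [set s | exists2 phi, Atrig A phi & s = mom phi].
have [|||s [phi Aphi ->] [h1 h2]] := @near_point_cone _ _ S z e _ _ _ e0.
- by eexists; exists (fun=> 0); [exact: Atrig0|].
- move=> _ _ t de [phi Aphi ->] [psi Apsi ->] t0 t1 de0.
  have [|ka [mk kT kF]] := @exists_mass t; first by rewrite ltW.
  have A0 := Atrig0 A.
  have Ab b : Atrig A (if b then phi else psi) by case: b.
  have h0 (y : 'rV[R]_N) : `|0 - (fun=> 0) (ka y) : 'rV[R]_d| <= 0 by rewrite subrr normr0.
  (* Near convexity is lamination of the field 0, cut into two pieces of masses [t] and [1 - t];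
     freezing it costs nothing. *)
  have [w Aw hw] := laminate cr (p := fun=> 0) x0 fL L0 A0 Ab mk h0 de0.
  exists (mom w); first by exists w.
  rewrite norm_rV_le ?(ltW de0)//; apply/forallP => j; rewrite !mxE.
  by have := hw j; rewrite big_bool/= kT kF mulr0 add0r !addr0.
- move=> c de c0 de0; pose F x := \sum_j c ord0 j * f j x.
  have FL : lip (\sum_j `|c ord0 j| * L) F.
    move=> x y; rewrite -sumrB (le_trans (ler_norm_sum _ _ _))// mulr_suml.
    apply: ler_sum => j _; rewrite -mulrBr normrM -mulrA ler_wpM2l//; exact: fL.
  have Fc x : - \sum_j `|c ord0 j| <= F x.
    rewrite -sumrN; apply: ler_sum => j _; have [->|j0] := eqVneq j ord0.
      by rewrite (@le_trans _ _ 0) ?oppr_le0// mulr_ge0.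
    have := f1 j x j0; have := f0 j x; have := ler_norm (- c ord0 j); rewrite normrN.
    have := normr_ge0 (c ord0 j).
    by move=> a1 a2 a3 a4; nra.
  have [phi Aphi hphi] := Qenv_approx A FL Fc x0 de0.
  exists (mom phi); first by exists phi.
  apply: le_trans (_ : \int[P]_y F (x0 + phi y) <= _); last first.
    by rewrite (le_trans hphi)// lerD2r hQ.
  have bf j : bmeas (fun y => f j (x0 + phi y)).
    exact: bmeas_lip_comp (fL j) (vbmeas_vtrig (Atrig_vtrig Aphi)).
  rewrite /F bRint_sum; last by move=> j; apply: bmeasM => //; exact: bmeas_cst.
  by apply: ler_sum => j _; rewrite bRintZ// mxE.
exists phi => //; split; first by move: h1; rewrite mxE.
by move=> j j0; move: (h2 j j0); rewrite mxE.
Qed.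

End young_approx.

(** * Nonnegative charges *)

Section positive_charge.
Context (R : realType) (d : nat).
Implicit Types nu : {charge set 'rV[R]_d -> \bar R}.

Lemma measurable_norm_le (r : R) : measurable [set x : 'rV[R]_d | `|x| <= r].
Proof.
rewrite -[X in measurable X]setTI.
rewrite (_ : [set x | _] = Num.norm @^-1` `]-oo, r]%classic); last first.
  by apply/seteqP; split=> y /=; rewrite in_itv.
have /(_ measurableT) := continuous_rV_measurable (@norm_continuous R 'rV[R]_d).
by apply; exact: measurable_itv.
Qed.

(** The negative Jordan part vanishes, as measurable subsets of the negative Hahn set have mass both
    nonnegative and nonpositive. *)
Lemma charge_finite_measure nu : (forall B, measurable B -> (0 <= nu B)%E) ->
  exists mu : {finite_measure set 'rV[R]_d -> \bar R},
    (forall B, measurable B -> mu B = nu B) /\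
    forall f, pairing nu f = (\int[mu]_x (f x)%:E)%E.
Proof.
move=> nu0; rewrite /pairing; cbv zeta.
pose nuPN := projT2 (cid (projT2 (cid (Hahn_decomposition nu)))).
have negE B : measurable B -> jordan_neg nuPN B = 0%E.
  move=> mB; rewrite jordan_negE cjordan_negE /crestr0 mem_set// /crestr.
  have [_ [mN negN] _ _] := nuPN.
  apply/eqP; rewrite oppe_eq0 eq_le nu0 ?andbT; last exact: measurableI.
  by rewrite negN//; exact: measurableI.
have int0 (f : 'rV[R]_d -> R) : (\int[jordan_neg nuPN]_x (f x)%:E = 0)%E.
  rewrite (eq_measure_integral (@mzero _ _ R)); first exact: integral_measure_zero.
  by move=> B mB _; exact: negE.
exists (jordan_pos nuPN); split=> [B mB|f]; last by rewrite int0 sube0.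
transitivity (jordan_pos nuPN B - jordan_neg nuPN B)%E; first by rewrite negE// sube0.
by rewrite (jordan_decomp nuPN mB) /cadd/= /cscale/= mulN1e.
Qed.

Lemma charge_probability nu : (forall B, measurable B -> (0 <= nu B)%E) ->
  nu setT = 1%E ->
  exists mu : probability 'rV[R]_d R, (forall B, measurable B -> mu B = nu B) /\
    forall f, pairing nu f = (\int[mu]_x (f x)%:E)%E.
Proof.
move=> nu0 nu1; have [m [mE pairE]] := charge_finite_measure nu0.
have m1 : m setT = 1%E by rewrite mE.
pose mu : probability 'rV[R]_d R := HB.pack (Measure.sort m) (Measure.class m)
    (Measure_isProbability.Build _ _ _ (Measure.sort m) m1).
by exists mu.
Qed.

Lemma spt_null nu (mu : probability 'rV[R]_d R) (r : R) :
  (forall B, measurable B -> mu B = nu B) -> spt nu `<=` [set x | `|x| <= r] ->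
  mu (~` [set x | `|x| <= r]) = 0%E.
Proof.
move=> muE nur.
have mr := measurableC (measurable_norm_le r).
(* The complement of the support is a union of possibly uncountably many null open sets; it is
   covered by those rational balls that are themselves null, which are countably many. *)
pose b (q : 'rV[rat]_d * nat) : set 'rV[R]_d :=
  @ball R 'rV[R]_d (map_mx ratr q.1) q.2.+1%:R^-1.
pose F k := if unpickle k is Some q then if `[< null_on nu (b q) >] then b q else set0 else set0.
suff : mu.-negligible (~` [set x | `|x| <= r]) by move/(measure_negligible mr).
apply: (@negligibleS _ _ _ mu (\bigcup_k F k)); last first.
  apply: negligible_bigcup => k; rewrite /F; case: unpickle => [q|]; last exact: negligible_set0.
  case: asboolP => [h|_]; last exact: negligible_set0.
  have mq : measurable (b q) by apply: open_rV_measurable; exact: ball_open.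
  by exists (b q); split => //; apply: etrans (muE _ mq) _; exact: h.
move=> x /= hx.
have : ~ spt nu x by move=> /nur.
rewrite /spt /= => /contrapT[U [oU nU] Ux].
have /nbhs_ballP[e /= e0 he] : nbhs x U by exact: open_nbhs_nbhs.
have e2 : 0 < e / 2 by rewrite divr_gt0.
have /(@cvgrPdist_lt R R^o)/(_ _ e2)/filter_ex[n] := @cvg_harmonic R.
rewrite sub0r normrN /= ger0_norm ?invr_ge0// => hn.
have n0 : 0 < n.+1%:R^-1 :> R by rewrite invr_gt0.
have hq i : exists q : rat, `|x ord0 i - ratr q| < n.+1%:R^-1.
  have /rat_in_itvoo[q] : x ord0 i - n.+1%:R^-1 < x ord0 i + n.+1%:R^-1.
    by rewrite ltrD2l (lt_trans _ n0)// oppr_lt0.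
  rewrite in_itv/= => /andP[h1 h2]; exists q.
  by rewrite ltr_norml ltrBrDl ltrBlDr; apply/andP; split; move: h1 h2; rewrite ltrBlDr ?ltrBlDr// addrC.
pose q : 'rV[rat]_d := \row_i sval (cid (hq i)).
have xq : `|x - map_mx ratr q| < n.+1%:R^-1.
  rewrite norm_rV_lt//; apply/forallP => i; rewrite !mxE; exact: (svalP (cid (hq i))).
have bU : b (q, n) `<=` U.
  move=> y; rewrite /b -ball_normE/= => hy; apply: he; rewrite -ball_normE/=.
  rewrite (le_lt_trans (ler_distD (map_mx ratr q) _ _))// (splitr e).
  by apply: ltrD; [exact: lt_trans xq hn|exact: lt_trans hy hn].
exists (pickle (q, n)) => //; rewrite /F pickleK; case: asboolP => [_|[]].
  by rewrite /b -ball_normE/= distrC.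
by move=> B mB Bb; apply: nU => //; exact: subset_trans Bb bU.
Qed.

Lemma integral_cutoff (mu : probability 'rV[R]_d R) (r : R) (f : 'rV[R]_d -> R) :
  mu (~` [set x | `|x| <= r]) = 0%E -> continuous f ->
  (\int[mu]_x (f x)%:E)%E = (\int[mu]_x (f x * cutoff r x))%:E.
Proof.
move=> mur cf; have cfr := C0_cutoff r cf.
have mf := continuous_rV_measurable cf.
have mfr := continuous_rV_measurable (C0_continuous cfr).
rewrite -bRint_EFin; last first.
  by split=> //; have [B _ hB] := C0_bounded cfr; exists B.
apply: ae_eq_integral => //; try by apply/measurable_EFinP.
have mr := measurableC (measurable_norm_le r).
exists (~` [set x : 'rV[R]_d | `|x| <= r]); split => // x /=.
by apply: contra_not => h _; rewrite cutoff_eq1// mulr1.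
Qed.

End positive_charge.

(** * Approximation of all moments *)

Section moments.
Context (R : realType) (N d l : nat) (A : 'I_N -> 'M[R]_(d, l)).
Hypotheses (N0 : (0 < N)%N) (cr : constant_rank A).
Variables (mu : probability 'rV[R]_d R) (rho : R) (x0 : 'rV[R]_d).
Hypotheses (rho0 : 0 <= rho) (mu0 : mu (~` [set x | `|x| <= rho]) = 0%E).
Hypothesis mu_qc : forall f : 'rV[R]_d -> R, continuous f -> Aquasiconvex A f ->
  ((f x0)%:E <= \int[mu]_x (f x)%:E)%E.
Local Notation P := (torusP R N).

(** Vanishes wherever [cutoff rho] does not, so its moment against [mu] is 0; far away it is at
    least [|x| / 2], so a small average leaves little mass at large values. It is also nonnegative
    and Lipschitz, as the envelope requires. *)
Definition excess (x : 'rV[R]_d) : R := Num.max 0 (`|x| - (rho + 1)).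

Lemma excess_ge0 x : 0 <= excess x.
Proof. by rewrite le_max lexx. Qed.

Lemma excess_lip : lip 1 excess.
Proof.
move=> x y; rewrite mul1r /excess; apply: le_trans (ler_dist_dist x y).
move: `|x| `|y| => a b; have k1 := ler_norm (a - b); have k2 := ler_norm (b - a).
rewrite distrC in k2; rewrite ler_norml.
by case: (leP 0 (a - _)); case: (leP 0 (b - _)) => h1 h2; apply/andP; split; lra.
Qed.

Lemma excess_cutoff x : excess x * cutoff rho x = 0.
Proof.
rewrite /excess maxEle; case: ifP => h; last by rewrite mul0r.
by rewrite cutoff_eq0 ?mulr0//; lra.
Qed.

Lemma excess_ge x : 2 * (rho + 1) <= `|x| -> `|x| <= 2 * excess x.
Proof.
rewrite /excess; move: `|x| rho0 => a r0 h.
by case: (leP 0 (a - (rho + 1))) => h'; lra.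
Qed.

Lemma bmeas_cutoff (f : 'rV[R]_d -> R) (r : R) : continuous f ->
  bmeas (fun x => f x * cutoff r x).
Proof.
move=> cf; have cfr := C0_cutoff r cf; split.
  exact: continuous_rV_measurable (C0_continuous cfr).
by have [B _ hB] := C0_bounded cfr; exists B.
Qed.

(** Jensen for the quasiconvex function [Qenv A f], followed by [Qenv A f <= f]. The cutoff changes
    no integral, [mu] being carried by the ball, and makes the integrands bounded. *)
Lemma mu_Qenv (f : 'rV[R]_d -> R) (L c : R) : lip L f -> 0 <= L -> (forall x, c <= f x) ->
  Qenv A f x0 <= \int[mu]_x (f x * cutoff rho x).
Proof.
move=> fL L0 fc; have QL := Qenv_lip A fL L0 fc.
have cQ := lip_continuous QL; have cf := lip_continuous fL.
have := mu_qc cQ (Qenv_quasiconvex cr fL L0 fc).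
rewrite (integral_cutoff mu0 cQ) lee_fin => /le_trans; apply.
apply: bRint_le; [exact: bmeas_cutoff|exact: bmeas_cutoff|move=> x].
by rewrite ler_wpM2r ?(Qenv_le_id A fL fc)//; have /andP[] := cutoff_01 rho x.
Qed.

(** The field [phi] is fixed before [f]: the moments of all tents of mesh [1/(n+1)], together with
    that of [excess], control every bounded [f] through its modulus of continuity at that scale. *)
Lemma young_seq (n : nat) : exists2 phi, Atrig A phi &
  \int[P]_y excess (x0 + phi y) <= n.+1%:R^-1 /\
  forall (f : 'rV[R]_d -> R) (e B : R), continuous f -> 0 <= e ->
    (forall x, `|f x| <= B) ->
    (forall x y, `|x - y| <= n.+1%:R^-1 -> `|f x - f y| <= e) ->
    `|\int[P]_y f (x0 + phi y) - \int[mu]_x (f x * cutoff rho x)| <=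
    2 * e + 3 * B / n.+1%:R.
Proof.
(* The nodes cover the cube of radius [2 (rho + 1)]. Beyond it [excess] is at least 1, so
   [2 * B * excess] dominates the crude error of [tent_approx]. *)
pose M := (Num.truncn (n.+1%:R * (2 * (rho + 1)))).+1.
have hM : n.+1%:R * (2 * (rho + 1)) <= M%:R by apply/ltW/truncnS_gt.
pose I : finType := {ffun 'I_d -> 'I_(M.*2).+1}; pose p := #|I|.
pose T (k : I) : 'rV[R]_d -> R := tent n k.
pose g (j : 'I_p.+1) : 'rV[R]_d -> R :=
  if unlift ord0 j is Some i then T (enum_val i) else excess.
have g0 : g ord0 = excess by rewrite /g unlift_none.
have gT k : g (lift ord0 (enum_rank k)) = T k by rewrite /g liftK enum_rankK.
pose L : R := d%:R * n.+1%:R + 1.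
have L0 : 0 <= L by rewrite addr_ge0 ?mulr_ge0.
have gL j : lip L (g j).
  move=> x y; rewrite /g; case: unlift => [i|].
    apply: le_trans (@tent_lip R d n M (enum_val i) x y) _; by rewrite ler_wpM2r// lerDl.
  by apply: le_trans (excess_lip _ _) _; rewrite ler_wpM2r// lerDr mulr_ge0.
have gge0 j x : 0 <= g j x.
  rewrite /g; case: unlift => [i|]; last exact: excess_ge0.
  by have /andP[] := tent_01 n (enum_val i) x.
have gle1 j x : j != ord0 -> g j x <= 1.
  rewrite /g; case: unliftP => [i _ _|-> /eqP//].
  by have /andP[] := tent_01 n (enum_val i) x.
have bgc j : bmeas (fun x => g j x * cutoff rho x).
  by apply: bmeas_cutoff; exact: lip_continuous (gL j).
pose z : 'rV[R]_p.+1 := \row_j \int[mu]_x (g j x * cutoff rho x).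
(* There are [p] tents, so their errors together stay below [1/(n+1)]. *)
pose ep : R := n.+1%:R^-1 / p.+1%:R.
have ep0 : 0 < ep by rewrite divr_gt0 ?invr_gt0.
have hQ (c : 'rV[R]_p.+1) : 0 <= c ord0 ord0 ->
    Qenv A (fun x => \sum_j c ord0 j * g j x) x0 <= dot c z.
  move=> c0.
  apply: (le_trans (@mu_Qenv _ (\sum_j `|c ord0 j| * L) (- \sum_j `|c ord0 j|) _ _ _)).
  - move=> x y; rewrite -sumrB (le_trans (ler_norm_sum _ _ _))// mulr_suml.
    apply: ler_sum => j _; rewrite -mulrBr normrM -mulrA ler_wpM2l//; exact: gL.
  - by apply: sumr_ge0 => j _; rewrite mulr_ge0.
  - move=> x; rewrite -sumrN; apply: ler_sum => j _; have [->|j0] := eqVneq j ord0.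
      by rewrite (@le_trans _ _ 0) ?oppr_le0// mulr_ge0.
    have := gle1 j x j0; have := gge0 j x; have := ler_norm (- c ord0 j); rewrite normrN.
    have := normr_ge0 (c ord0 j).
    by move=> a1 a2 a3 a4; nra.
  under eq_Rintegral do (rewrite mulr_suml; under eq_bigr do rewrite -mulrA).
  rewrite bRint_sum; last by move=> j; apply: bmeasM => //; exact: bmeas_cst.
  by apply: ler_sum => j _; rewrite bRintZ// mxE.
have [phi Aphi [h1 h2]] := young_approx N0 cr gL L0 gge0 gle1 hQ ep0.
have bphi := vbmeas_vtrig (Atrig_vtrig Aphi).
have epn : ep <= n.+1%:R^-1.
  by rewrite /ep ler_pdivrMr// ler_peMr// ler1n.
have ex : \int[P]_y excess (x0 + phi y) <= n.+1%:R^-1.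
  move: h1; rewrite g0 mxE g0; under [X in _ <= X + _]eq_Rintegral do rewrite excess_cutoff.
  by rewrite Rintegral_prob_cst add0r => /le_trans; apply.
exists phi => //; split=> // f e B cf e0 fB fe.
have B0 : 0 <= B := le_trans (normr_ge0 _) (fB 0).
have bexc : bmeas (fun y => excess (x0 + phi y)) by exact: bmeas_lip_comp excess_lip bphi.
pose Tf x := \sum_k f (node R n k) * T k x.
have hTf x : `|f x - Tf x| <= e + 2 * B * excess x.
  apply: le_trans (tent_approx M e0 fB (fe x)) _; case: ifPn => h.
    by rewrite lerDl mulr_ge0 ?excess_ge0// mulr_ge0.
  have hx : 2 * (rho + 1) <= `|x|.
    rewrite -(@ler_pM2l _ n.+1%:R)//; apply: (le_trans hM).
    by rewrite leNgt; apply: contra h => /ltW.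
  have := excess_ge hx => h'.
  rewrite (le_trans (_ : 2 * B <= 2 * B * excess x))// ?lerDr//.
  rewrite ler_peMr ?mulr_ge0//; move: (excess x) h' (le_trans hx h') rho0 => t _.
  by rewrite ler_pM2l// => h1t r0; apply: le_trans h1t; rewrite lerDr.
have bTphi k : bmeas (fun y => T k (x0 + phi y)).
  by rewrite -gT; exact: bmeas_lip_comp (gL _) bphi.
have bTf : bmeas (fun y => Tf (x0 + phi y)).
  by apply: bmeas_sum => k; apply: bmeasM => //; exact: bmeas_cst.
have bf : bmeas (fun y => f (x0 + phi y)).
  by apply: (vbmeas_comp (u := fun y => x0 + phi y)) => //; apply: vbmeasD => //; exact: vbmeas_cst.
have e1 : `|\int[P]_y f (x0 + phi y) - \int[P]_y Tf (x0 + phi y)| <= e + 2 * B / n.+1%:R.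
  apply: le_trans (bRint_dist _ bf bTf) _.
  have bs : bmeas (fun y => 2 * B * excess (x0 + phi y)).
    by apply: bmeasM => //; exact: bmeas_cst.
  apply: (@le_trans _ _ (\int[P]_y (e + 2 * B * excess (x0 + phi y)))).
    apply: bRint_le => //; first by apply: bmeas_norm; exact: bmeasB.
    by apply: bmeasD => //; exact: bmeas_cst.
  rewrite bRintD//; last exact: bmeas_cst.
  by rewrite Rintegral_prob_cst bRintZ// lerD2l ler_wpM2l// mulr_ge0.
have e2 : `|\int[P]_y Tf (x0 + phi y) - \sum_k f (node R n k) * z ord0 (lift ord0 (enum_rank k))|
    <= B / n.+1%:R.
  rewrite bRint_sum; last by move=> k; apply: bmeasM => //; exact: bmeas_cst.
  rewrite -sumrB; apply: le_trans (ler_norm_sum _ _ _) _.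
  apply: (@le_trans _ _ (\sum_(k : I) B * ep)).
    apply: ler_sum => k _; rewrite bRintZ// -mulrBr normrM ler_pM// -gT.
    by apply: h2; rewrite eq_sym neq_lift.
  rewrite sumr_const -/p -[leLHS]mulr_natr -mulrA ler_wpM2l// /ep -mulrA ler_piMr ?invr_ge0//.
  by rewrite mulrC ler_pdivrMr// mul1r ler_nat.
have bTc : bmeas (fun x => Tf x * cutoff rho x).
  have : bmeas (fun x => \sum_k f (node R n k) * (T k x * cutoff rho x)).
    apply: bmeas_sum => k; apply: bmeasM; first exact: bmeas_cst.
    by rewrite -gT.
  by under eq_fun do (under eq_bigr do rewrite mulrA; rewrite -mulr_suml).
(* Where the cutoff is nonzero the excess vanishes, so the modulus [e] is the whole error. *)
have e3 : `|\sum_k f (node R n k) * z ord0 (lift ord0 (enum_rank k)) -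
    \int[mu]_x (f x * cutoff rho x)| <= e.
  rewrite (_ : \sum_k _ = \int[mu]_x (Tf x * cutoff rho x)).
    have bfc := bmeas_cutoff rho cf.
    apply: le_trans (bRint_dist _ bTc bfc) _; apply: bRint_le_cst.
      by apply: bmeas_norm; exact: bmeasB.
    move=> x; have /andP[c0 c1] := cutoff_01 rho x.
    rewrite -mulrBl normrM (ger0_norm c0) distrC.
    apply: (@le_trans _ _ ((e + 2 * B * excess x) * cutoff rho x)); first by rewrite ler_wpM2r.
    by rewrite mulrDl -mulrA excess_cutoff mulr0 addr0 ler_piMr.
  rewrite /Tf; under eq_Rintegral do (rewrite mulr_suml; under eq_bigr do rewrite -mulrA).
  rewrite bRint_sum; last first.
    by move=> k; apply: bmeasM; [exact: bmeas_cst|rewrite -gT].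
  by apply: eq_bigr => k _; rewrite bRintZ ?mxE ?gT// -gT.
apply: le_trans (ler_distD _ _ _) (le_trans (lerD e1 (le_trans (ler_distD _ _ _) (lerD e2 e3))) _).
by rewrite -!mulrA; move: (B / _) => t; lra.
Qed.

End moments.

(** * Integrable functions on the torus *)

Section torus_functions.
Context (R : realType) (N : nat).
Local Notation P := (torusP R N).
Local Notation cell := (@cell R N).

Lemma tint_ext (f g : 'rV[R]_N -> R) : (forall x, cell x -> f x = g x) -> tint f = tint g.
Proof.
move=> fg; rewrite /tint /integral.
suff -> : (fun x => (f x)%:E) \_ cell = (fun x => (g x)%:E) \_ cell by [].
by apply/funext => x; rewrite !patchE; case: ifPn => //; rewrite inE => /fg ->.
Qed.

Lemma tint_cond (b : pred 'rV[R]_N) (f : 'rV[R]_N -> R) :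
  (\int[@lebR R N]_(x in cell `&` [set x | b x]) (f x)%:E)%E =
  tint (fun x => if b x then f x else 0).
Proof.
rewrite /tint /integral.
suff -> : (fun x => (f x)%:E) \_ (cell `&` [set x | b x]) =
  (fun x => (if b x then f x else 0)%:E) \_ cell by [].
apply/funext => x; rewrite !patchE in_setI; case: (x \in cell) => //=.
have -> : (x \in [set x | b x]) = b x by apply/idP/idP; rewrite inE.
by case: (b x).
Qed.

(** The two set functions agree on the part of [E] within the cell; [lebR_le] shows that this part
    is null. *)
Lemma torusP_ae (Q : set 'rV[R]_N) :
  almost_everywhere (@lebR R N) (fun x => cell x -> Q x) ->
  exists E, [/\ measurable E, P E = 0%E & forall x, cell x -> ~ E x -> Q x].
Proof.
move=> [E [mE E0 hE]]; exists E; split => //; last first.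
  by move=> x cx; apply: contra_notP => nQ; apply: hE => /= /(_ cx).
apply/eqP; rewrite eq_le measure_ge0 andbT -(lebR_cell mE) -E0.
exact: lebR_le.
Qed.

Lemma continuous_enorm (d : nat) : continuous (@enorm R d).
Proof.
move=> x; apply: (@continuous_comp 'rV[R]_d R^o R^o (fun x => \sum_i x ord0 i ^+ 2) Num.sqrt).
  apply: (@continuous_big R^o 'I_d +%R 0 xpredT _ 'rV[R]_d (index_enum _)
    (fun i x => x ord0 i ^+ 2)) => [|i _]; first exact: add_continuous.
  by apply: continuous_mul; exact: coord_continuous.
exact: sqrt_continuous.
Qed.

Lemma vbmeas_L1 (d : nat) (u : 'rV[R]_N -> 'rV[R]_d) : vbmeas u -> L1 u.
Proof.
move=> bu; have mc := @measurable_cell R N.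
split; first by apply: measurable_funS (vbmeas_meas bu).
have be := vbmeas_comp bu (@continuous_enorm d).
apply/(integrable_restr mc (@lebR_cell R N)); split.
  by apply: (measurable_funS measurableT) => //; apply/measurable_EFinP; exact: be.1.
apply/(integrable_mkcond _ mc); apply: (integrableS measurableT) => //.
exact: bmeas_integrable be.
Qed.

(** [G] is merely integrable, so it is replaced by a bounded trigonometric polynomial; the uniform
    bound on [a n] pays for the replacement, and L^1 convergence handles the rest. *)
Lemma weak_null (a : nat -> 'rV[R]_N -> R) (B : R) (G : 'rV[R]_N -> R) :
  (forall n, measurable_fun setT (a n)) -> (forall n x, `|a n x| <= B) ->
  P.-integrable setT (EFin \o G) ->
  (\int[P]_x `|a n x|) @[n --> \oo] --> 0 ->
  (\int[P]_x (a n x * G x)) @[n --> \oo] --> 0.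
Proof.
move=> ma aB iG a0; have B0 : 0 <= B := le_trans (normr_ge0 _) (aB 0 0).
apply/cvgrPdist_le => e e0.
have B1 : 0 < B + 1 by rewrite ltr_wpDl.
have e1 : 0 < e / 2 / (B + 1) by rewrite !divr_gt0.
have [p tp hp] := trig_dense (torusP_cell R N) iG e1.
have [_ [C0 pC0]] := bmeas_trig tp.
pose C := `|C0| + 1; have C1 : 0 < C by rewrite ltr_wpDl.
have pC x : `|p x| <= C by rewrite (le_trans (pC0 x))// (le_trans (ler_norm _))// lerDl.
have ip := bmeas_integrable P (bmeas_trig tp).
have e2 : 0 < e / 2 / C by rewrite !divr_gt0.
move/cvgrPdist_le : a0 => /(_ _ e2); apply: filterS => n.
have ba : bmeas (fun x => `|a n x|) by apply: bmeas_norm; split => //; exists B.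
rewrite sub0r normrN ger0_norm; last exact: Rintegral_ge0.
move=> hn; rewrite sub0r normrN.
have mG : measurable_fun setT G by apply/measurable_EFinP; exact: measurable_int iG.
have iGp : P.-integrable setT (EFin \o (fun x => `|G x - p x|)).
  have iB : P.-integrable setT (EFin \o (fun x => G x - p x)) by exact: (integrableB measurableT iG ip).
  exact: (integrable_norm iB).
have iaG : P.-integrable setT (EFin \o (fun x => a n x * G x)).
  have : P.-integrable setT (EFin \o (fun x => B * G x)) by exact: (integrableZl measurableT B iG).
  apply: le_integrable => //; first by apply/measurable_EFinP; exact: measurable_funM.
  by move=> x _ /=; rewrite lee_fin !normrM (ger0_norm B0) ler_wpM2r.
apply: le_trans (le_normr_Rintegral measurableT iaG) _.
have iCa : P.-integrable setT (EFin \o (fun x => C * `|a n x|)).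
  by apply: bmeas_integrable; apply: bmeasM => //; exact: bmeas_cst.
have iBG : P.-integrable setT (EFin \o (fun x => B * `|G x - p x|)).
  exact: (integrableZl measurableT B iGp).
apply: (@le_trans _ _ (\int[P]_x (C * `|a n x| + B * `|G x - p x|))).
  apply: le_Rintegral => //.
  - exact: (integrable_norm iaG).
  - exact: (integrableD measurableT iCa iBG).
  move=> x _; rewrite normrM -{1}(subrK (p x) (G x)).
  apply: (@le_trans _ _ (`|a n x| * (`|G x - p x| + C))).
    by rewrite ler_wpM2l// (le_trans (ler_normD _ _))// lerD2l.
  by rewrite mulrDr addrC mulrC lerD2l ler_wpM2r.
rewrite RintegralD// (bRintZ _ C ba) (RintegralZl B measurableT iGp).
move: hp; rewrite (EFin_Rintegral iGp) lee_fin => hp.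
rewrite (splitr e); apply: lerD.
  by rewrite -(divfK (lt0r_neq0 C1) (e / 2)) mulrC ler_wpM2r// ltW.
apply: (@le_trans _ _ ((B + 1) * \int[P]_x `|G x - p x|)).
  by rewrite ler_wpM2r ?Rintegral_ge0// lerDl.
by rewrite -[leRHS](divfK (lt0r_neq0 B1) (e / 2)) mulrC ler_wpM2r// ltW.
Qed.

(** The function and its dilation factor change together. This is possible because the threshold in
    [oscillation] is uniform over functions with a common bound. *)
Lemma oscillation_limit (F : nat -> 'rV[R]_N -> R) (B c : R) (G : 'rV[R]_N -> R) :
  (forall n, measurable_fun setT (F n)) -> (forall n x, `|F n x| <= B) ->
  (forall n, Defs.periodic (F n)) -> P.-integrable setT (EFin \o G) ->
  (\int[P]_x F n x) @[n --> \oo] --> c ->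
  (\int[P]_x (F n (n.+1%:R *: x) * G x)) @[n --> \oo] --> c * \int[P]_x G x.
Proof.
move=> mF FB pF iG Fc; have B0 : 0 <= B := le_trans (normr_ge0 _) (FB 0 0).
have h0 : (\int[P]_x (F n (n.+1%:R *: x) * G x) - \int[P]_x F n x * \int[P]_x G x)
    @[n --> \oo] --> 0.
  apply/cvgrPdist_le => e e0; have B1 : 0 < B + 1 by rewrite ltr_wpDl.
  have e1 : 0 < e / (B + 1) by rewrite divr_gt0.
  have [m _ hm] := oscillation iG e1.
  exists m => // n /= mn; rewrite sub0r normrN.
  apply: le_trans (hm n.+1 (leqW mn) (F n) B (mF n) (FB n) (pF n)) _.
  apply: (@le_trans _ _ ((B + 1) * (e / (B + 1)))); first by rewrite ler_wpM2r ?ltW// ltrDl.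
  by rewrite mulrC divfK// gt_eqF.
have h1 : (\int[P]_x F n x * \int[P]_x G x) @[n --> \oo] --> c * \int[P]_x G x.
  by apply: cvgMr_tmp.
have h n : \int[P]_x (F n (n.+1%:R *: x) * G x) =
    (\int[P]_x (F n (n.+1%:R *: x) * G x) - \int[P]_x F n x * \int[P]_x G x) +
    \int[P]_x F n x * \int[P]_x G x by rewrite subrK.
rewrite -[X in _ --> X]add0r; under eq_cvg do rewrite h; exact: cvgD.
Qed.

End torus_functions.

(** * From quasiconvex measures to Young measures *)

Section quasiconvex_measures.
Context (R : realType) (N d l : nat) (A : 'I_N -> 'M[R]_(d, l)).
Local Notation P := (torusP R N).
Local Notation cell := (@cell R N).

Lemma Atrig_cst_smooth_torus (x0 : 'rV[R]_d) w : Atrig A w ->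
  smooth_torus (fun x => x0 + w x).
Proof.
move=> Aw; apply: vtrig_smooth_torus; apply: vtrigD; first exact: vtrig_cst.
exact: Atrig_vtrig Aw.
Qed.

Lemma kerA_Atrig_cst (x0 : 'rV[R]_d) w : Atrig A w -> kerA A (fun x => x0 + w x).
Proof.
move=> Aw; apply: kerA_smooth => [|y]; first exact: Atrig_cst_smooth_torus.
rewrite -[RHS](Atrig_free y Aw); apply: eq_bigr => k _; congr (_ *m _).
rewrite (_ : (fun x => x0 + w x) = cst x0 + w); last by apply/funext.
rewrite deriveD ?derive_cst ?add0r//.
apply: diff_derivable; exact: ((vtrig_smooth_torus (Atrig_vtrig Aw)).1 [::]).
Qed.

Lemma pairing_cst (nu : {charge set 'rV[R]_d -> \bar R}) (c : R) :
  pairing nu (fun=> c) = (c%:E * nu setT)%E.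
Proof.
rewrite /pairing; cbv zeta.
pose nuPN := projT2 (cid (projT2 (cid (Hahn_decomposition nu)))).
rewrite !integral_cst// -muleBr//; last first.
  by rewrite fin_num_adde_defl// fin_numN fin_num_measure.
congr (_ * _)%E; rewrite (jordan_decomp nuPN measurableT) /cadd/= /cscale/=.
by rewrite mulN1e.
Qed.

Lemma Aquasiconvex_cst (c : R) : Aquasiconvex A (fun=> c).
Proof.
by move=> x phi _ _ _; rewrite tint_bmeas ?Rintegral_prob_cst//; exact: bmeas_cst.
Qed.

Lemma M_Aqc_sub_H_A (K : set 'rV[R]_d) : (0 < N)%N -> constant_rank A -> propZL A ->
  compact K -> M_Aqc A K `<=` H_A A K.
Proof.
move=> N0 cr [C ZL] cK nu [nu0 [sptK nuqc]]; split => //.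
(* The constants 1 and -1 are both quasiconvex, so the mass is at least and at most 1. *)
have nu1 : nu setT = 1%E.
  have cc (c : R) : continuous (fun _ : 'rV[R]_d => c) by exact: cst_continuous.
  have := nuqc _ (cc 1) (Aquasiconvex_cst 1).
  have := nuqc _ (cc (-1)) (Aquasiconvex_cst (-1)).
  rewrite !pairing_cst mul1e mulN1e EFinN leeN2 => h1 h2.
  by apply: le_anti; apply/andP; split; [exact: h1|exact: h2].
have [mu [muE pairE]] := charge_probability nu0 nu1.
have [rho rho0 hrho] : exists2 rho, 0 <= rho & K `<=` [set x : 'rV[R]_d | `|x| <= rho].
  have [B [_ hB]] := compact_bounded cK; exists (`|B| + 1); first by rewrite addr_ge0.
  by move=> x /hB; apply; rewrite (le_lt_trans (ler_norm _))// ltrDl.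
have mu0 := spt_null muE (subset_trans sptK hrho).
pose x0 := barycenter nu.
have mu_qc f : continuous f -> Aquasiconvex A f -> ((f x0)%:E <= \int[mu]_x (f x)%:E)%E.
  by move=> cf qf; rewrite -pairE; exact: nuqc.
have seqP n := cid2 (young_seq N0 cr rho0 mu0 mu_qc n).
pose phi n := s2val (seqP n); have Aphi n : Atrig A (phi n) := s2valP (seqP n).
have exc n : \int[P]_y excess rho (x0 + phi n y) <= n.+1%:R^-1 := (s2valP' (seqP n)).1.
have mom n := (s2valP' (seqP n)).2.
pose u n x := x0 + phi n (n.+1%:R *: x).
have Au n : Atrig A (fun x => phi n (n.+1%:R *: x)) by exact: Atrig_dilate.
have bx0 n : vbmeas (fun y => x0 + phi n y).
  by apply: vbmeasD; [exact: vbmeas_cst|exact: vbmeas_vtrig (Atrig_vtrig (Aphi n))].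
have bu n : vbmeas (u n) by exact: (vbmeas_dilate n.+1 (bx0 n)).
have per n : Defs.periodic (fun y => x0 + phi n y) := (Atrig_cst_smooth_torus x0 (Aphi n)).2.
(* As [enorm x <= d |x|], a value of [enorm] above [L] forces [|x| >= 2 (rho + 1)], where
   [|x| <= 2 * excess]. The summand 1 keeps [L] positive even when [d = 0]. *)
pose L := d%:R * (2 * (rho + 1)) + 1.
have L0 : 0 < L by rewrite ltr_wpDl// !mulr_ge0// addr_ge0.
have cexc : continuous (excess (R := R) (d := d) rho) by exact: lip_continuous (@excess_lip _ _ _).
have [] := ZL u L _ L0.
- by move=> n; split; [exact: vbmeas_L1|exact: kerA_Atrig_cst].
- apply: (@squeeze_cvge _ _ _ _ (cst 0%E) _ (fun n => (2 * d%:R * n.+1%:R^-1)%:E)); last first.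
  + apply/cvg_EFin; first by apply: nearW.
    rewrite -(mulr0 (2 * d%:R)); apply: cvgMl_tmp; exact: cvg_harmonic.
  + exact: cvg_cst.
  apply: nearW => n; rewrite tint_cond.
  have be := vbmeas_comp (bu n) (@continuous_enorm R d).
  have bif : bmeas (fun x => if L < enorm (u n x) then enorm (u n x) else 0).
    split; last first.
      have [_ [B hB]] := be; exists B => x; case: ifP => // _.
      by rewrite normr0 (le_trans _ (hB x)).
    apply: measurable_fun_ifT => //; last exact: be.1.
    apply: (measurable_fun_ltr (f := cst L)) => //; exact: be.1.
  rewrite tint_bmeas// !lee_fin; apply/andP; split.
    by apply: Rintegral_ge0 => x _; case: ifP => // _; exact: sqrtr_ge0.
  have bexc : bmeas (fun x => excess rho (x0 + phi n x)) by exact: (vbmeas_comp (bx0 n)).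
  have [mexc [B hB]] := bexc.
  have pexc : Defs.periodic (fun x => excess rho (x0 + phi n x)).
    by move=> x z; have := per n x z => /= ->.
  apply: (@le_trans _ _ (\int[P]_x (2 * d%:R * excess rho (u n x)))).
    have bxu : bmeas (fun x => excess rho (u n x)) by exact: (vbmeas_comp (bu n)).
    apply: bRint_le => //; first by apply: bmeasM => //; exact: bmeas_cst.
    move=> x; case: ifPn => h; last by rewrite !mulr_ge0// excess_ge0.
    have h1 := lt_le_trans h (enorm_le (u n x)).
    have dx : 2 * (rho + 1) <= `|u n x|.
      have := lt_le_trans (ltr_pwDr ltr01 (lexx _)) (ltW h1).
      move: `|u n x| => a; case: (posnP d) => [->|d0]; first by rewrite !mul0r ltxx.
      by rewrite ltr_pM2l ?ltr0n// => /ltW.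
    apply: le_trans (enorm_le _) _; rewrite -mulrA mulrCA ler_wpM2l//.
    exact: excess_ge.
  rewrite bRintZ; last exact: (vbmeas_comp (bu n)).
  rewrite ler_wpM2l ?mulr_ge0// (torus_scale (f := fun x => excess rho (x0 + phi n x)) _ mexc hB)//.
move=> v [vP vu]; exists v; split; first by move=> n; have [h1 [h2 _]] := vP n.
split; first by exists (C * L) => n; have [_ [_ h]] := vP n.
move=> f f0 g g1; have cf := C0_continuous f0; have [B B0 fB] := C0_bounded f0.
have mc := @measurable_cell R N.
(* Measurability of [v n] is given on the cell, so it is set to 0 elsewhere. *)
pose w n := (v n) \_ cell.
have mw n : measurable_fun setT (w n) by apply/(measurable_restrictT _ mc); exact: (vP n).1.1.
pose G := g \_ cell.
have wE n x : cell x -> w n x = v n x by move=> cx; rewrite /w patchE mem_set.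
have GE x : cell x -> G x = g x by move=> cx; rewrite /G patchE mem_set.
have iG : P.-integrable setT (EFin \o G).
  have [_] := (integrable_restr mc (@lebR_cell R N) _).1 g1.
  rewrite (_ : _ \_ _ = EFin \o G)//; apply/funext => x /=; rewrite /G !patchE.
  by case: ifP.
have mf := continuous_rV_measurable cf.
have bfw n : bmeas (fun x => f (w n x)).
  by split; [exact: (measurableT_comp mf (mw n))|exists B].
have bfu n : bmeas (fun x => f (u n x)) by exact: vbmeas_comp.
have ib (b : 'rV[R]_N -> R) : bmeas b -> P.-integrable setT (EFin \o (fun x => b x * G x)).
  move=> [mb [D hD]].
  have : P.-integrable setT (EFin \o (fun x => D * G x)) by exact: (integrableZl measurableT D iG).
  have mG : measurable_fun setT G by apply/measurable_EFinP; exact: measurable_int iG.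
  apply: le_integrable => //; first by apply/measurable_EFinP; exact: measurable_funM.
  by move=> x _ /=; rewrite lee_fin !normrM ler_wpM2r// (le_trans (hD x)) ?ler_norm.
have -> : (pairing nu f * tint g)%E = (\int[mu]_x (f x * cutoff rho x) * \int[P]_x G x)%:E.
  rewrite pairE (integral_cutoff mu0 cf) EFinM; congr (_ * _)%E.
  rewrite (@tint_ext _ _ g G); last by move=> x /GE.
  by rewrite tintE EFin_Rintegral.
have tE n : tint (fun x => f (v n x) * g x) =
    (\int[P]_x ((f (w n x) - f (u n x)) * G x) + \int[P]_x (f (u n x) * G x))%:E.
  rewrite (@tint_ext _ _ _ (fun x => f (w n x) * G x)); last by move=> x cx; rewrite wE// GE.
  rewrite tintE EFin_Rintegral; last exact: ib.
  rewrite -RintegralD//; [|exact: (ib _ (bmeasB (bfw n) (bfu n)))|exact: ib].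
  by congr EFin; apply: eq_Rintegral => x _; rewrite -mulrDl subrK.
under eq_cvg do rewrite tE.
apply/cvg_EFin; first by apply: nearW.
(* One summand is tested on a bounded difference that tends to 0 in L^1, and contributes nothing;
   the other involves a dilated sequence with convergent means. *)
rewrite -[X in _ --> X]add0r; apply: cvgD; last first.
  apply: (@oscillation_limit _ _ (fun n y => f (x0 + phi n y)) B) => //.
  - by move=> n; exact: (vbmeas_comp (bx0 n) cf).1.
  - by move=> n x z; have := per n x z => /= ->.
  apply/cvgrPdist_le => e e0; have e4 : 0 < e / 4 by rewrite divr_gt0.
  have [de de0 hde] := C0_unif f0 e4.
  have e5 : 0 < e / 2 / (3 * B) by rewrite !divr_gt0// mulr_gt0.
  have /(@cvgrPdist_le R R^o)/(_ _ de0) := @cvg_harmonic R.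
  have /(@cvgrPdist_le R R^o)/(_ _ e5) := @cvg_harmonic R.
  apply: filterS2 => n; rewrite sub0r normrN /= ger0_norm ?invr_ge0// => n1 n2.
  rewrite distrC; apply: le_trans (mom n f (e / 4) B cf (ltW e4) fB _) _.
    by move=> x y /le_trans/(_ n2); exact: hde.
  apply: (@le_trans _ _ (2 * (e / 4) + e / 2)); last by lra.
  rewrite lerD2l -ler_pdivlMl ?mulr_gt0// [leRHS]mulrC; exact: n1.
apply: (@weak_null _ _ (fun n x => f (w n x) - f (u n x)) (B + B)) => //.
- by move=> n; have [] := bmeasB (bfw n) (bfu n).
- by move=> n x; rewrite (le_trans (ler_normB _ _))// lerD.
apply/cvgrPdist_le => e e0; have e2 : 0 < e / 2 by rewrite divr_gt0.
have [D D0 hD] := C0_dist f0 e2.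
have eD : 0 < e / 2 / D by rewrite divr_gt0.
have /fine_cvgP[fin /cvgrPdist_le/(_ _ eD)] := vu.
move: fin; apply: filterS2 => n /=.
have -> : tint (fun x => enorm (v n x - u n x)) = (\int[P]_x (enorm (w n x - u n x))%:E)%E.
  by rewrite -tintE; apply: tint_ext => x cx; rewrite wE.
move=> fin; rewrite sub0r normrN /= => hn.
have me : measurable_fun setT (fun x => enorm (w n x - u n x)).
  apply: (measurableT_comp (continuous_rV_measurable (@continuous_enorm R d))).
  apply/measurable_rVP => i.
  rewrite (_ : (fun x => _) = (fun x => w n x ord0 i - u n x ord0 i)); last first.
    by apply/funext => x; rewrite !mxE.
  apply: measurable_funB; last exact: (bu n i).1.
  exact: (measurableT_comp (@measurable_coord R d i) (mw n)).
(* Integrability is read off the finiteness of the integral, which the convergence in (ZL)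
   guarantees for large [n]. *)
have ie : P.-integrable setT (EFin \o (fun x => enorm (w n x - u n x))).
  apply/integrableP; split; first exact/measurable_EFinP.
  rewrite -ge0_fin_numE; last exact: integral_ge0.
  by under eq_integral do rewrite /= ger0_norm ?sqrtr_ge0//.
rewrite sub0r normrN ger0_norm; last exact: Rintegral_ge0.
have iDe : P.-integrable setT (EFin \o (fun x => D * enorm (w n x - u n x))).
  exact: (integrableZl measurableT D ie).
have ic : P.-integrable setT (EFin \o (fun=> e / 2)).
  by apply: bmeas_integrable; exact: bmeas_cst.
apply: (@le_trans _ _ (\int[P]_x (e / 2 + D * enorm (w n x - u n x)))).
  apply: le_Rintegral => //.
  - by apply: bmeas_integrable; apply: bmeas_norm; exact: bmeasB.
  - exact: (integrableD measurableT ic iDe).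
  move=> x _; apply: le_trans (hD _ _) _; rewrite lerD2l ler_wpM2l ?(ltW D0)//.
  exact: norm_le_enorm.
rewrite RintegralD// Rintegral_prob_cst (RintegralZl D measurableT ie).
rewrite [leRHS](splitr e) lerD2l mulrC -ler_pdivlMr//; exact: le_trans (ler_norm _) hn.
Qed.

End quasiconvex_measures.

(** * From Young measures to quasiconvex measures *)

Section positivity.
Context (R : realType) (d : nat).

Lemma measure_tail (m : {finite_measure set 'rV[R]_d -> \bar R}) (e : R) : 0 < e ->
  exists n : nat, (m (~` [set x | `|x| <= n%:R])%R <= e%:E)%E.
Proof.
move=> e0; pose F n := ~` [set x : 'rV[R]_d | `|x| <= n%:R].
have mF n : measurable (F n) by apply: measurableC; exact: measurable_norm_le.
have F0 : \bigcap_n F n = set0.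
  apply/seteqP; split=> // x hx; apply: (hx (Num.truncn `|x|).+1 I) => /=.
  exact/ltW/truncnS_gt.
have cF : m \o F @ \oo --> m (\bigcap_n F n).
  apply: nonincreasing_cvg_mu => //.
  - by rewrite -ge0_fin_numE// fin_num_measure.
  - by rewrite F0.
  move=> i j ij; apply/subsetPset; apply: subsetC => x /= /le_trans; apply.
  by rewrite ler_nat.
move: cF; rewrite F0 measure0 => /fine_cvgP[fin /cvgrPdist_le/(_ _ e0)].
move=> /(filterI fin)/filter_ex[n []] fn; rewrite sub0r normrN => /= h; exists n.
by rewrite -[leLHS]fineK// lee_fin (le_trans (ler_norm _)).
Qed.

Definition bcont (h : 'rV[R]_d -> R) := continuous h /\ exists B : R, forall x, `|h x| <= B.

Lemma bcont_dense (m : {finite_measure set 'rV[R]_d -> \bar R}) (E : set 'rV[R]_d) (e : R) :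
  measurable E -> 0 < e ->
  exists2 h, bcont h & (\int[m]_x (`|\1_E x - h x|)%:E <= e%:E)%E.
Proof.
move=> mE e0.
have AAm h : bcont h -> measurable_fun setT h by move=> [/continuous_rV_measurable].
have AAb h : bcont h -> exists B : R, forall x, `|h x| <= B by case.
have AAc c : bcont (fun=> c).
  by split; [exact: cst_continuous|exists `|c|].
have AAD h g : bcont h -> bcont g -> bcont (fun x => h x + g x).
  move=> [ch [B hB]] [cg [C gC]]; split; first exact: continuous_add.
  by exists (B + C) => x; rewrite (le_trans (ler_normD _ _))// lerD.
have AAM h g : bcont h -> bcont g -> bcont (fun x => h x * g x).
  move=> [ch [B hB]] [cg [C gC]]; split; first exact: continuous_mul.
  by exists (B * C) => x; rewrite normrM ler_pM.
suff [_ /(_ _ e0)] : dense_in m bcont (\1_E) by [].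
apply: (dense_in_indic AAm AAb AAc AAD AAM (@measurable_rV_halfspaces R d)) => // _ [i [b ->]].
split; first exact: measurable_halfspace.
pose h (x : 'rV[R]_d) := ramp (x ord0 i - b).
have -> : [set x : 'rV[R]_d | b < x ord0 i] = [set x | 0 < h x].
  apply/seteqP; split=> x /=; rewrite /h /ramp.
    by rewrite -subr_gt0 => h1; rewrite leNgt h1 /=; case: ifP.
  by case: ifPn => [_|]; [rewrite ltxx|rewrite -ltNge subr_gt0].
have h01 x : 0 <= h x <= 1 by exact: ramp_01.
apply: (dense_in_gt0 m AAm AAc AAD AAM); last first.
  by move=> x; have /andP[h0 ->] := h01 x; rewrite andbT (le_trans _ h0)// lerN10.
split; last by exists 1 => x; have /andP[h0 h1] := h01 x; rewrite ger0_norm.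
apply: (@lip_continuous _ _ 1) => x y; rewrite mul1r; apply: le_trans (ramp_dist _ _) _.
rewrite opprB addrA subrK; have := coord_le_norm (x - y) i; by rewrite !mxE.
Qed.

(** The indicator of [E] is approximated in L^1 of the sum of the two Jordan parts, so that the
    errors of the two integrals are small together. *)
Lemma pairing_ge0 (nu : {charge set 'rV[R]_d -> \bar R}) :
  (forall f, C0 f -> (forall x, 0 <= f x) -> (0 <= pairing nu f)%E) ->
  forall E, measurable E -> (0 <= nu E)%E.
Proof.
rewrite /pairing; cbv zeta.
pose nuPN := projT2 (cid (projT2 (cid (Hahn_decomposition nu)))).
set p := jordan_pos _; set q := jordan_neg _ => pos E mE.
have nuE : nu E = (p E - q E)%E.
  by rewrite (jordan_decomp nuPN mE) /cadd/= /cscale/= mulN1e.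
have finm : fin_num_fun (measure_add p q).
  by move=> U mU; rewrite measure_addE fin_numD !fin_num_measure.
pose m : {finite_measure set 'rV[R]_d -> \bar R} :=
  HB.pack (Measure.sort (measure_add p q)) (Measure.class (measure_add p q))
    (Measure_isFinite.Build _ _ _ (Measure.sort (measure_add p q)) finm).
rewrite nuE sube_ge0 ?fin_num_measure//; apply/lee_addgt0Pr => e e0.
have e2 : 0 < e / 2 by rewrite divr_gt0.
have [h [ch _] hh] := bcont_dense m mE e2.
have [n hn] := measure_tail m e2.
(* [ramp] clips the approximant to [0,1] without increasing its distance to an indicator, and the
   cutoff at the tail radius puts it in [C0]. *)
pose f x := ramp (h x) * cutoff n%:R x.
have cr : continuous (fun x => ramp (h x)).
  move=> x; apply/(@cvgrPdist_lt R R^o _ _ (@nbhs_filter 'rV[R]_d x)) => t t0.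
  have /(@cvgrPdist_lt R R^o _ _ (@nbhs_filter 'rV[R]_d x) h (h x))/(_ _ t0) := ch x.
  by apply: filterS => y; apply: le_lt_trans; exact: ramp_dist.
have f01 x : 0 <= f x <= 1.
  have /andP[a0 a1] := ramp_01 (h x); have /andP[b0 b1] := cutoff_01 n%:R x.
  by rewrite /f mulr_ge0//= -[leRHS]mulr1 ler_pM.
have C0f : C0 f by exact: C0_cutoff.
have mf := continuous_rV_measurable (C0_continuous C0f).
have f0 x : 0 <= f x by have /andP[] := f01 x.
have mE1 : measurable_fun setT (\1_E : 'rV[R]_d -> R) by exact: measurable_indic.
have key (mm : {measure set 'rV[R]_d -> \bar R}) (g1 g2 : 'rV[R]_d -> R) :
    measurable_fun setT g1 -> measurable_fun setT g2 -> (forall x, 0 <= g1 x) ->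
    (forall x, 0 <= g2 x) ->
    (\int[mm]_x (g1 x)%:E <= \int[mm]_x (g2 x)%:E + \int[mm]_x (`|g1 x - g2 x|)%:E)%E.
  move=> m1 m2 p1 p2; have m12 := measurable_absB m1 m2.
  have M1 : measurable_fun setT (EFin \o g1) by exact/measurable_EFinP.
  have M2 : measurable_fun setT (EFin \o g2) by exact/measurable_EFinP.
  rewrite -ge0_integralD//; try by move=> x _; rewrite lee_fin.
  apply: ge0_le_integral => //; try by move=> x _; rewrite lee_fin.
    exact: emeasurable_funD.
  by move=> x _; rewrite -EFinD lee_fin -lerBlDl ler_norm.
have fin (mm : {finite_measure set 'rV[R]_d -> \bar R}) : (\int[mm]_x (f x)%:E \is a fin_num)%E.
  apply: integrable_fin_num => //; apply: measurable_bounded_integrable => //.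
    by rewrite -ge0_fin_numE// fin_num_measure.
  exists 1; split; first exact: num_real.
  by move=> M M1 x _ /=; rewrite ger0_norm// (le_trans _ (ltW M1))//; have /andP[] := f01 x.
have pq : (\int[q]_x (f x)%:E <= \int[p]_x (f x)%:E)%E.
  by rewrite -sube_ge0 ?fin//; exact: pos.
have hm : (\int[m]_x (`|\1_E x - f x|)%:E <= e%:E)%E.
  have M1 : measurable_fun setT (fun x => (`|\1_E x - h x|)%:E).
    by apply: measurable_absB => //; exact: continuous_rV_measurable.
  have mt := measurableC (@measurable_norm_le R d n%:R).
  have M2 : measurable_fun setT (fun x => (\1_(~` [set x : 'rV[R]_d | `|x| <= n%:R]) x)%:E : \bar R).
    by apply/measurable_EFinP; exact: measurable_indic.
  apply: (@le_trans _ _ (\int[m]_x ((`|\1_E x - h x|)%:E +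
      (\1_(~` [set x : 'rV[R]_d | `|x| <= n%:R]) x)%:E))%E).
    apply: ge0_le_integral => //.
    - exact: measurable_absB.
      - exact: emeasurable_funD.
    move=> x _; rewrite -EFinD lee_fin.
    have h1 : `|\1_E x - ramp (h x)| <= `|\1_E x - h x|.
      have e1 : \1_E x = ramp (\1_E x) :> R.
        by rewrite indicE; case: (x \in E); [rewrite ramp_ge1|rewrite ramp_le0].
      rewrite {1}e1; exact: ramp_dist.
    have h2 : `|ramp (h x) - f x| <= \1_(~` [set x : 'rV[R]_d | `|x| <= n%:R]) x.
      rewrite /f indicE; case: (boolP (x \in _)) => hx.
        have /andP[a0 a1] := ramp_01 (h x); have /andP[b0 b1] := cutoff_01 n%:R x.
        rewrite -{1}[ramp _]mulr1 -mulrBr normrM ger0_norm// ger0_norm ?subr_ge0//.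
        by rewrite -[leRHS]mulr1 ler_pM ?subr_ge0// lerBlDl lerDr.
      rewrite cutoff_eq1 ?mulr1 ?subrr ?normr0//.
      by move: hx; rewrite notin_setE/= => /contrapT.
    exact: le_trans (ler_distD (ramp (h x)) _ _) (lerD h1 h2).
  rewrite ge0_integralD//; try by move=> x _; rewrite lee_fin.
  rewrite integral_indic// setIT (splitr e) EFinD; exact: leeD.
move: hm; rewrite (ge0_integral_measure_add p q)//; last exact: measurable_absB.
have := key p _ _ mf mE1 f0 (fun x => ler0n _ _).
have := key q _ _ mE1 mf (fun x => ler0n _ _) f0.
rewrite !integral_indic// !setIT => hq hp hm.
apply: le_trans hq _; apply: le_trans (leeD2r _ (le_trans pq hp)) _.
rewrite -addeA leeD2l//; apply: le_trans hm; rewrite leeD2r//.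
by under eq_integral do rewrite distrC.
Qed.

End positivity.

(** * Jensen's inequality for limits of bounded solutions *)

Section young_measures.
Context (R : realType) (N d l : nat) (A : 'I_N -> 'M[R]_(d, l)).
Local Notation P := (torusP R N).
Local Notation cell := (@cell R N).

(** Quasiconvexity applies to the Fejer mean, which is the mean of [u] plus a test field. All values
    stay in the ball of radius [B], so [f] may be cut off outside it, and the affine modulus of
    [C0_dist] compares the Fejer mean with [u]. *)
Lemma kerA_jensen (f : 'rV[R]_d -> R) (u : 'rV[R]_N -> 'rV[R]_d) :
  continuous f -> Aquasiconvex A f -> vbmeas u -> kerA A u ->
  f (vmean u) <= \int[P]_x f (u x).
Proof.
move=> cf qf bu ku; have [B uB] := vbmeas_bounded bu.
have C0f := C0_cutoff B cf; pose F x := f x * cutoff B x.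
have FE x : `|x| <= B -> F x = f x by move=> h; rewrite /F cutoff_eq1// mulr1.
apply/ler_addgt0Pr => e e0; have e2 : 0 < e / 2 by rewrite divr_gt0.
have [C C1 hC] := C0_dist C0f e2.
have eC : 0 < e / 2 / C by rewrite divr_gt0.
have /cvgrPdist_le/(_ _ eC)/filter_ex[m] := vfejer_L1 bu.
rewrite sub0r normrN ger0_norm; last exact: Rintegral_ge0.
move=> hm; have [w Aw hw] := vfejer_Atrig m bu ku.
have bw := vbmeas_vtrig (Atrig_vtrig Aw).
have bv := vbmeas_vfejer m bu.
have h1 : f (vmean u) <= \int[P]_x F (vfejer m u x).
  have := qf (vmean u) w (vtrig_smooth_torus (Atrig_vtrig Aw)).
  rewrite tint_bmeas; last first.
    by apply: (vbmeas_comp (u := fun y => vmean u + w y)) => //; apply: vbmeasD => //; exact: vbmeas_cst.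
  rewrite lee_fin => h; apply: le_trans (h _ _) _.
  - by move=> i; rewrite tint_bmeas// (Atrig_mean i Aw).
  - by move=> y; exact: Atrig_free.
  rewrite le_eqVlt; apply/orP; left; apply/eqP; apply: eq_Rintegral => x _.
  by rewrite FE ?hw// -hw; exact: vfejer_bound.
apply: (le_trans h1).
have bF (v : 'rV[R]_N -> 'rV[R]_d) : vbmeas v -> bmeas (fun x => F (v x)).
  by move=> bv'; exact: vbmeas_comp bv' (C0_continuous C0f).
have bn : bmeas (fun x => C * `|vfejer m u x - u x|).
  by apply: bmeasM; [exact: bmeas_cst|apply: vbmeas_norm; exact: vbmeasB].
have be : bmeas (fun x => e / 2 + C * `|vfejer m u x - u x|).
  by apply: bmeasD => //; exact: bmeas_cst.
apply: (@le_trans _ _ (\int[P]_x (F (u x) + (e / 2 + C * `|vfejer m u x - u x|)))).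
  apply: bRint_le; [exact: bF|by apply: bmeasD => //; exact: bF|move=> x].
  by rewrite -lerBlDl (le_trans (ler_norm _))//; exact: hC.
rewrite bRintD//; last exact: bF.
have -> : \int[P]_x F (u x) = \int[P]_x f (u x) by apply: eq_Rintegral => x _; rewrite FE.
rewrite lerD2l bRintD//; last exact: bmeas_cst.
rewrite Rintegral_prob_cst bRintZ; last by apply: vbmeas_norm; exact: vbmeasB.
by rewrite [leRHS](splitr e) lerD2l mulrC -ler_pdivlMr.
Qed.

Lemma tint_ae (f g : 'rV[R]_N -> R) (E : set 'rV[R]_N) :
  measurable_fun setT f -> measurable_fun setT g -> measurable E -> P E = 0%E ->
  (forall x, cell x -> ~ E x -> f x = g x) -> tint f = tint g.
Proof.
move=> mf mg mE E0 fg; rewrite !tintE; apply: ae_eq_integral => //;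
  try by apply/measurable_EFinP.
have mc := @measurable_cell R N.
exists (E `|` ~` cell); split; first by apply: measurableU => //; exact: measurableC.
  by apply: null_set_setU => //; [exact: measurableC|exact: torusP_cell].
move=> x /= hx; apply: contrapT => /not_orP[nE /contrapT cx].
by apply: hx => _; rewrite fg.
Qed.

(* Changing [v] on a null set turns the essential bound into a pointwise one. *)
Lemma bounded_version (v : 'rV[R]_N -> 'rV[R]_d) (M : R) : L1 v -> kerA A v ->
  Linf_le v M ->
  exists w, [/\ vbmeas w, kerA A w, forall x, `|w x| <= `|M| &
    forall f, continuous f -> tint (fun x => f (v x)) = (\int[P]_x f (w x))%:E].
Proof.
move=> [mv _] kv /torusP_ae[E [mE E0 hE]]; have mc := @measurable_cell R N.
pose v' := v \_ cell.
have mv' : measurable_fun setT v' by exact/(measurable_restrictT _ mc).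
have vE x : cell x -> v' x = v x by move=> cx; rewrite /v' patchE mem_set.
pose w x := if enorm (v' x) <= `|M| then v' x else 0.
have mw : measurable_fun setT w.
  apply: measurable_fun_ifT => //; apply: measurable_fun_ler => //.
  exact: (measurableT_comp (continuous_rV_measurable (@continuous_enorm R d)) mv').
have wM x : `|w x| <= `|M|.
  by rewrite /w; case: ifP => h; rewrite ?normr0// (le_trans (norm_le_enorm _)).
have bw : vbmeas w.
  move=> i; split; first exact: (measurableT_comp (@measurable_coord R d i) mw).
  by exists `|M| => x; rewrite (le_trans (coord_le_norm _ _)).
have wE x : cell x -> ~ E x -> w x = v' x.
  by move=> cx nE; rewrite /w vE// (le_trans (hE x cx nE)) ?ler_norm.
exists w; split => //.
- move=> psi spsi; rewrite -[RHS](kv psi spsi).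
  pose T (u : 'rV[R]_N -> 'rV[R]_d) x :=
    \sum_k ((u x *m A k) *m ('D_(evec R k) psi x)^T) ord0 ord0.
  have mT u : measurable_fun setT u -> measurable_fun setT (T u).
    move=> mu; rewrite (_ : T u = fun x =>
      \sum_k \sum_j \sum_i A k i j * (u x ord0 i * 'D_(evec R k) psi x ord0 j)).
      apply: measurable_sum => k; apply: measurable_sum => j; apply: measurable_sum => i.
      apply: measurable_funM => //; apply: measurable_funM.
        exact: (measurableT_comp (@measurable_coord R d i) mu).
      exact: (bmeas_smooth_coord j (smooth_torus_derive (evec R k) spsi)).1.
    apply/funext => x; apply: eq_bigr => k _; rewrite mxE; apply: eq_bigr => j _.
    by rewrite !mxE mulr_suml; apply: eq_bigr => i _; ring.
  rewrite (@tint_ext _ _ (T v) (T v')); last by move=> x cx; rewrite /T vE.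
  apply: (@tint_ae (T w) (T v') E); [exact: mT|exact: mT|by []|by []|].
  by move=> x cx nE; rewrite /T wE.
move=> f cf; have mf := continuous_rV_measurable cf.
rewrite -tint_bmeas; last exact: vbmeas_comp.
rewrite (@tint_ext _ _ _ (fun x => f (v' x))); last by move=> x cx; rewrite vE.
apply: (@tint_ae _ _ E) => //.
- exact: (measurableT_comp mf mv').
- exact: (measurableT_comp mf mw).
by move=> x cx nE; rewrite wE.
Qed.

Lemma H_A_sub_M_Aqc (K : set 'rV[R]_d) : compact K -> H_A A K `<=` M_Aqc A K.
Proof.
move=> cK nu [[v [vP [[M vM] vlim]]] sptK].
have t1 : tint (fun _ : 'rV[R]_N => 1) = 1%E.
  by rewrite tint_bmeas ?Rintegral_prob_cst//; exact: bmeas_cst.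
have L11 : L1R (fun _ : 'rV[R]_N => 1 : R).
  have mc := @measurable_cell R N.
  apply/(integrable_restr mc (@lebR_cell R N)); split => //.
  apply/(integrable_mkcond _ mc); apply: (integrableS measurableT) => //.
  by apply: bmeas_integrable; exact: bmeas_cst.
have wP j := cid (bounded_version (vP j).1 (vP j).2 (vM j)).
pose w j := sval (wP j).
have bw j : vbmeas (w j) by have [] := svalP (wP j).
have kw j : kerA A (w j) by have [] := svalP (wP j).
have wM j x : `|w j x| <= `|M| by have [_ _ h _] := svalP (wP j); exact: h.
have tw j f : continuous f -> tint (fun x => f (v j x)) = (\int[P]_x f (w j x))%:E.
  by have [_ _ _ h] := svalP (wP j); exact: h.
(* Testing the weak convergence with the constant 1 turns it into convergence of integrals. *)
have lim f : C0 f -> (\int[P]_x f (w j x))%:E @[j --> \oo] --> pairing nu f.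
  move=> f0; have := vlim f f0 _ L11; rewrite t1 mule1.
  under eq_cvg do under eq_fun do rewrite mulr1.
  by under eq_cvg do rewrite (tw _ _ (C0_continuous f0)).
have nu0 : forall B, measurable B -> (0 <= nu B)%E.
  apply: pairing_ge0 => f f0 fge0; apply: (cvge_to_ge (lim f f0)).
  by apply: nearW => j; rewrite lee_fin; exact: Rintegral_ge0.
have cut1 (r : R) : `|M| <= r -> pairing nu (fun x => 1 * cutoff r x) = 1%E.
  move=> hr; have := lim _ (C0_cutoff r (@cst_continuous 'rV[R]_d R^o 1)).
  have E j : \int[P]_x (1 * cutoff r (w j x)) = 1.
    rewrite -[RHS](Rintegral_prob_cst P); apply: eq_Rintegral => x _.
    by rewrite mul1r cutoff_eq1// (le_trans (wM j x)).
  under eq_cvg do rewrite E.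
  by move=> h; apply: cvg_unique h _ => //; exact: cvg_cst.
(* No mass escapes: all [w j] take values in a fixed ball, so wide cutoffs have pairing 1 with [nu],
   and they differ from 1 only on a tail of small measure. *)
have nu1 : nu setT = 1%E.
  have [m [mE pairE]] := charge_finite_measure nu0.
  have mcut r : measurable_fun setT (fun x : 'rV[R]_d => (1 * cutoff r x)%:E).
    apply/measurable_EFinP; apply: continuous_rV_measurable.
    exact: C0_continuous (C0_cutoff r (@cst_continuous 'rV[R]_d R^o 1)).
  have c01 r (x : 'rV[R]_d) := cutoff_01 r x.
  rewrite -mE//; apply: le_anti; apply/andP; split.
    apply/lee_addgt0Pr => e e0; have [n hn] := measure_tail m e0.
    pose r := Num.max `|M| n%:R.
    rewrite -(cut1 r) ?le_max ?lexx// pairE.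
    have mt := measurableC (@measurable_norm_le R d r).
    apply: (@le_trans _ _ (\int[m]_x ((1 * cutoff r x)%:E +
        (\1_(~` [set x : 'rV[R]_d | `|x| <= r]) x)%:E))%E).
      rewrite -[leLHS]mul1e -(integral_cst m measurableT 1).
      apply: ge0_le_integral => //.
        by apply: emeasurable_funD => //; apply/measurable_EFinP; exact: measurable_indic.
      move=> x _; rewrite -EFinD lee_fin mul1r indicE; case: (boolP (x \in _)) => hx.
        by rewrite lerDr; have /andP[] := c01 r x.
      rewrite cutoff_eq1 ?addr0//.
      by move: hx; rewrite notin_setE/= => /contrapT.
    have c0 (x : 'rV[R]_d) : setT x -> (0 <= (1 * cutoff r x)%:E)%E.
      by rewrite mul1r lee_fin; have /andP[] := c01 r x.
    have mi : measurable_fun setT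
        (fun x => (\1_(~` [set x : 'rV[R]_d | `|x| <= r]) x)%:E : \bar R).
      by apply/measurable_EFinP; exact: measurable_indic.
    rewrite ge0_integralD//.
    rewrite integral_indic// setIT leeD2l//; apply: le_trans hn.
    apply: le_measure; [by rewrite inE| |].
      by rewrite inE; apply: measurableC; exact: measurable_norm_le.
    by apply: subsetC => x /= /le_trans; apply; rewrite le_max lexx orbT.
  rewrite -(cut1 `|M|)// pairE -[leRHS]mul1e -(integral_cst m measurableT 1).
  apply: ge0_le_integral => //.
  - by move=> x _; rewrite mul1r lee_fin; have /andP[] := c01 `|M| x.
  - by move=> x _; rewrite mul1r lee_fin; have /andP[] := c01 `|M| x.
split => //; split => // f cf qf.
have [mu [muE pairE]] := charge_probability nu0 nu1.
have [rho rho0 hrho] : exists2 rho, `|M| <= rho & K `<=` [set x : 'rV[R]_d | `|x| <= rho].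
  have [B [_ hB]] := compact_bounded cK; exists (`|M| + `|B| + 1).
    by rewrite -addrA lerDl addr_ge0.
  move=> x /hB; apply; rewrite (le_lt_trans (ler_norm _))// (@le_lt_trans _ _ (`|M| + `|B|))//.
    by rewrite lerDr.
  by rewrite ltrDl.
have mu0 := spt_null muE (subset_trans sptK hrho).
(* [g * cutoff rho] is in [C0] and agrees with [g] at all values of [w j], since [rho >= |M|]. *)
have mom g : continuous g -> (\int[P]_x g (w j x)) @[j --> \oo] -->
    \int[mu]_x (g x * cutoff rho x).
  move=> cg; have := lim _ (C0_cutoff rho cg).
  rewrite pairE bRint_EFin; last exact: bmeas_cutoff.
  move=> /fine_cvgP[_]; apply: cvg_trans; apply: near_eq_cvg; apply: nearW => j /=.
  by apply: eq_Rintegral => x _; rewrite cutoff_eq1 ?mulr1// (le_trans (wM j x)).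
(* Coordinates are continuous, so convergence of moments contains that of the means. *)
have mean : vmean (w j) @[j --> \oo] --> barycenter nu.
  apply/cvgrPdist_le => e e0.
  have h (i : 'I_d) : \forall j \near \oo, `|barycenter nu ord0 i - vmean (w j) ord0 i| <= e.
    have ci : continuous (fun x : 'rV[R]_d => x ord0 i) by exact: coord_continuous.
    have /cvgrPdist_le/(_ _ e0) := mom _ ci.
    by apply: filterS => j; rewrite !mxE pairE (integral_cutoff mu0 ci).
  have : \forall j \near \oo, forall i : 'I_d,
      `|barycenter nu ord0 i - vmean (w j) ord0 i| <= e by exact: filter_forall.
  apply: filterS => j hj.
  by rewrite norm_rV_le ?(ltW e0)//; apply/forallP => i; rewrite !mxE; have := hj i; rewrite !mxE.
rewrite pairE (integral_cutoff mu0 cf) lee_fin.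
have fm : f (vmean (w j)) @[j --> \oo] --> f (barycenter nu).
  by apply: continuous_cvg mean; exact: cf.
apply: (ler_cvg_to fm (mom f cf)); apply: nearW => j; exact: kerA_jensen.
Qed.

End young_measures.

Theorem theorem5p14 (R : realType) (N d l : nat)
    (A : 'I_N -> 'M[R]_(d, l)) (K : set 'rV[R]_d) :
  (0 < N)%N ->
  constant_rank A ->
  propZL A ->
  compact K ->
  H_A A K = M_Aqc A K.
Proof.
move=> N0 cr ZL cK; apply/seteqP; split; first exact: H_A_sub_M_Aqc.
exact: M_Aqc_sub_H_A.
Qed.
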